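(* Let $0\le\alpha<1$ and let $h\in L^2(\mathbb{T})$ be a non-negative function with $\int_{-\pi}^{\pi}\log h(t)\,dt>-\infty$ such that the outer function $O_h$ is bounded and bounded away from zero on $\mathbb{D}$. Then $O_h\in\mathcal{D}_\alpha$ if and only if $N_\alpha(h)<\infty$.
   Context: $\mathbb{D}$ is the open unit disk, $\mathbb{T}=\partial\mathbb{D}$; a function $h$ on $\mathbb{T}$ is identified with $h(t):=h(e^{it})$. The outer function associated with $h$ is $$O_h(z):=\exp\Big(\frac1{2\pi}\int_{-\pi}^{\pi}\frac{e^{i\varphi}+z}{e^{i\varphi}-z}\log h(\varphi)\,d\varphi\Big),\quad z\in\mathbb{D}.$$ $\mathcal{D}_\alpha$ is the space of analytic functions $f$ on $\mathbb{D}$ with $\mathcal{D}_\alpha(f):=\frac1\pi\int_{\mathbb{D}}|f'(z)|^2(1-|z|)^\alpha dA(z)<\infty$, where $A$ is area Lebesgue measure. Moreover $$N_\alpha(h):=\int_{-\pi}^{\pi}\int_{-\pi}^{\pi}\frac{|h(\varphi)-h(\theta)|^2}{|e^{i\varphi}-e^{i\theta}|^{2-\alpha}}\,d\varphi\, d\theta.$$ *)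

(* Defs.v *)
From mathcomp Require Export all_boot all_order all_algebra.
From mathcomp Require Export all_classical all_reals all_analysis.
From mathcomp Require Export complex.

Set Implicit Arguments.
Unset Strict Implicit.
Unset Printing Implicit Defensive.

Import Order.TTheory GRing.Theory Num.Theory.
Import numFieldNormedType.Exports.
Import Normc.

Local Open Scope classical_set_scope.
Local Open Scope ring_scope.
Local Open Scope complex_scope.

Section Defs.
Context {R : realType}.
Implicit Types (h : R[i] -> R) (f : R[i] -> R[i]) (z : R[i]) (alpha : R).

Definition unit_disk : set R[i] := [set z | normc z < 1].

Definition expi (t : R) : R[i] := cos t +i* sin t.

Definition cexp z : R[i] := (expR (complex.Re z))%:C * expi (complex.Im z).

Definition arc : set R := `[- pi, pi].

(* Functions on the circle are functions on the plane of which only the values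
   on the circle are ever used. *)
Definition L2circle h : Prop :=
  measurable_fun arc (h \o expi) /\
  (\int[lebesgue_measure]_(t in arc) (`|h (expi t)| ^+ 2)%:E < +oo)%E.

Definition ae_nonneg h : Prop :=
  {ae lebesgue_measure, forall t : R, arc t -> 0 <= h (expi t)}.

(* lne 0 = -oo, and the integral of a function with integrable positive part
   and non-integrable negative part is -oo. *)
Definition log_integral h : \bar R :=
  (\int[lebesgue_measure]_(t in arc) lne (h (expi t))%:E)%E.

Definition arc_cintegral (g : R -> R[i]) : R[i] :=
  Rintegral lebesgue_measure arc (fun t => complex.Re (g t)) +i*
  Rintegral lebesgue_measure arc (fun t => complex.Im (g t)).

(* ln 0 = 0 is harmless here: a finite log_integral forces h > 0 a.e. *)
Definition outer h z : R[i] :=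
  cexp (((2 * pi)^-1)%:C *
    arc_cintegral (fun t =>
      (expi t + z) / (expi t - z) * (ln (h (expi t)))%:C)).

Definition bounded_on_disk f : Prop :=
  exists M : R, forall z, unit_disk z -> normc (f z) <= M.

Definition bounded_away_from_zero_on_disk f : Prop :=
  exists2 m : R, 0 < m & forall z, unit_disk z -> m <= normc (f z).

(* The regular module R[i]^o carries the topology and norm of the field R[i]. *)
Definition analytic_on_disk f : Prop :=
  forall z, unit_disk z -> derivable (f : R[i]^o -> R[i]^o) z 1.

Definition cderiv f z : R[i] := 'D_1 (f : R[i]^o -> R[i]^o) z.

Definition dirichlet_integral alpha f : \bar R :=
  ((pi^-1)%:E *
   \int[lebesgue_measure \x lebesgue_measure]_(p in
       [set p : R * R | unit_disk (p.1 +i* p.2)])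
     ((normc (cderiv f (p.1 +i* p.2))) ^+ 2 *
      (1 - normc (p.1 +i* p.2)) `^ alpha)%:E)%E.

Definition dirichlet_space alpha : set (R[i] -> R[i]) :=
  [set f | analytic_on_disk f /\ (dirichlet_integral alpha f < +oo)%E].

(* On the diagonal, 0 / 0 = 0. *)
Definition Nseminorm alpha h : \bar R :=
  (\int[lebesgue_measure]_(t in arc) \int[lebesgue_measure]_(s in arc)
    (`|h (expi t) - h (expi s)| ^+ 2 /
     (normc (expi t - expi s)) `^ (2 - alpha))%:E)%E.

End Defs.

(* Main.v *)
Require Import Defs.
From HB Require Import structures.
From mathcomp Require Import ring lra measurable_realfun.
Set Implicit Arguments.
Unset Strict Implicit.
Unset Printing Implicit Defensive.
Import Order.TTheory GRing.Theory Num.Theory.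
Import numFieldNormedType.Exports.
Import Normc.
Local Open Scope classical_set_scope.
Local Open Scope ring_scope.
Local Open Scope complex_scope.

(* Let u = log h, which is integrable, let c_n be its Fourier coefficients and
   F = c_0 + 2 sum c_n z^n its Herglotz integral, so that the outer function is
   O = exp F.  Fatou's theorem on radial limits turns m <= |O| <= M into
   log m <= u <= log M almost everywhere; hence exp is bi-Lipschitz on the values
   of u, and N(h) is finite iff N(u) is; similarly O' = F' O shows that the
   Dirichlet integrals of O and F are finite together.
   Both remaining quantities are weighted sums of |c_n|^2.  Averaging over
   rotations and Parseval give
     int |F'|^2 (1 - |z|)^alpha = sum 4 n^2 |c_n|^2 int |z|^(2n-2) (1 - |z|)^alpha,
   and N(u) is, up to a constant, sum |c_n|^2 int |e^(int) - 1|^2 / |e^(it) - 1|^(2-alpha)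
   (Bessel's inequality for the lower bound; Parseval on smaller circles and
   Fatou's lemma for the upper one).  The two moments are of order n^(-1-alpha)
   and n^(1-alpha). *)

(** * Invariance of plane Lebesgue measure *)

Section translation.
Context {R : realType}.
Local Notation mu := (@lebesgue_measure R).

Lemma lebesgue_measure_shift (a : R) (A : set R) : measurable A ->
  pushforward mu (fun x : R => x + a : measurableTypeR R) A = mu A.
Proof.
move=> mA.
have mf : measurable_fun setT (fun x : R => x + a : measurableTypeR R).
  exact: measurable_funD.
pose f : {mfun R >-> measurableTypeR R} := HB.pack (fun x : R => x + a : measurableTypeR R) (isMeasurableFun.Build _ _ _ _ _ mf).
apply/esym/(@lebesgue_measure_unique R (pushforward mu f)) => //= _ [[c d]] _ <-.
rewrite /pushforward /=.
rewrite (_ : _ @^-1` _ = `]c - a, d - a]%classic); last first.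
  by apply/seteqP; split => x /=; rewrite !in_itv/= ltrBlDr lerBrDr.
by rewrite !lebesgue_measure_itv/= !lte_fin ltrD2r; case: ifP => // _; rewrite -!EFinD; congr EFin; ring.
Qed.

Lemma ge0_integral_shift (a : R) (f : R -> \bar R) :
  measurable_fun setT f -> (forall x, 0 <= f x)%E ->
  (\int[mu]_x f (x + a)%R = \int[mu]_x f x)%E.
Proof.
move=> mf f0.
transitivity (\int[pushforward mu (fun x : R => (x + a)%R : measurableTypeR R)]_x f x)%E.
  by rewrite ge0_integral_pushforward //=; exact: measurable_funD.
apply: eq_measure_integral => [|? A mA _]; first exact: measurable_funD.
exact: lebesgue_measure_shift.
Qed.

Lemma lebesgue_measure_scale (a : R) (A : set R) : 0 < a -> measurable A ->
  (a%:E * pushforward mu (fun x : R => (a * x)%R : measurableTypeR R) A = mu A)%E.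
Proof.
move=> a0 mA.
have mf : measurable_fun setT (fun x : R => a * x : measurableTypeR R).
  exact: measurable_funM.
pose f : {mfun R >-> measurableTypeR R} := HB.pack (fun x : R => a * x : measurableTypeR R) (isMeasurableFun.Build _ _ _ _ _ mf).
apply/esym/(@lebesgue_measure_unique R (mscale (NngNum (ltW a0)) (pushforward mu f))) => //= _ [[c d]] _ <-.
rewrite /mscale /= /pushforward.
rewrite (_ : _ @^-1` _ = `]c / a, d / a]%classic); last first.
  by apply/seteqP; split => x /=; rewrite !in_itv/= ltr_pdivrMr// ler_pdivlMr// ![x * _]mulrC.
rewrite !lebesgue_measure_itv/= !lte_fin ltr_pM2r ?invr_gt0//.
case: ifP => _; last by rewrite mule0.
by rewrite -!EFinD -EFinM; congr EFin; field; exact: lt0r_neq0.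
Qed.

Lemma ge0_integral_scale (a : R) (f : R -> \bar R) : 0 < a ->
  measurable_fun setT f -> (forall x, 0 <= f x)%E ->
  (a%:E * \int[mu]_x f (a * x)%R = \int[mu]_x f x)%E.
Proof.
move=> a0 mf f0.
have mF : measurable_fun setT (fun x : R => a * x : measurableTypeR R).
  exact: measurable_funM.
unshelve epose (m := pushforward mu (fun x : R => (a * x)%R : measurableTypeR R)
  : {measure set (measurableTypeR R) -> \bar R}); first exact: mF.
transitivity (\int[mscale (NngNum (ltW a0)) m]_x f x)%E.
  by rewrite ge0_integral_mscale//= ge0_integral_pushforward.
by apply: eq_measure_integral => A mA _; exact: lebesgue_measure_scale.
Qed.

End translation.

Section plane.
Context {R : realType}.
Local Notation mu := (@lebesgue_measure R).
Local Notation mu2 := (mu \x mu)%E.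
Implicit Types f : R * R -> \bar R.

Let T : measurableType _ := (measurableTypeR R * measurableTypeR R)%type.

Lemma tonelli_xy f : measurable_fun (setT : set T) f -> (forall x, 0 <= f x)%E ->
  (\int[mu2]_p f p = \int[mu]_x \int[mu]_y f (x, y))%E.
Proof. move=> mf f0; exact: (@fubini_tonelli1 _ _ _ _ R mu mu f mf f0). Qed.

Lemma tonelli_yx f : measurable_fun (setT : set T) f -> (forall x, 0 <= f x)%E ->
  (\int[mu2]_p f p = \int[mu]_y \int[mu]_x f (x, y))%E.
Proof.
move=> mf f0; rewrite (tonelli_xy mf f0).
exact: (@fubini_tonelli _ _ _ _ R mu mu f mf f0).
Qed.

Lemma measurable_integral_y f : measurable_fun (setT : set T) f ->
  (forall x, 0 <= f x)%E ->
  measurable_fun setT (fun x => \int[mu]_y f (x, y))%E.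
Proof. move=> mf f0; exact: (@measurable_fun_fubini_tonelli_F _ _ _ _ R mu f mf f0). Qed.

Lemma integral_shearx (a : R) f : measurable_fun (setT : set T) f ->
  (forall x, 0 <= f x)%E ->
  (\int[mu2]_p f (p.1 + a * p.2, p.2)%R = \int[mu2]_p f p)%E.
Proof.
move=> mf f0.
have mg : measurable_fun (setT : set T) (fun p : T => f (p.1 + a * p.2, p.2)%R).
  apply: (measurableT_comp mf); apply: measurable_fun_pair => //.
  apply: measurable_funD => //. apply: measurable_funM => //.
rewrite (tonelli_yx mg (fun=> f0 _)) (tonelli_yx mf f0).
apply: eq_integral => y _.
rewrite -(ge0_integral_shift (a * y) (f := fun x => f (x, y)))//.
by apply: (measurableT_comp mf); exact: measurable_fun_pair.
Qed.

Lemma integral_sheary (a : R) f : measurable_fun (setT : set T) f ->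
  (forall x, 0 <= f x)%E ->
  (\int[mu2]_p f (p.1, p.2 + a * p.1)%R = \int[mu2]_p f p)%E.
Proof.
move=> mf f0.
have mg : measurable_fun (setT : set T) (fun p : T => f (p.1, p.2 + a * p.1)%R).
  apply: (measurableT_comp mf); apply: measurable_fun_pair => //.
  apply: measurable_funD => //. apply: measurable_funM => //.
rewrite (tonelli_xy mg (fun=> f0 _)) (tonelli_xy mf f0).
apply: eq_integral => x _.
rewrite -(ge0_integral_shift (a * x) (f := fun y => f (x, y)))//.
by apply: (measurableT_comp mf); exact: measurable_fun_pair.
Qed.

(* A rotation is the product of three shears. *)
Lemma integral_rotation (t : R) f : measurable_fun (setT : set T) f ->
  (forall x, 0 <= f x)%E -> -pi < t < pi ->
  (\int[mu2]_p f (cos t * p.1 - sin t * p.2, sin t * p.1 + cos t * p.2)%R =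
   \int[mu2]_p f p)%E.
Proof.
move=> mf f0 tpi.
pose s := t / 2.
have c0 : cos s != 0.
  rewrite gt_eqF//; apply: cos_gt0_pihalf; rewrite /s; move: tpi; lra.
have ts : t = s *+ 2 by rewrite /s; lra.
pose a := - (sin s / cos s).
have h1 := cos2Dsin2 s.
have ea : a * cos s = - sin s by rewrite /a mulNr divfK.
have es : sin t = sin s * cos s *+ 2 by rewrite ts sin_mulr2n mulrC.
have ec : cos t = cos s ^+ 2 - sin s ^+ 2 by rewrite ts cos_mulr2n -h1; ring.
have e1 : 1 + a * sin t = cos t.
  rewrite ec es -{1}h1 /a; field.
  exact: c0.
have e2 : a * (1 + cos t) = - sin t.
  by rewrite ec es -{1}h1 /a; field.
rewrite -(integral_shearx a mf f0).
rewrite -(integral_sheary (sin t) (f := fun p => f (p.1 + a * p.2, p.2)%R))//; last first.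
  apply: (measurableT_comp mf); apply: measurable_fun_pair => //.
  by apply: measurable_funD => //; exact: measurable_funM.
rewrite -(integral_shearx a (f := fun p => f (p.1 + a * (p.2 + sin t * p.1), p.2 + sin t * p.1)%R))//; last first.
  apply: (measurableT_comp mf); apply: measurable_fun_pair => //.
    apply: measurable_funD => //; apply: measurable_funM => //.
    by apply: measurable_funD => //; exact: measurable_funM.
  by apply: measurable_funD => //; exact: measurable_funM.
apply: eq_integral => -[x y] _ /=; congr (f (_, _)).
- by transitivity (cos t * x + a * (1 + cos t) * y); [rewrite e2; ring | rewrite -e1; ring].
- by rewrite -e1; ring.
Qed.

Lemma integral_plane_scale (a : R) f : 0 < a -> measurable_fun (setT : set T) f ->
  (forall x, 0 <= f x)%E ->
  ((a ^+ 2)%:E * \int[mu2]_p f (a * p.1, a * p.2)%R = \int[mu2]_p f p)%E.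
Proof.
move=> a0 mf f0.
have mg : measurable_fun (setT : set T) (fun p : T => f (a * p.1, a * p.2)%R).
  apply: (measurableT_comp mf); apply: measurable_fun_pair => //; exact: measurable_funM.
have mh : measurable_fun (setT : set T) (fun p : T => f (p.1, a * p.2)%R).
  apply: (measurableT_comp mf); apply: measurable_fun_pair => //; exact: measurable_funM.
rewrite (tonelli_xy mg (fun=> f0 _)) (tonelli_xy mf f0).
rewrite -[RHS](ge0_integral_scale a0 (measurable_integral_y mf f0)); last first.
  by move=> x; apply: integral_ge0.
rewrite expr2 EFinM -muleA; congr (_ * _)%E.
rewrite -ge0_integralZl//.
- apply: eq_integral => x _.
  rewrite -(ge0_integral_scale a0 (f := fun y => f (a * x, y)%R))//.
  by apply: (measurableT_comp mf); exact: measurable_fun_pair.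
- exact: (measurable_integral_y mg).
- by move=> x _; apply: integral_ge0.
- by rewrite lee_fin ltW.
Qed.

End plane.

(** * Radial integrals and moments of the disk *)

Section radial.
Context {R : realType}.
Local Notation mu := (@lebesgue_measure R).
Local Notation mu2 := (mu \x mu)%E.
Let T : measurableType _ := (measurableTypeR R * measurableTypeR R)%type.

Lemma lebesgue2_setX (A B : set R) : measurable A -> measurable B ->
  mu2 (A `*` B) = (mu A * mu B)%E.
Proof. by move=> mA mB; exact: (@product_measure1E _ _ _ _ _ mu mu). Qed.

Definition sqnorm (p : R * R) : R := p.1 ^+ 2 + p.2 ^+ 2.

Lemma measurable_sqnorm : measurable_fun (setT : set T) sqnorm.
Proof. by apply: measurable_funD => //; apply: measurable_funX. Qed.

Lemma sqnorm_ge0 p : 0 <= sqnorm p.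
Proof. by rewrite addr_ge0// sqr_ge0. Qed.

Lemma measurable_sqnorm_preimage (A : set R) : measurable A ->
  measurable (sqnorm @^-1` A : set T).
Proof.
by move=> mA; rewrite -[X in measurable X]setTI; apply: measurable_sqnorm.
Qed.

Definition disk_area : \bar R := mu2 [set p | sqnorm p <= 1].

Lemma measurable_disk_le (b : R) : measurable ([set p | sqnorm p <= b] : set T).
Proof.
rewrite (_ : [set p | _] = sqnorm @^-1` `]-oo, b]); first exact: measurable_sqnorm_preimage.
by apply/seteqP; split => p /=; rewrite in_itv.
Qed.

Lemma disk_area_fin_num : disk_area \is a fin_num.
Proof.
rewrite ge0_fin_numE ?measure_ge0//.
apply: (@le_lt_trans _ _ (mu2 (`[-1, 1]%classic `*` `[-1, 1]%classic))).
  apply: le_measure; rewrite ?inE.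
  - exact: measurable_disk_le.
  - exact: measurableX.
  - move=> [x y]; rewrite /sqnorm/= !in_itv/= => xy.
    have := sqr_ge0 x; have := sqr_ge0 y.
    by split; nra.
by rewrite lebesgue2_setX// !lebesgue_measure_itv/= lte_fin; case: ifP; rewrite ?mule0 ?mul0e ?ltry// -EFinM ltry.
Qed.

Lemma disk_area_gt0 : (0 < disk_area)%E.
Proof.
apply: (@lt_le_trans _ _ (mu2 (`[0, 2^-1]%classic `*` `[0, 2^-1]%classic))).
  rewrite lebesgue2_setX// !lebesgue_measure_itv/= lte_fin invr_gt0 ltr0n/=.
  by rewrite -EFinM lte_fin subr0 mulr_gt0.
apply: le_measure; rewrite ?inE.
- exact: measurableX.
- exact: measurable_disk_le.
- move=> [x y]; rewrite /sqnorm/= !in_itv/= => -[/andP[? ?] /andP[? ?]].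
  by nra.
Qed.

Lemma disk_le_area (b : R) : 0 <= b ->
  mu2 [set p | sqnorm p <= b] = (b%:E * disk_area)%E.
Proof.
rewrite le_eqVlt => /predU1P[<-|b0].
  rewrite mul0e (_ : [set p | _] = [set 0] `*` [set 0]).
    by rewrite lebesgue2_setX// lebesgue_measure_set1 mul0e.
  apply/seteqP; split => -[x y]; rewrite /sqnorm/=.
    move=> h; have := sqr_ge0 x; have := sqr_ge0 y => hy hx.
    by split; apply/eqP; rewrite -sqrf_eq0 eq_le; apply/andP; split; lra.
  by move=> [-> ->]; rewrite expr0n/= addr0.
rewrite /disk_area.
have mI c : measurable_fun (setT : set T) (fun p => (\1_([set p : R * R | sqnorm p <= c]) p : R)%:E).
  apply/measurable_EFinP; apply: measurable_indic; exact: measurable_disk_le.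
have := @integral_plane_scale R (Num.sqrt b) (fun p => (\1_([set p : R * R | sqnorm p <= b]) p : R)%:E).
rewrite sqrtr_gt0 => /(_ b0 (mI b)) => /(_ ltac:(by move=> p; rewrite lee_fin)).
rewrite sqr_sqrtr 1?ltW// => h.
rewrite -[LHS]mul1e.
transitivity (\int[mu2]_p (\1_([set p : R * R | sqnorm p <= b]) p : R)%:E)%E.
  by rewrite integral_indic ?setIT ?mul1e//; exact: measurable_disk_le.
rewrite -h; congr (_ * _)%E.
transitivity (\int[mu2]_p (\1_([set p : R * R | sqnorm p <= 1]) p : R)%:E)%E; last first.
  by rewrite integral_indic ?setIT//; exact: measurable_disk_le.
apply: eq_integral => p _; congr EFin; rewrite !indicE; congr (_%:R); congr nat_of_bool.
have e : sqnorm (Num.sqrt b * p.1, Num.sqrt b * p.2) = b * sqnorm p.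
  by rewrite /sqnorm/= !exprMn sqr_sqrtr ?ltW// mulrDr.
apply/idP/idP => /set_mem H; apply/mem_set; move: H => /=; rewrite e.
  by move=> H; rewrite -(ler_pM2l b0) mulr1.
by move=> H; rewrite -[leRHS]mulr1 ler_pM2l.
Qed.

Lemma radial_itv (a b : R) : a <= b ->
  mu2 (sqnorm @^-1` `]a, b]) = ((Num.max b 0 - Num.max a 0)%:E * disk_area)%E.
Proof.
move=> ab.
have [b0|b0] := ltP b 0.
  rewrite max_r ?(le_trans ab (ltW b0))// subrr mul0e.
  rewrite (_ : _ @^-1` _ = set0) ?measure0//.
  apply/seteqP; split => // p /=; rewrite in_itv/= => /andP[_] h.
  by have := sqnorm_ge0 p; rewrite leNgt (le_lt_trans h b0).
have [a0|a0] := ltP a 0.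
  rewrite subr0 -(disk_le_area b0); congr (mu2 _).
  apply/seteqP; split => p /=; rewrite in_itv/=; first by move=> /andP[].
  by move=> ->; rewrite (lt_le_trans a0)// sqnorm_ge0.
rewrite EFinB muleBl ?disk_area_fin_num//.
rewrite -(disk_le_area b0) -(disk_le_area a0).
rewrite (_ : _ @^-1` _ = [set p | sqnorm p <= b] `\` [set p | sqnorm p <= a]); last first.
  apply/seteqP; split => p /=; rewrite in_itv/=.
    by move=> /andP[h1 h2]; split => //; apply/negP; rewrite -ltNge.
  by move=> [h1 /negP]; rewrite -ltNge => ->.
rewrite measureD; [|exact: measurable_disk_le..|]; last first.
  by rewrite -ge0_fin_numE ?measure_ge0// [X in X \is a fin_num](disk_le_area b0) fin_numM// disk_area_fin_num.
congr (_ - mu2 _)%E; rewrite setIidr// => p /= h; exact: le_trans ab.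
Qed.

(* Lebesgue measure on the line is recovered from the push-forward of the area
   under the squared norm, divided by the area of the disk, to which Lebesgue
   measure on the negative half-line is added. *)
Lemma integral_radial (g : R -> \bar R) : measurable_fun setT g ->
  (forall x, 0 <= g x)%E -> (forall x : R, (x < 0)%R -> g x = 0)%E ->
  (\int[mu2]_p g (sqnorm p) = disk_area * \int[mu]_x g x)%E.
Proof.
move=> mg g0 gN.
have c0 : 0 < fine disk_area by rewrite fine_gt0// disk_area_gt0 ltey_eq disk_area_fin_num.
unshelve epose (m1 := pushforward mu2 (sqnorm : T -> measurableTypeR R)
  : {measure set (measurableTypeR R) -> \bar R}); first exact: measurable_sqnorm.
have ci : 0 <= (fine disk_area)^-1 by rewrite invr_ge0 ltW.
pose m2 : {measure set (measurableTypeR R) -> \bar R} := mscale (NngNum ci) m1.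
have mN : measurable (`]-oo, 0[%classic : set (measurableTypeR R)) by [].
pose m3 : {measure set (measurableTypeR R) -> \bar R} := mrestr mu mN.
pose m : {measure set (measurableTypeR R) -> \bar R} := measure_add m2 m3.
have mE A : measurable A -> mu A = m A.
  apply: lebesgue_measure_unique => _ [[a b]] _ <-.
  rewrite [RHS]measure_addE [m2 _]/= /mscale [m1 _]/= /pushforward [m3 _]/= /mrestr [(NngNum ci)%:num]/=.
  have [ab|ba] := leP a b; last first.
    rewrite set_itv_ge ?bnd_simp -?leNgt ?ltW// preimage_set0 set0I !measure0 mule0 add0e//.
  rewrite radial_itv// -[X in (_ * (_ * X))%E](fineK disk_area_fin_num) -!EFinM.
  rewrite mulrC mulfK ?gt_eqF//.
  have itvE (c d : R) (l r : bool) : c <= d ->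
      mu [set` Interval (BSide l c) (BSide r d)] = (d - c)%:E.
    rewrite lebesgue_measure_itv/= lte_fin le_eqVlt => /predU1P[->|->]; last by rewrite EFinB.
    by rewrite ltxx subrr.
  rewrite (itvE a b false false)//.
  have [b0|b0] := ltP b 0.
    rewrite max_r ?(le_trans ab (ltW b0))// subrr add0e setIidl ?itvE//.
    by move=> x /=; rewrite !in_itv/= => /andP[_] /le_lt_trans; exact.
  have [a0|a0] := ltP a 0.
    rewrite (_ : `]a, b] `&` `]-oo, 0[%classic = `]a, 0[%classic) ?itvE ?(ltW a0)//.
      by rewrite -EFinD; congr EFin; ring.
    apply/seteqP; split => x /=; rewrite !in_itv/=; first by move=> [/andP[-> _] ->].
    by move=> /andP[-> x0]; rewrite (le_trans (ltW x0) b0).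
  rewrite (_ : `]a, b] `&` `]-oo, 0[%classic = set0) ?measure0 ?adde0//.
  apply/seteqP; split => // x /=; rewrite !in_itv/= => -[/andP[ax _] x0].
  by have := lt_trans ax x0; rewrite ltNge a0.
have mD : measurable (`[0, +oo[%classic : set R) by [].
have gE : g = g \_ `[0, +oo[%classic.
  apply/funext => x; rewrite patchE; case: ifPn => // /negP; rewrite inE/= in_itv/= andbT.
  by move=> /negP; rewrite -ltNge => /gN.
rewrite [in RHS]gE -integral_mkcond.
rewrite (eq_measure_integral m2); last first.
  move=> A mA AD; rewrite [LHS](mE _ mA) [m _]measure_addE [m3 _]/= /mrestr.
  rewrite (_ : A `&` _ = set0) ?measure0 ?adde0//.
  apply/seteqP; split => // x /= [/AD]/=; rewrite !in_itv/= andbT => x0.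
  by rewrite ltNge x0.
rewrite ge0_integral_mscale//; last exact: measurable_funTS.
rewrite ge0_integral_pushforward//; [|exact: measurable_sqnorm|exact: measurable_funTS].
rewrite (_ : _ @^-1` _ = setT); last first.
  by apply/seteqP; split => p //= _; rewrite in_itv/= sqnorm_ge0.
rewrite muleA -[X in ((X * _) * _)%E](fineK disk_area_fin_num) /= -EFinM.
by rewrite divff ?gt_eqF// mul1e.
Qed.

End radial.

Lemma integrable_le_cst d (T : measurableType d) (R : realType)
    (m : {measure set T -> \bar R}) (A : set T) (f : T -> R) (M : R) :
  measurable A -> (m A < +oo)%E -> measurable_fun A f ->
  (forall x, A x -> `|f x| <= M) -> m.-integrable A (EFin \o f).
Proof.
move=> mA Aoo mf fM; apply: measurable_bounded_integrable => //.
exists M; split; first exact: num_real.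
by move=> N MN x Ax; exact: le_trans (fM _ Ax) (ltW MN).
Qed.

Section disk_moments.
Context {R : realType}.
Local Notation mu := (@lebesgue_measure R).
Local Notation mu2 := (mu \x mu)%E.
Implicit Types (n : nat) (y s alpha : R).

Lemma powR_le1D y alpha : 0 <= y -> 0 <= alpha <= 1 -> y `^ alpha <= 1 + y.
Proof.
move=> y0 /andP[a0 a1]; have [y1|y1] := leP y 1.
  have : y `^ alpha <= 1 `^ alpha by rewrite ge0_ler_powR// nnegrE.
  by rewrite powR1; lra.
have : y `^ alpha <= y `^ 1 by rewrite ler_powR// ltW.
by rewrite powRr1//; lra.
Qed.

Lemma powR_ge_quadratic y alpha : 0 <= y -> 0 <= alpha <= 1 ->
  y - y ^+ 2 / 4 <= y `^ alpha.
Proof.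
move=> y0 /andP[a0 a1]; have [y1|y1] := leP y 1.
  apply: (@le_trans _ _ y); first by have := sqr_ge0 y; lra.
  move: y0; rewrite le_eqVlt => /predU1P[<-|y0]; first exact: powR_ge0.
  have : y `^ 1 <= y `^ alpha by rewrite ger_powR// y0.
  by rewrite powRr1// ltW.
have : 1 `^ alpha <= y `^ alpha by rewrite ge0_ler_powR// ?nnegrE// ltW.
by rewrite powR1; have := sqr_ge0 (y - 2); nra.
Qed.

Lemma integral_is_derive (f F : R -> R) (a b : R) : a < b ->
  (forall x : R, is_derive x 1 F (f x)) -> continuous f ->
  (\int[mu]_(x in `[a, b]) (f x)%:E = (F b - F a)%:E)%E.
Proof.
move=> ab dF cf; rewrite (@continuous_FTC2 _ f F)//.
- exact: continuous_subspaceT.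
- have cF x : F y @[y --> x] --> F x.
    by apply: differentiable_continuous; apply/derivable1_diffP; case: (dF x).
  split; [by move=> x _; case: (dF x)| |].
  + exact: cvg_at_right_filter.
  + exact: cvg_at_left_filter.
- by move=> x _; rewrite derive1E; apply: derive_val.
Qed.

Lemma integral01_poly n (a b c : R) :
  (\int[mu]_(s in `[0%R, 1%R]) (s ^+ n * (a + b * s + c * s ^+ 2))%:E =
   (a / n.+1%:R + b / n.+2%:R + c / n.+3%:R)%:E)%E.
Proof.
pose F (s : R) := a / n.+1%:R * s ^+ n.+1 + b / n.+2%:R * s ^+ n.+2 + c / n.+3%:R * s ^+ n.+3.
have dF (s : R) : is_derive s 1 F (s ^+ n * (a + b * s + c * s ^+ 2)).
  have -> : s ^+ n * (a + b * s + c * s ^+ 2) =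
    a / n.+1%:R * (n.+1%:R * s ^+ n) + b / n.+2%:R * (n.+2%:R * s ^+ n.+1) +
    c / n.+3%:R * (n.+3%:R * s ^+ n.+2).
    have e (k : nat) (x y : R) : x / k.+1%:R * (k.+1%:R * y) = x * y.
      by rewrite mulrA divfK ?pnatr_eq0.
    by rewrite !e !exprS; ring.
  have dX (k : nat) (x : R) :
      is_derive s 1 (fun s : R => x * s ^+ k.+1) (x * (k.+1%:R * s ^+ k)).
    rewrite (_ : (fun _ => _) = x *: (id ^+ k.+1 : R -> R)); last first.
      by apply/funext => y; rewrite exprfctE.
    by apply: is_derive_eq; rewrite /GRing.scale/= mulr1 mulr_natl.
  by apply: is_deriveD.
rewrite (integral_is_derive _ dF)//.
  by rewrite /F !expr1n !expr0n/= !mulr0 !addr0 subr0 !mulr1.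
move=> s; have cX k : {for s, continuous (fun s : R => s ^+ k)} by exact: exprn_continuous.
apply: cvgM; first exact: cX.
apply: cvgD; last by apply: cvgM; [exact: cvg_cst|exact: cX].
by apply: cvgD; [|apply: cvgM => //]; exact: cvg_cst.
Qed.

Definition radial_weight alpha s : R := (1 - Num.sqrt s) `^ alpha.

Definition disk_moment alpha n : \bar R :=
  (\int[mu2]_(p in [set p | (sqnorm p < 1)%R])
    (sqnorm p ^+ n * radial_weight alpha (sqnorm p))%:E)%E.

Lemma measurable_radial_weight alpha : measurable_fun setT (radial_weight alpha).
Proof.
apply: (measurableT_comp (measurable_powR alpha)).
by apply: measurable_funB => //; apply: continuous_measurable_fun; exact: sqrt_continuous.
Qed.

Lemma disk_momentE alpha n : disk_moment alpha n =
  (disk_area * \int[mu]_(s in `[0%R, 1%R[) (s ^+ n * radial_weight alpha s)%:E)%E.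
Proof.
rewrite /disk_moment integral_mkcond [in RHS]integral_mkcond -integral_radial.
- apply: eq_integral => p _; rewrite !patchE.
  congr (if _ then _ else _).
  by apply/idP/idP => /set_mem /= H; apply/mem_set; move: H; rewrite /= in_itv/= sqnorm_ge0.
- apply/(measurable_restrictT _ _).1 => //; apply/measurable_EFinP.
  by apply: measurable_funM => //; apply: measurable_funTS; exact: measurable_radial_weight.
- move=> x; rewrite patchE; case: ifPn => // /set_mem/=; rewrite in_itv/= => /andP[x0 _].
  by rewrite lee_fin mulr_ge0 ?exprn_ge0 ?powR_ge0.
- move=> x x0; rewrite patchE memNset//= in_itv/= => /andP[].
  by rewrite leNgt x0.
Qed.

Lemma radial_weight_le alpha (N s : R) : 0 <= alpha <= 1 -> 0 < N -> 0 <= s <= 1 ->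
  radial_weight alpha s <= N `^ (- alpha) * (1 + N * (1 - s)).
Proof.
move=> a01 N0 /andP[s0 s1]; have a0 : 0 <= alpha by case/andP: a01.
have : radial_weight alpha s <= (1 - s) `^ alpha.
  have r1 : Num.sqrt s <= 1 by rewrite -sqrtr1 ler_wsqrtr.
  have r0 := sqrtr_ge0 s; have := sqr_sqrtr s0 => rs.
  by apply: ge0_ler_powR => //; rewrite ?nnegrE; nra.
move=> /le_trans; apply.
rewrite (_ : 1 - s = N^-1 * (N * (1 - s))); last by rewrite mulrA mulVf ?mul1r ?gt_eqF.
rewrite powRM ?invr_ge0 ?mulr_ge0 ?subr_ge0 ?(ltW N0)//.
rewrite -powR_inv1 ?(ltW N0)// -powRrM mulN1r ler_wpM2l ?powR_ge0//.
rewrite powR_inv1 ?(ltW N0)// [N^-1 * _]mulrA mulVf ?gt_eqF// mul1r.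
by rewrite powR_le1D// mulr_ge0 ?subr_ge0 ?(ltW N0).
Qed.

Lemma radial_weight_ge alpha (N s : R) : 0 <= alpha <= 1 -> 0 < N -> 0 <= s <= 1 ->
  N `^ (- alpha) / 2 * (N * (1 - s) - (N * (1 - s)) ^+ 2 / 4) <= radial_weight alpha s.
Proof.
move=> a01 N0 /andP[s0 s1]; have a0 : 0 <= alpha by case/andP: a01.
have h : ((1 - s) / 2) `^ alpha <= radial_weight alpha s.
  have r1 : Num.sqrt s <= 1 by rewrite -sqrtr1 ler_wsqrtr.
  have r0 := sqrtr_ge0 s; have := sqr_sqrtr s0 => rs.
  by apply: ge0_ler_powR => //; rewrite ?nnegrE; nra.
apply: le_trans h.
have y0 : 0 <= N * (1 - s) by rewrite mulr_ge0 ?subr_ge0 ?(ltW N0).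
rewrite (_ : (1 - s) / 2 = N^-1 * 2^-1 * (N * (1 - s))); last by field; rewrite gt_eqF.
have Ni : 0 <= N^-1 by rewrite invr_ge0 ltW.
rewrite (powRM _ (mulr_ge0 Ni _) y0)//.
rewrite (powRM _ Ni)//.
rewrite -[in N^-1](powR_inv1 (ltW N0)) -powRrM mulN1r.
have h2 : (2 : R)^-1 <= 2^-1 `^ alpha.
  by apply: ger1_powR; [lra|case/andP: a01].
have h3 := powR_ge_quadratic y0 a01.
move: h3; set Y := N * (1 - s) => h3.
rewrite -[leLHS]mulrA -[leRHS]mulrA ler_wpM2l ?powR_ge0//.
have [q0|q0] := leP 0 (Y - Y ^+ 2 / 4); first by rewrite ler_pM.
apply: (@le_trans _ _ 0); first by rewrite pmulr_rle0// ltW.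
by rewrite mulr_ge0 ?powR_ge0.
Qed.

Lemma lebesgue_measure_cc_lty (a b : R) : (mu `[a, b] < +oo)%E.
Proof. by rewrite lebesgue_measure_itv/=; case: ifP => _; rewrite ?ltry// -EFinD ltry. Qed.

Lemma integrable01_poly n (a b c : R) :
  mu.-integrable `[0, 1] (fun s => (s ^+ n * (a + b * s + c * s ^+ 2))%:E).
Proof.
apply: (@integrable_le_cst _ _ _ _ _ _ (`|a| + `|b| + `|c|)) => //.
- exact: lebesgue_measure_cc_lty.
- apply: measurable_funM => //; apply: measurable_funD; last exact: measurable_funM.
  by apply: measurable_funD => //; exact: measurable_funM.
- move=> s /=; rewrite in_itv/= => /andP[s0 s1].
  rewrite normrM normrX (ger0_norm s0) -[leRHS]mul1r.
  apply: ler_pM => //; [by rewrite exprn_ge0|by rewrite exprn_ile1|].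
  rewrite (le_trans (ler_normD _ _))// lerD//.
    rewrite (le_trans (ler_normD _ _))// lerD// normrM (ger0_norm s0).
    by rewrite ler_piMr.
  by rewrite normrM normrX (ger0_norm s0) ler_piMr// exprn_ile1.
Qed.

Lemma powR_neg1B (N alpha : R) : 0 < N -> N `^ (- 1 - alpha) = N^-1 * N `^ (- alpha).
Proof.
move=> N0; rewrite powRD; last by rewrite (gt_eqF N0) implybT.
by rewrite powR_inv1 ?ltW.
Qed.

Lemma disk_moment_le alpha n : 0 <= alpha <= 1 ->
  (disk_moment alpha n <= disk_area * (2 * n.+1%:R `^ (- 1 - alpha))%:E)%E.
Proof.
move=> a01; rewrite disk_momentE lee_wpmul2l ?(ltW disk_area_gt0)//.
set N : R := n.+1%:R; have N0 : 0 < N by rewrite ltr0n.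
apply: (@le_trans _ _ (\int[mu]_(s in `[0%R, 1%R])
   ((N `^ (- alpha))%:E * (s ^+ n * ((1 + N) + (- N) * s + 0 * s ^+ 2))%:E))%E).
  apply: (@le_trans _ _ (\int[mu]_(s in `[0%R, 1%R]) (s ^+ n * radial_weight alpha s)%:E)%E).
    apply: ge0_subset_integral => //.
    - apply/measurable_EFinP.
      by apply: measurable_funM => //; apply: measurable_funTS; exact: measurable_radial_weight.
    - by move=> s /=; rewrite in_itv/= => /andP[s0 _]; rewrite lee_fin mulr_ge0 ?exprn_ge0 ?powR_ge0.
    - by apply: subset_itvl; rewrite bnd_simp.
  apply: ge0_le_integral => //.
  - by move=> s /=; rewrite in_itv/= => /andP[s0 _]; rewrite lee_fin mulr_ge0 ?exprn_ge0 ?powR_ge0.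
  - apply/measurable_EFinP.
    by apply: measurable_funM => //; apply: measurable_funTS; exact: measurable_radial_weight.
  - apply/measurable_EFinP; apply: measurable_funM => //; apply: measurable_funM => //.
    by apply: measurable_funD; [apply: measurable_funD => //; apply: measurable_funM|apply: measurable_funM].
  - move=> s /=; rewrite in_itv/= => s01; rewrite -EFinM lee_fin mulrCA.
    case/andP: (s01) => s0 s1; rewrite ler_wpM2l ?exprn_ge0//.
    have := radial_weight_le a01 N0 s01.
    by rewrite (_ : 1 + N + - N * s + 0 * s ^+ 2 = 1 + N * (1 - s))//; ring.
rewrite ge0_integralZl//.
- rewrite integral01_poly -EFinM lee_fin.
  have -> : n.+2%:R = N + 1 :> R by rewrite natr1.
  rewrite powR_neg1B// [2 * _]mulrA [leRHS]mulrC ler_wpM2l ?powR_ge0//.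
  rewrite mul0r addr0 mulNr -subr_ge0.
  rewrite (_ : _ - _ = (N * (N + 1))^-1); first by rewrite invr_ge0; nra.
  by field; rewrite !gt_eqF//; lra.
- apply/measurable_EFinP; apply: measurable_funM => //.
  by apply: measurable_funD; [apply: measurable_funD => //; apply: measurable_funM|apply: measurable_funM].
- move=> s /=; rewrite in_itv/= => /andP[s0 s1]; rewrite lee_fin mulr_ge0 ?exprn_ge0//.
  by nra.
- by rewrite lee_fin powR_ge0.
Qed.

Lemma disk_moment_ge alpha n : 0 <= alpha <= 1 ->
  (disk_area * (8^-1 * n.+1%:R `^ (- 1 - alpha))%:E <= disk_moment alpha n)%E.
Proof.
move=> a01; rewrite disk_momentE lee_wpmul2l ?(ltW disk_area_gt0)//.
set N : R := n.+1%:R; have N1 : 1 <= N by rewrite ler1n.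
have N0 : 0 < N by lra.
rewrite integral_itv_bndo_bndc; last first.
  apply/measurable_EFinP.
  by apply: measurable_funM => //; apply: measurable_funTS; exact: measurable_radial_weight.
pose P s := s ^+ n * ((N - N ^+ 2 / 4) + (- N + N ^+ 2 / 2) * s + (- (N ^+ 2 / 4)) * s ^+ 2).
have iP : (\int[mu]_(s in `[0%R, 1%R]) (N `^ (- alpha) / 2 * P s)%:E <=
    \int[mu]_(s in `[0%R, 1%R]) (s ^+ n * radial_weight alpha s)%:E)%E.
  apply: le_integral => //.
  - rewrite (_ : (fun s => _) = (fun s => (N `^ (- alpha) / 2)%:E * (P s)%:E)%E)//.
    by apply: integrableZl => //; exact: integrable01_poly.
  - apply: (@integrable_le_cst _ _ _ _ _ _ 1) => //.
    + exact: lebesgue_measure_cc_lty.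
    + by apply: measurable_funM => //; apply: measurable_funTS; exact: measurable_radial_weight.
    + move=> s /=; rewrite in_itv/= => /andP[s0 s1].
      rewrite ger0_norm ?mulr_ge0 ?exprn_ge0 ?powR_ge0// -[leRHS]mulr1.
      rewrite ler_pM ?exprn_ge0 ?powR_ge0 ?exprn_ile1//.
      have r1 : Num.sqrt s <= 1 by rewrite -sqrtr1 ler_wsqrtr.
      have r0 := sqrtr_ge0 s; case/andP: a01 => a0 _.
      have : (1 - Num.sqrt s) `^ alpha <= 1 `^ alpha.
        by apply: ge0_ler_powR; rewrite // ?nnegrE//; lra.
      by rewrite powR1.
  - move=> s /set_mem/=; rewrite in_itv/= => s01; rewrite lee_fin /P mulrCA.
    case/andP: (s01) => s0 s1; rewrite ler_wpM2l ?exprn_ge0//.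
    have := radial_weight_ge a01 N0 s01.
    by apply: le_trans; rewrite le_eqVlt; apply/orP; left; apply/eqP; congr (_ * _); field.
apply: le_trans iP.
under eq_integral do rewrite EFinM.
rewrite integralZl//; last first.
  exact: integrable01_poly.
rewrite integral01_poly -EFinM lee_fin.
have -> : n.+3%:R = N + 2 :> R by rewrite /N -!natr1; ring.
have -> : n.+2%:R = N + 1 :> R by rewrite natr1.
rewrite powR_neg1B// mulrA [leLHS]mulrC -mulrA ler_wpM2l ?powR_ge0//.
rewrite -/N (_ : _ + _ = (N + 4) / (2 * (N + 1) * (N + 2))); last by field; rewrite !gt_eqF//; lra.
rewrite -subr_ge0.
rewrite (_ : _ - _ = (N ^+ 2 + 5 * N - 2) / (8 * N * (N + 1) * (N + 2))); last first.
  by field; rewrite !gt_eqF//; lra.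
by rewrite divr_ge0// ?mulr_ge0//; nra.
Qed.

End disk_moments.

(** * Chords of the circle and their moments *)

Section measurable_inverse.
Context {R : realType}.

Lemma measurable_invr : measurable_fun setT (fun x : R => x^-1).
Proof.
rewrite (_ : (fun x => _) = (fun x : R => x * (x ^+ 2) `^ (-1))).
  apply: measurable_funM => //; apply: (measurableT_comp (measurable_powR _)).
  exact: measurable_funX.
apply/funext => x; rewrite powR_inv1 ?sqr_ge0//.
have [->|x0] := eqVneq x 0; first by rewrite invr0 mul0r.
by rewrite expr2 invfM mulVKf.
Qed.

End measurable_inverse.

Section trigonometric_bounds.
Context {R : realType}.
Implicit Types x t : R.

Lemma is_derive_continuous (f df : R -> R) :
  (forall x, is_derive x (1 : R) f (df x)) -> continuous f.
Proof.
move=> dF x; apply: differentiable_continuous; apply/derivable1_diffP.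
by case: (dF x).
Qed.

Lemma is_derive_ge0 (f df : R -> R) : f 0 = 0 ->
  (forall x, is_derive x (1 : R) f (df x)) ->
  (forall x, 0 <= x -> 0 <= df x) -> forall x, 0 <= x -> 0 <= f x.
Proof.
move=> f0 dF df0 x x0.
have [//|c cx] := @MVT_segment R f df 0 x x0 (fun y _ => dF y).
  by apply: continuous_subspaceT; exact: is_derive_continuous dF.
rewrite f0 !subr0 => ->; rewrite mulr_ge0// df0//.
by move: cx; rewrite in_itv/= => /andP[].
Qed.

Lemma sin_le x : 0 <= x -> sin x <= x.
Proof.
move=> x0; rewrite -subr_ge0.
by apply: (@is_derive_ge0 (fun x => x - sin x) (fun x => 1 - cos x)) => //;
  rewrite sin0 subrr.
Qed.

Lemma is_derive_scaleX (a : R) (k : nat) (s : R) :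
  is_derive s 1 (fun s : R => a * s ^+ k.+1) (a * (k.+1%:R * s ^+ k)).
Proof.
rewrite (_ : (fun _ => _) = a *: (id ^+ k.+1 : R -> R)); last first.
  by apply/funext => y; rewrite exprfctE.
by apply: is_derive_eq; rewrite /GRing.scale/= mulr1 mulr_natl.
Qed.

Lemma cos_ge x : 0 <= x -> 1 - x ^+ 2 / 2 <= cos x.
Proof.
move=> x0; rewrite -subr_ge0.
have := @is_derive_ge0 (fun x => (cos x + 2^-1 * x ^+ 2) + (-1)) (fun x => (- sin x + 2^-1 * (2%:R * x ^+ 1)) + 0).
move=> /(_ _ _ _ x x0) h.
have : 0 <= cos x + 2^-1 * x ^+ 2 + -1.
  apply: h.
  - by rewrite cos0 expr0n/= mulr0 addr0 subrr.
  - move=> y; apply: is_deriveD; apply: is_deriveD; exact: is_derive_scaleX.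
  - move=> y y0; rewrite expr1 addr0 mulKf ?pnatr_eq0// addrC subr_ge0; exact: sin_le.
by congr (_ <= _); field.
Qed.

Lemma sin_ge x : 0 <= x -> x - x ^+ 3 / 6 <= sin x.
Proof.
move=> x0; rewrite -subr_ge0.
have := @is_derive_ge0 (fun x => (sin x + 6^-1 * x ^+ 3) + (- 1) * x ^+ 1) (fun x => (cos x + 6^-1 * (3%:R * x ^+ 2)) + (-1) * (1%:R * x ^+ 0)).
move=> /(_ _ _ _ x x0) h.
have : 0 <= sin x + 6^-1 * x ^+ 3 + - 1 * x ^+ 1.
  apply: h.
  - by rewrite sin0 !expr0n/= !mulr0 !addr0.
  - move=> y; apply: is_deriveD; [apply: is_deriveD|]; exact: is_derive_scaleX.
  - move=> y y0; rewrite expr0; have := cos_ge y0; rewrite (_ : 6^-1 * (3 * _) = y ^+ 2 / 2); last by field.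
    lra.
by rewrite expr1; congr (_ <= _); field.
Qed.

(* The square of the distance between two points of the circle whose arguments differ by t. *)
Definition chord2 t : R := 2 - 2 * cos t.

Lemma chord2_half t : chord2 t = 4 * sin (t / 2) ^+ 2.
Proof.
rewrite /chord2 {1}(_ : t = (t / 2) *+ 2); last by rewrite mulr2n; field.
by rewrite cos_mulr2n sin2cos2; ring.
Qed.

Lemma chord2_ge0 t : 0 <= chord2 t.
Proof. by rewrite chord2_half mulr_ge0// sqr_ge0. Qed.

Lemma chord2N t : chord2 (- t) = chord2 t.
Proof. by rewrite /chord2 cosN. Qed.

Lemma chord2_norm t : chord2 `|t| = chord2 t.
Proof. by rewrite /chord2 cos_norm. Qed.

Lemma chord2_le4 t : chord2 t <= 4.
Proof. by rewrite /chord2; have := cos_geN1 t; lra. Qed.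

Lemma chord2_le t : chord2 t <= t ^+ 2.
Proof.
rewrite -chord2_norm -(real_normK (num_real t)).
rewrite /chord2; have := @cos_ge `|t| (normr_ge0 t); lra.
Qed.

Lemma chord2_ge t : `|t| <= pi -> t ^+ 2 / 9 <= chord2 t.
Proof.
move=> tpi; rewrite -chord2_norm -(real_normK (num_real t)).
move: (normr_ge0 t) tpi; set x := `|t| => x0 xpi.
have h := @sin_ge (x / 2); have pi4 := @pihalf_lt2 R.
have x4 : x < 4 by lra.
have := h ltac:(lra); rewrite chord2_half; move: (sin _) => y hy.
have : x / 6 <= y by nra.
by move=> ?; nra.
Qed.

Lemma chord2_gt0 t : `|t| <= pi -> t != 0 -> 0 < chord2 t.
Proof.
move=> tpi t0; apply: lt_le_trans (chord2_ge tpi).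
by rewrite divr_gt0// lt_neqAle sqr_ge0 eq_sym sqrf_eq0 t0.
Qed.

Lemma continuous_chord2 : continuous chord2.
Proof.
move=> t; apply: cvgB; first exact: cvg_cst.
by apply: cvgM; [exact: cvg_cst|exact: continuous_cos].
Qed.

Definition chord t : R := Num.sqrt (chord2 t).

Lemma measurable_chord : measurable_fun setT chord.
Proof.
apply: continuous_measurable_fun => t; apply: continuous_comp; first exact: continuous_chord2.
exact: sqrt_continuous.
Qed.

Lemma chord_le t : chord t <= `|t|.
Proof. by rewrite -sqrtr_sqr ler_wsqrtr// chord2_le. Qed.

Lemma chord_ge t : `|t| <= pi -> `|t| / 3 <= chord t.
Proof.
move=> tpi; rewrite (_ : `|t| / 3 = Num.sqrt (t ^+ 2 / 9)).
  by rewrite ler_wsqrtr// chord2_ge.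
rewrite (_ : t ^+ 2 / 9 = (t / 3) ^+ 2); last by field.
by rewrite sqrtr_sqr normrM [`|_^-1|]gtr0_norm.
Qed.

End trigonometric_bounds.

Section periodic.
Context {R : realType}.
Local Notation mu := (@lebesgue_measure R).

Lemma ge0_integral_oppr (f : R -> \bar R) :
  measurable_fun setT f -> (forall x, 0 <= f x)%E ->
  (\int[mu]_x f (- x)%R = \int[mu]_x f x)%E.
Proof.
move=> mf f0.
transitivity (\int[pushforward mu (fun x : R => (- x)%R : measurableTypeR R)]_x f x)%E.
  by rewrite ge0_integral_pushforward//; exact: measurable_funN.
apply: eq_measure_integral => [|? A mA _]; first exact: measurable_funN.
exact: lebesgue_measureN.
Qed.

Lemma integral_itv_shift (a : R) (b c : R) (l r : bool) (f : R -> \bar R) :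
  measurable_fun setT f -> (forall x, 0 <= f x)%E ->
  (\int[mu]_(x in [set` Interval (BSide l b) (BSide r c)]) f (x + a)%R =
   \int[mu]_(x in [set` Interval (BSide l (b + a)%R) (BSide r (c + a)%R)]) f x)%E.
Proof.
move=> mf f0; rewrite integral_mkcond [RHS]integral_mkcond.
rewrite -[RHS](@ge0_integral_shift R a).
- apply: eq_integral => x _; rewrite !patchE; congr (if _ then _ else _).
  by apply/idP/idP => /set_mem H; apply/mem_set; move: H;
    case: l; case: r; rewrite /= !in_itv/= ?lerD2r ?ltrD2r.
- apply/(measurable_restrictT _ _).1 => //; exact: measurable_funTS.
- by move=> x; rewrite patchE; case: ifP.
Qed.

Lemma ge0_integral_split (a b c : R) (l : bool) (f : R -> \bar R) :
  measurable_fun setT f -> (forall x, 0 <= f x)%E -> a <= b -> b <= c ->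
  (\int[mu]_(x in [set` Interval (BSide l a) (BRight c)]) f x =
   \int[mu]_(x in [set` Interval (BSide l a) (BRight b)]) f x +
   \int[mu]_(x in `]b, c]) f x)%E.
Proof.
move=> mf f0 ab bc.
rewrite (@itv_bndbnd_setU _ _ _ (BRight b)); last 2 first.
- by case: l; rewrite bnd_simp.
- by rewrite bnd_simp.
rewrite ge0_integral_setU//; first exact: measurable_funTS.
apply/disj_setPS => x [/=]; rewrite !in_itv/= => /andP[_ xb] /andP[bx _].
by rewrite leNgt bx in xb.
Qed.

Lemma ge0_integral_periodic (f : R -> \bar R) (a : R) :
  measurable_fun setT f -> (forall x, 0 <= f x)%E -> (forall x, f (x + pi *+ 2)%R = f x) ->
  `|a| <= pi *+ 2 ->
  (\int[mu]_(x in arc) f (x + a)%R = \int[mu]_(x in arc) f x)%E.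
Proof.
have main (g : R -> \bar R) (b : R) : measurable_fun setT g -> (forall x, 0 <= g x)%E ->
    (forall x, g (x + pi *+ 2)%R = g x) -> 0 <= b <= pi *+ 2 ->
    (\int[mu]_(x in arc) g (x + b)%R = \int[mu]_(x in arc) g x)%E.
  move=> mg g0 pg /andP[b0 b2].
  have pp := @pi_gt0 R; move: b2; rewrite mulr2n => b2.
  have arcE (k : R -> \bar R) : measurable_fun setT k ->
      (\int[mu]_(x in arc) k x = \int[mu]_(x in `](- pi)%R, pi]) k x)%E.
    by move=> mk; rewrite /arc integral_itv_obnd_cbnd//; exact: measurable_funTS.
  rewrite !arcE//; last by apply: (measurableT_comp mg); exact: measurable_funD.
  rewrite (integral_itv_shift b _ _ _ _ mg g0).
  have h1 : - pi + b <= pi by lra.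
  rewrite (ge0_integral_split (b := pi) _ mg g0) ?lerDl//.
  rewrite [RHS](ge0_integral_split (b := - pi + b) _ mg g0) ?lerDl//.
  rewrite addeC; congr (_ + _)%E.
  have e1 : pi = - pi + pi *+ 2 :> R by rewrite mulr2n addKr.
  have e2 : pi + b = (- pi + b) + pi *+ 2 by rewrite mulr2n; ring.
  rewrite {1}e1 e2 -(integral_itv_shift _ _ _ _ _ mg g0).
  by apply: eq_integral => x _; rewrite pg.
move=> mf f0 pf; rewrite ler_norml => /andP[a1 a2].
have [a0|a0] := leP 0 a; first by rewrite main// a0.
have mg : measurable_fun setT (fun x : R => f (x + a)%R).
  by apply: (measurableT_comp mf); exact: measurable_funD.
have pg x : f (x + pi *+ 2 + a)%R = f (x + a)%R by rewrite addrAC pf.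
have a3 : 0 <= - a <= pi *+ 2 by rewrite oppr_ge0 (ltW a0)/= lerNl.
rewrite -(main _ _ mg (fun=> f0 _) pg a3).
by apply: eq_integral => x _; rewrite addrNK.
Qed.

Lemma ge0_integral_arc_even (f : R -> \bar R) :
  measurable_fun setT f -> (forall x, 0 <= f x)%E -> (forall x, f (- x)%R = f x) ->
  (\int[mu]_(x in arc) f x = 2%:E * \int[mu]_(x in `[0%R, pi]) f x)%E.
Proof.
move=> mf f0 ef; have pp := @pi_ge0 R.
rewrite /arc (ge0_integral_split (b := 0) _ mf f0) ?oppr_le0//.
rewrite integral_itv_obnd_cbnd; last exact: measurable_funTS.
rewrite mule_natl mule2n.
congr (_ + _)%E; rewrite integral_mkcond [RHS]integral_mkcond -[LHS]ge0_integral_oppr.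
- apply: eq_integral => x _; rewrite !patchE ef; congr (if _ then _ else _).
  apply/idP/idP => /set_mem H; apply/mem_set; move: H; rewrite /= !in_itv/=;
    by move=> /andP[h1 h2]; apply/andP; split; lra.
- apply/(measurable_restrictT _ _).1 => //; exact: measurable_funTS.
- by move=> x; rewrite patchE; case: ifP.
Qed.

End periodic.

Section chord_moments.
Context {R : realType}.
Local Notation mu := (@lebesgue_measure R).
Implicit Types (alpha : R) (n : nat).

Definition chord_kernel alpha (s : R) : R := (chord s `^ (2 - alpha))^-1.

Lemma chord_kernel_ge0 alpha s : 0 <= chord_kernel alpha s.
Proof. by rewrite invr_ge0 powR_ge0. Qed.

Lemma measurable_chord_kernel alpha : measurable_fun setT (chord_kernel alpha).
Proof.
apply: (measurableT_comp measurable_invr).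
by apply: (measurableT_comp (measurable_powR _)); exact: measurable_chord.
Qed.

Definition chord_moment alpha n : \bar R :=
  (\int[mu]_(s in arc) (chord2 (n%:R * s) * chord_kernel alpha s)%:E)%E.

Lemma chord_kernel_le alpha s : 0 <= alpha < 1 -> 0 < `|s| <= pi ->
  chord_kernel alpha s <= 9 * `|s| `^ (alpha - 2).
Proof.
move=> /andP[a0 a1] /andP[s0 spi].
have h := chord_ge spi.
have : (`|s| / 3) `^ (2 - alpha) <= chord s `^ (2 - alpha).
  by apply: ge0_ler_powR => //; rewrite ?nnegrE ?sqrtr_ge0//; lra.
move=> {}h; have p0 : 0 < (`|s| / 3) `^ (2 - alpha) by rewrite powR_gt0// divr_gt0.
rewrite /chord_kernel; apply: (@le_trans _ _ ((`|s| / 3) `^ (2 - alpha))^-1).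
  by rewrite lef_pV2 ?posrE// (lt_le_trans p0).
have -> : ((`|s| / 3) `^ (2 - alpha))^-1 = 3 `^ (2 - alpha) * `|s| `^ (alpha - 2).
  rewrite -powRN opprB powRM ?invr_ge0// mulrC; congr (_ * _).
  by rewrite -powR_inv1// -powRrM mulN1r opprB.
rewrite ler_wpM2r ?powR_ge0//.
have : (3 : R) `^ (2 - alpha) <= 3 `^ 2%:R by apply: ler_powR; lra.
by rewrite powR_mulrn//; lra.
Qed.

Lemma chord_kernel_ge alpha s : 0 <= alpha < 1 -> 0 < `|s| <= pi ->
  `|s| `^ (alpha - 2) <= chord_kernel alpha s.
Proof.
move=> /andP[a0 a1] /andP[s0 spi].
have : chord s `^ (2 - alpha) <= `|s| `^ (2 - alpha).
  apply: ge0_ler_powR => //; rewrite ?nnegrE ?sqrtr_ge0//; [lra|exact: chord_le].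
rewrite /chord_kernel => h.
have -> : `|s| `^ (alpha - 2) = (`|s| `^ (2 - alpha))^-1 by rewrite -powRN opprB.
rewrite lef_pV2 ?posrE// powR_gt0// sqrtr_gt0 chord2_gt0//.
by rewrite -normr_gt0.
Qed.

Lemma measurable_chord_moment alpha n :
  measurable_fun setT (fun s : R => (chord2 (n%:R * s) * chord_kernel alpha s)%:E).
Proof.
apply/measurable_EFinP; apply: measurable_funM; last exact: measurable_chord_kernel.
apply: (measurableT_comp (continuous_measurable_fun continuous_chord2)).
exact: measurable_funM.
Qed.

Lemma integral_powR_le (alpha a b : R) : 0 <= alpha < 1 -> 0 < a -> a < b ->
  (\int[mu]_(s in `[a, b]) (s `^ (alpha - 2))%:E <= (a `^ (alpha - 1) / (1 - alpha))%:E)%E.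
Proof.
move=> /andP[a0 a1] a_gt0 ab.
pose F s : R := (alpha - 1)^-1 * s `^ (alpha - 1).
have c1 p : {in `]0, +oo[, continuous (fun s : R => s `^ p)}.
  move=> s s0; apply: differentiable_continuous; apply/derivable1_diffP.
  exact: derivable_powR.
have dF : {in `]0, +oo[, forall s : R, derivable F s 1}.
  by move=> s s0; apply: derivableM => //; exact: derivable_powR.
have cF (s : R) : 0 < s -> {for s, continuous F}.
  move=> s0; apply: differentiable_continuous; apply/derivable1_diffP; apply: dF.
  by rewrite in_itv/= s0.
rewrite (@continuous_FTC2 _ (fun s => s `^ (alpha - 2)) F)//.
- rewrite -EFinB lee_fin /F.
  have : 0 <= b `^ (alpha - 1) by exact: powR_ge0.
  have e : (alpha - 1)^-1 = - (1 - alpha)^-1 by rewrite -invrN opprB.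
  rewrite e; have : 0 < (1 - alpha)^-1 by rewrite invr_gt0 subr_gt0.
  move: (1 - alpha)^-1 (_ `^ _) (_ `^ _) => x y z; nra.
- apply: continuous_in_subspaceT => s /set_mem/=; rewrite in_itv/= => /andP[as0 _].
  by apply: c1; rewrite in_itv/= andbT (lt_le_trans a_gt0).
- split.
  + move=> s; rewrite in_itv/= => /andP[as0 _]; apply: dF.
    by rewrite in_itv/= (lt_trans a_gt0).
  + by apply: cvg_at_right_filter; exact: cF.
  + by apply: cvg_at_left_filter; apply: cF; exact: lt_trans ab.
- move=> s; rewrite in_itv/= => /andP[as0 _].
  have s0 : s \in `]0, +oo[ by rewrite in_itv/= (lt_trans a_gt0).
  rewrite derive1Ml; last exact: derivable_powR.
  rewrite powR_derive1// mulrA mulVf ?mul1r; last by lra.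
  by rewrite -addrA -opprD.
Qed.

Lemma chord_moment_le alpha n : 0 <= alpha < 1 ->
  (chord_moment alpha n.+1 <= (90 / (1 - alpha) * n.+1%:R `^ (1 - alpha))%:E)%E.
Proof.
move=> a01; have /andP[a0 a1] := a01.
have := measurable_chord_moment alpha n.+1; rewrite /chord_moment.
move eN : (n.+1%:R : R) => N mf; have N1 : 1 <= N by rewrite -eN ler1n.
have N0 : 0 < N by lra.
have pi2 := @pi_ge2 R.
have Ni1 : N^-1 <= 1 by rewrite invf_le1.
have Ni0 : 0 < N^-1 by rewrite invr_gt0.
have Nip : N^-1 <= pi by apply: (le_trans Ni1); apply: le_trans pi2; rewrite ler1n.
have f0 (s : R) : (0 <= (chord2 (N * s) * chord_kernel alpha s)%:E)%E.
  by rewrite lee_fin mulr_ge0 ?chord2_ge0 ?chord_kernel_ge0.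
rewrite (ge0_integral_arc_even mf f0); last first.
  by move=> s; rewrite mulrN chord2N /chord_kernel /chord chord2N.
rewrite (ge0_integral_split (b := N^-1) _ mf f0) ?(ltW Ni0)//.
set I1 := (X in (_ * (X + _))%E); set I2 := (X in (_ * (_ + X))%E).
have h1 : (I1 <= (9 * N `^ (1 - alpha))%:E)%E.
  apply: (@le_trans _ _ (\int[mu]_(s in `[0%R, (N^-1)%R]) (cst (9 * N ^+ 2 * N `^ (- alpha))%:E s))%E).
    apply: ge0_le_integral => //.
    - exact: measurable_funTS.
    - move=> s /=; rewrite in_itv/= => /andP[s0 sN]; rewrite lee_fin.
      move: s0; rewrite le_eqVlt => /predU1P[<-|s0].
        rewrite mulr0 /chord2 cos0 mulr1 subrr mul0r.
        by rewrite !mulr_ge0 ?exprn_ge0 ?powR_ge0 ?(ltW N0).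
      have sp : 0 < `|s| <= pi by rewrite gtr0_norm// s0/=; lra.
      apply: (@le_trans _ _ (N ^+ 2 * s ^+ 2 * (9 * `|s| `^ (alpha - 2)))).
        apply: ler_pM; rewrite ?chord2_ge0 ?chord_kernel_ge0//.
          by rewrite -exprMn chord2_le.
        exact: chord_kernel_le.
      rewrite gtr0_norm//.
      have e : s ^+ 2 * s `^ (alpha - 2) = s `^ alpha.
        rewrite -powR_mulrn ?(ltW s0)// -powRD; last by rewrite (gt_eqF s0) implybT.
        by rewrite addrC subrK.
      rewrite (_ : _ * _ = 9 * N ^+ 2 * (s ^+ 2 * s `^ (alpha - 2))); last by ring.
      rewrite e ler_wpM2l ?mulr_ge0 ?exprn_ge0 ?(ltW N0)//.
      rewrite powRN -powR_inv1 ?powR_ge0// powRAC powR_inv1 ?(ltW N0)//.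
      by apply: ge0_ler_powR; rewrite ?nnegrE ?(ltW s0) ?(ltW Ni0).
  rewrite integral_cst//= lebesgue_measure_itv/= lte_fin Ni0 -EFinD -EFinM lee_fin subr0.
  rewrite le_eqVlt; apply/orP; left; apply/eqP.
  rewrite powRD ?powRr1 ?(ltW N0)//; last by rewrite (gt_eqF N0) implybT.
  by field; rewrite gt_eqF.
have h2 : (I2 <= (36 / (1 - alpha) * N `^ (1 - alpha))%:E)%E.
  apply: (@le_trans _ _ (\int[mu]_(s in `[(N^-1)%R, pi]) (36%:E * (s `^ (alpha - 2))%:E))%E).
    rewrite /I2 integral_itv_obnd_cbnd; last exact: measurable_funTS.
    apply: ge0_le_integral => //.
    - exact: measurable_funTS.
    - apply/measurable_EFinP; apply: measurable_funM => //.
      by apply: measurable_funTS; exact: measurable_powR.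
    - move=> s /=; rewrite in_itv/= => /andP[sN sp]; rewrite lee_fin.
      have s0 : 0 < s by exact: lt_le_trans sN.
      have sp' : 0 < `|s| <= pi by rewrite gtr0_norm// s0.
      rewrite (_ : 36 = 4 * 9) -?mulrA; last by ring.
      apply: ler_pM; rewrite ?chord2_ge0 ?chord_kernel_ge0 ?chord2_le4//.
      by rewrite -[X in _ * X `^ _](gtr0_norm s0) chord_kernel_le.
  rewrite ge0_integralZl//; last 2 first.
  - by apply/measurable_EFinP; apply: measurable_funTS; exact: measurable_powR.
  - by move=> s _; rewrite lee_fin powR_ge0.
  have := @integral_powR_le alpha N^-1 pi a01 Ni0 ltac:(lra).
  rewrite -powR_inv1 ?(ltW N0)// -powRrM mulN1r opprB => h.
  apply: le_trans (lee_wpmul2l _ h) _; first by rewrite lee_fin.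
  rewrite -EFinM lee_fin le_eqVlt; apply/orP; left; apply/eqP.
  by ring.
apply: (@le_trans _ _ (2%:E * ((9 * N `^ (1 - alpha))%:E + (36 / (1 - alpha) * N `^ (1 - alpha))%:E))%E).
  by rewrite lee_wpmul2l ?lee_fin// leeD.
rewrite -EFinD -EFinM lee_fin.
have : 1 <= (1 - alpha)^-1 by rewrite invf_ge1; lra.
have := powR_ge0 N (1 - alpha).
by move: (_ `^ _) (1 - alpha)^-1 => x y; nra.
Qed.

Lemma chord_moment_ge alpha n : 0 <= alpha < 1 ->
  ((36^-1 * n.+1%:R `^ (1 - alpha))%:E <= chord_moment alpha n.+1)%E.
Proof.
move=> a01; have /andP[a0 a1] := a01.
have := measurable_chord_moment alpha n.+1; rewrite /chord_moment.
move eN : (n.+1%:R : R) => N mf; have N1 : 1 <= N by rewrite -eN ler1n.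
have N0 : 0 < N by lra.
have pi2 := @pi_ge2 R.
have Ni1 : N^-1 <= 1 by rewrite invf_le1.
have Ni0 : 0 < N^-1 by rewrite invr_gt0.
have Nip : N^-1 <= pi by apply: (le_trans Ni1); apply: le_trans pi2; rewrite ler1n.
have f0 (s : R) : (0 <= (chord2 (N * s) * chord_kernel alpha s)%:E)%E.
  by rewrite lee_fin mulr_ge0 ?chord2_ge0 ?chord_kernel_ge0.
apply: (@le_trans _ _ (\int[mu]_(s in `[(N^-1 / 2)%R, (N^-1)%R]) (chord2 (N * s) * chord_kernel alpha s)%:E)%E); last first.
  apply: ge0_subset_integral => //.
  - exact: measurable_itv.
  - exact: measurable_funTS.
  by move=> s; rewrite /arc/= !in_itv/= => /andP[s1 s2]; apply/andP; split; lra.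
apply: (@le_trans _ _ (\int[mu]_(s in `[(N^-1 / 2)%R, (N^-1)%R]) (cst (N ^+ 2 / 18 * N `^ (- alpha))%:E s))%E).
  rewrite integral_cst//= lebesgue_measure_itv/= lte_fin (_ : (N^-1 / 2 < N^-1) = true); last by lra.
  rewrite -EFinD -EFinM lee_fin le_eqVlt; apply/orP; left; apply/eqP.
  rewrite powRD ?powRr1 ?(ltW N0)//; last by rewrite (gt_eqF N0) implybT.
  by field; rewrite gt_eqF.
apply: ge0_le_integral => //.
- by move=> s _; rewrite lee_fin !mulr_ge0 ?exprn_ge0 ?powR_ge0 ?(ltW N0).
- exact: measurable_funTS.
- move=> s /=; rewrite in_itv/= => /andP[s1 s2]; rewrite lee_fin.
  have s0 : 0 < s by lra.
  have sp : 0 < `|s| <= pi by rewrite gtr0_norm// s0/=; lra.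
  have Ns : N * s <= 1 by rewrite -ler_pdivlMl// mulr1.
  have hs : (N * s) ^+ 2 / 9 <= chord2 (N * s).
    by apply: chord2_ge; rewrite gtr0_norm ?mulr_gt0//; lra.
  apply: (@le_trans _ _ ((N * s) ^+ 2 / 9 * s `^ (alpha - 2))); last first.
    apply: ler_pM => //; rewrite ?divr_ge0 ?sqr_ge0 ?powR_ge0//.
    by rewrite -[X in X `^ _](gtr0_norm s0) chord_kernel_ge.
  have e : s ^+ 2 * s `^ (alpha - 2) = s `^ alpha.
    rewrite -powR_mulrn ?(ltW s0)// -powRD; last by rewrite (gt_eqF s0) implybT.
    by rewrite addrC subrK.
  rewrite (_ : _ / 9 * _ = N ^+ 2 / 9 * (s ^+ 2 * s `^ (alpha - 2))); last by ring.
  rewrite e (_ : N ^+ 2 / 18 * _ = N ^+ 2 / 9 * (2^-1 * N `^ (- alpha))); last by field.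
  rewrite ler_wpM2l ?divr_ge0 ?sqr_ge0//.
  apply: (@le_trans _ _ ((N^-1 / 2) `^ alpha)).
    have eN2 : N^-1 `^ alpha = N `^ (- alpha).
      by rewrite -powR_inv1 ?(ltW N0)// -powRrM mulN1r.
    rewrite powRM ?(ltW Ni0)// eN2 mulrC ler_wpM2l ?powR_ge0//.
    by apply: ger1_powR; lra.
  by apply: ge0_ler_powR; rewrite ?nnegrE ?(ltW s0)// divr_ge0// ltW.
Qed.

End chord_moments.

(** * Complex exponential and differentiability *)

Section complex_basics.
Context {R : realType}.
Implicit Types (z w : R[i]) (t s : R).
Local Notation Re := complex.Re.
Local Notation Im := complex.Im.

Lemma normc_sqr z : normc z ^+ 2 = Re z ^+ 2 + Im z ^+ 2.
Proof. by case: z => a b /=; rewrite sqr_sqrtr// addr_ge0 ?sqr_ge0. Qed.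

Lemma normc_ge0 z : 0 <= normc z.
Proof. by case: z => a b /=; rewrite sqrtr_ge0. Qed.

Lemma Re_mulc z w : Re (z * w) = Re z * Re w - Im z * Im w.
Proof. by case: z; case: w. Qed.

Lemma Im_mulc z w : Im (z * w) = Re z * Im w + Im z * Re w.
Proof. by case: z; case: w. Qed.

Lemma Re_addc z w : Re (z + w) = Re z + Re w.
Proof. by case: z; case: w. Qed.

Lemma Im_addc z w : Im (z + w) = Im z + Im w.
Proof. by case: z; case: w. Qed.

Lemma Re_oppc z : Re (- z) = - Re z.
Proof. by case: z. Qed.

Lemma Im_oppc z : Im (- z) = - Im z.
Proof. by case: z. Qed.

Lemma Re_invc z : Re z^-1 = Re z * (normc z ^+ 2)^-1.
Proof. by rewrite normc_sqr; case: z. Qed.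

Lemma Im_invc z : Im z^-1 = - (Im z * (normc z ^+ 2)^-1).
Proof. by rewrite normc_sqr; case: z => a b /=. Qed.

Lemma normc_real (x : R) : normc x%:C = `|x|.
Proof. by rewrite /= expr0n/= addr0 sqrtr_sqr. Qed.

Lemma Re_le_normc z : `|Re z| <= normc z.
Proof.
rewrite -(ler_sqr (normr_ge0 _) (normc_ge0 z)) normc_sqr real_normK ?num_real//.
by rewrite lerDl sqr_ge0.
Qed.

Lemma Im_le_normc z : `|Im z| <= normc z.
Proof.
rewrite -(ler_sqr (normr_ge0 _) (normc_ge0 z)) normc_sqr real_normK ?num_real//.
by rewrite lerDr sqr_ge0.
Qed.

Lemma normc_le_ReIm z : normc z <= `|Re z| + `|Im z|.
Proof.
rewrite -(ler_sqr (normc_ge0 z)) ?nnegrE ?addr_ge0// normc_sqr sqrrD.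
rewrite !real_normK ?num_real// lerD2r lerDl.
by rewrite mulrn_wge0// mulr_ge0.
Qed.

Lemma normcX z n : normc (z ^+ n) = normc z ^+ n.
Proof.
elim: n => [|n IH]; first by rewrite !expr0 normc1.
by rewrite !exprS normcM IH.
Qed.

Lemma normc_gt0 z : (0 < normc z) = (z != 0).
Proof.
rewrite lt_neqAle normc_ge0 andbT eq_sym; congr (~~ _).
by apply/eqP/eqP => [/eq0_normc//|->]; rewrite normc0.
Qed.

Lemma normc_norm z : `|z| = (normc z)%:C.
Proof. by rewrite normc_def; case: z. Qed.

Lemma expiD s t : expi (s + t) = expi s * expi t.
Proof. by rewrite /expi cosD sinD; apply/eqP; rewrite eq_complex/= eqxx andTb addrC. Qed.

Lemma expi0 : expi (0 : R) = 1.
Proof. by rewrite /expi cos0 sin0. Qed.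

Lemma normc_expi t : normc (expi t) = 1.
Proof. by rewrite /= cos2Dsin2 sqrtr1. Qed.

Lemma expi_neq0 t : expi t != 0.
Proof. by rewrite -normc_gt0 normc_expi. Qed.

Lemma expiN t : expi (- t) = (expi t)^-1.
Proof.
apply: (mulfI (expi_neq0 t)); rewrite mulfV ?expi_neq0//.
by rewrite -expiD subrr expi0.
Qed.

Lemma expi_nat (n : nat) t : expi (n%:R * t) = expi t ^+ n.
Proof.
elim: n => [|n IH]; first by rewrite mul0r expi0 expr0.
by rewrite -natr1 mulrDl mul1r expiD IH exprSr.
Qed.

Lemma expi_periodic t : expi (t + pi *+ 2) = expi t.
Proof. by rewrite /expi cosD2pi sinD2pi. Qed.

Lemma normc_expi_sub1 t : normc (expi t - 1) ^+ 2 = chord2 t.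
Proof. by rewrite normc_sqr /= subr0 sin2cos2 /chord2; ring. Qed.

Lemma normc_expiB t s : normc (expi t - expi s) = chord (t - s).
Proof.
rewrite (_ : expi t - expi s = expi s * (expi (t - s) - 1)); last first.
  by rewrite mulrBr -expiD addrCA subrr addr0 mulr1.
rewrite normcM normc_expi mul1r -[LHS]ger0_norm ?normc_ge0// -sqrtr_sqr.
by rewrite normc_expi_sub1.
Qed.

Lemma cexpD z w : cexp (z + w) = cexp z * cexp w.
Proof.
by rewrite /cexp Re_addc Im_addc expRD expiD rmorphM/=; ring.
Qed.

Lemma normc_cexp z : normc (cexp z) = expR (Re z).
Proof. by rewrite /cexp normcM normc_expi mulr1 normc_real ger0_norm ?expR_ge0. Qed.

Lemma expR_quadratic (x : R) : `|x| <= 2^-1 -> `|expR x - 1 - x| <= 2 * x ^+ 2.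
Proof.
move=> /ler_normlP[x1 x2].
have h1 := expR_ge1Dx x; have h2 := expR_ge1Dx (- x).
have h3 : expR x * expR (- x) = 1 by rewrite -expRD subrr expR0.
have h4 := expR_ge0 x.
rewrite ger0_norm; last by lra.
by nra.
Qed.

Lemma sin_cubic (y : R) : `|sin y - y| <= `|y| ^+ 3 / 6.
Proof.
wlog y0 : y / 0 <= y.
  move=> H; have [/H//|y0] := leP 0 y.
  have := H (- y); rewrite oppr_ge0 (ltW y0) sinN normrN => /(_ isT).
  by rewrite -opprD normrN.
rewrite (ger0_norm y0) ler0_norm; last by rewrite subr_le0 sin_le.
by have := sin_ge y0; lra.
Qed.

Lemma cos_quadratic (y : R) : `|cos y - 1| <= y ^+ 2 / 2.
Proof.
rewrite ler0_norm; last by rewrite subr_le0 cos_le1.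
have := cos_ge (normr_ge0 y); rewrite cos_norm real_normK ?num_real//; lra.
Qed.

Lemma cexp_quadratic z : normc z <= 2^-1 -> normc (cexp z - 1 - z) <= 8 * normc z ^+ 2.
Proof.
move=> zle; have hx := le_trans (Re_le_normc z) zle; have hy := le_trans (Im_le_normc z) zle.
apply: le_trans (normc_le_ReIm _) _; rewrite normc_sqr.
case: z zle hx hy => x y /= _ hx hy.
rewrite !oppr0 !addr0 !mul0r subr0 addr0.
have e1 := expR_quadratic hx; have e2 := sin_cubic y; have e3 := cos_quadratic y.
have s1 := sin_max y; have c1 := cos_max y.
have r1 : `|expR x * cos y - 1 - x| <= 2 * x ^+ 2 + y ^+ 2.
  rewrite (_ : _ - x = (expR x - 1 - x) * cos y + (1 + x) * (cos y - 1)); last by ring.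
  apply: le_trans (ler_normD _ _) _; rewrite !normrM.
  have h : `|1 + x| <= 2.
    by apply: le_trans (ler_normD _ _) _; rewrite normr1; lra.
  apply: lerD.
    by rewrite -[leRHS]mulr1 ler_pM.
  rewrite (_ : y ^+ 2 = 2 * (y ^+ 2 / 2)); last by field.
  by rewrite ler_pM.
have r2 : `|expR x * sin y - y| <= 4 * (x ^+ 2 + y ^+ 2).
  rewrite (_ : _ - y = (expR x - 1 - x) * sin y + x * sin y + (sin y - y)); last by ring.
  have sy : `|sin y| <= 2 * `|y|.
    rewrite (_ : sin y = (sin y - y) + y); last by ring.
    apply: le_trans (ler_normD _ _) _.
    have := normr_ge0 y; move: e2 hy; move: (`|y|) => a; nra.
  apply: le_trans (ler_normD _ _) _; apply: (@le_trans _ _ (2 * x ^+ 2 * 1 + `|x| * (2 * `|y|) + `|y| ^+ 3 / 6)).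
    apply: lerD => //; apply: le_trans (ler_normD _ _) _; rewrite !normrM.
    by apply: lerD; rewrite ler_pM.
  rewrite -[in leLHS](real_normK (num_real x)) -[in leRHS](real_normK (num_real x)) -[in leRHS](real_normK (num_real y)).
  have := normr_ge0 x; have := normr_ge0 y; move: hx hy; move: (`|x|) (`|y|) => a b ha hb b0 a0.
  have b3 : b ^+ 3 <= b ^+ 2 by rewrite exprS ler_piMl ?exprn_ge0//; lra.
  by have := sqr_ge0 (a - b); have := sqr_ge0 a; have := sqr_ge0 b; nra.
by have := sqr_ge0 x; have := sqr_ge0 y; lra.
Qed.

End complex_basics.

Section quadratic_differentiability.
Context {R : realType}.
Implicit Types (f g : R[i] -> R[i]) (z w h : R[i]).

Definition quad_derive f z w : Prop := exists C d : R, [/\ 0 <= C, 0 < d &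
  forall h, normc h < d -> normc (f (z + h) - f z - h * w) <= C * normc h ^+ 2].

Lemma quad_derive_is_derive f z w : quad_derive f z w ->
  is_derive (z : R[i]^o) 1 (f : R[i]^o -> R[i]^o) w.
Proof.
move=> [C [d [C0 d0 H]]].
have L : (fun h : R[i]^o => h^-1 *: ((f \o shift z) (h *: (1 : R[i]^o)) - f z) : R[i]^o) @ 0^' --> (w : R[i]^o).
  apply/cvgrPdist_lt => eps e0.
  have [er eE] : exists2 r : R, eps = r%:C & 0 < r.
    move: e0; case: eps => a b; rewrite ltcE/= => /andP[/eqP-> a0].
    by exists a.
  move=> er0.
  near=> h.
  rewrite eE normc_norm ltcR.
  have h0 : h != 0 by near: h; exact: nbhs_dnbhs_neq.
  have hn0 : 0 < normc h by rewrite normc_gt0.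
  have hd : normc h < Num.min d (er / (C + 1)).
    have : `|h| < (Num.min d (er / (C + 1)))%:C.
      near: h; apply: dnbhs0_lt; rewrite ltcR lt_min d0/= divr_gt0//.
      by rewrite ltr_wpDl.
    by rewrite normc_norm ltcR.
  move: hd; rewrite lt_min => /andP[/H + hC].
  rewrite /= /GRing.scale/= mulr1 [h + z]addrC.
  rewrite (_ : w - _ = - (h^-1 * (f (z + h) - f z - h * w))); last first.
    by rewrite [in RHS]mulrBr (mulKf h0) opprB.
  rewrite normcN normcM normcV => H'.
  rewrite mulrC ltr_pdivrMr//; apply: le_lt_trans H' _.
  rewrite expr2 mulrA ltr_pM2r//.
  move: hC; rewrite ltr_pdivlMr ?ltr_wpDl//.
  by move: hn0; move: (normc h) => b; nra.
by split; [apply/cvg_ex; exists w|exact/cvg_lim].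
Unshelve. all: by end_near.
Qed.

Lemma quad_derive_cexp f z w : quad_derive f z w ->
  quad_derive (cexp \o f) z (w * cexp (f z)).
Proof.
move=> [C [d [C0 d0 H]]].
pose K := normc w + C * d.
have K0 : 0 <= K by rewrite addr_ge0 ?normc_ge0// mulr_ge0// ltW.
pose E := normc (cexp (f z)).
have E0 : 0 <= E := normc_ge0 _.
exists (E * (8 * K ^+ 2 + C)), (Num.min d (2^-1 / (K + 1))); split.
- by rewrite mulr_ge0// addr_ge0// mulr_ge0// exprn_ge0.
- by rewrite lt_min d0/= divr_gt0// ltr_wpDl.
move=> h; rewrite lt_min => /andP[hd hK].
have Hh := H h hd; have h0 := normc_ge0 h.
pose k := f (z + h) - f z.
have kle : normc k <= K * normc h.
  rewrite (_ : k = (f (z + h) - f z - h * w) + h * w); last by rewrite subrK.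
  apply: le_trans (le_normcD _ _) _; rewrite normcM /K.
  have : 0 <= C * normc h * (d - normc h).
    by rewrite !mulr_ge0 ?subr_ge0 ?(ltW hd).
  by move: Hh; move: (normc (_ - _ - _)) (normc h) (normc w) => a b c; nra.
have k2 : normc k <= 2^-1.
  apply: le_trans kle _.
  have : normc h * (K + 1) <= 2^-1 by rewrite -ler_pdivlMr ?ltW// ltr_wpDl.
  by rewrite mulrDr mulr1 mulrC; lra.
have fk : f (z + h) = f z + k by rewrite /k; ring.
rewrite /comp fk.
rewrite cexpD.
rewrite (_ : _ - _ - _ = cexp (f z) * ((cexp k - 1 - k) + (k - h * w))); last by ring.
rewrite normcM -mulrA ler_wpM2l//.
apply: le_trans (le_normcD _ _) _; rewrite mulrDl; apply: lerD => //.
apply: le_trans (cexp_quadratic k2) _.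
rewrite -mulrA ler_wpM2l// -exprMn ler_sqr ?nnegrE ?normc_ge0//.
by rewrite mulr_ge0 ?normc_ge0.
Qed.

End quadratic_differentiability.

(** * Herglotz integrals *)

Section complex_measurability.
Context d (X : measurableType d) (R : realType).
Implicit Types f g : X -> R[i].
Local Notation Re := complex.Re.
Local Notation Im := complex.Im.

Definition cmeasurable f : Prop :=
  measurable_fun setT (fun x => Re (f x)) /\ measurable_fun setT (fun x => Im (f x)).

Lemma cmeasurable_cst (c : R[i]) : cmeasurable (fun=> c).
Proof. by split; exact: measurable_cst. Qed.

Lemma cmeasurable_real (u : X -> R) : measurable_fun setT u -> cmeasurable (fun x => (u x)%:C).
Proof. by move=> mu; split => //; exact: measurable_cst. Qed.

Lemma cmeasurableD f g : cmeasurable f -> cmeasurable g -> cmeasurable (fun x => f x + g x).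
Proof.
move=> [f1 f2] [g1 g2]; split.
  by under eq_fun do rewrite Re_addc; exact: measurable_funD.
by under eq_fun do rewrite Im_addc; exact: measurable_funD.
Qed.

Lemma cmeasurableN f : cmeasurable f -> cmeasurable (fun x => - f x).
Proof.
move=> [f1 f2]; split.
  by under eq_fun do rewrite Re_oppc; exact: measurable_funN.
by under eq_fun do rewrite Im_oppc; exact: measurable_funN.
Qed.

Lemma cmeasurableM f g : cmeasurable f -> cmeasurable g -> cmeasurable (fun x => f x * g x).
Proof.
move=> [f1 f2] [g1 g2]; split.
  by under eq_fun do rewrite Re_mulc; apply: measurable_funB; exact: measurable_funM.
by under eq_fun do rewrite Im_mulc; apply: measurable_funD; exact: measurable_funM.
Qed.

Lemma measurable_normc2 f : cmeasurable f -> measurable_fun setT (fun x => normc (f x) ^+ 2).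
Proof.
move=> [f1 f2]; under eq_fun do rewrite normc_sqr.
by apply: measurable_funD; exact: measurable_funX.
Qed.

Lemma cmeasurableV f : cmeasurable f -> cmeasurable (fun x => (f x)^-1).
Proof.
move=> mf; have mi : measurable_fun setT (fun x => (normc (f x) ^+ 2)^-1).
  by apply: (measurableT_comp measurable_invr); exact: measurable_normc2.
case: mf => f1 f2; split.
  by under eq_fun do rewrite Re_invc; exact: measurable_funM.
by under eq_fun do rewrite Im_invc; apply: measurable_funN; exact: measurable_funM.
Qed.

Lemma cmeasurableX f n : cmeasurable f -> cmeasurable (fun x => f x ^+ n).
Proof.
move=> mf; elim: n => [|n IH].
  by under eq_fun do rewrite expr0; exact: cmeasurable_cst.
by under eq_fun do rewrite exprS; exact: cmeasurableM.
Qed.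

Lemma cmeasurable_sum (F : nat -> X -> R[i]) n : (forall i, cmeasurable (F i)) ->
  cmeasurable (fun x => \sum_(i < n) F i x).
Proof.
move=> mF; elim: n => [|n IH].
  by under eq_fun do rewrite big_ord0; exact: cmeasurable_cst.
by under eq_fun do rewrite big_ord_recr; exact: cmeasurableD.
Qed.

Lemma cmeasurable_expi (u : X -> R) : measurable_fun setT u -> cmeasurable (fun x => expi (u x)).
Proof.
move=> mu; split => /=.
  by apply: (measurableT_comp _ mu); apply: continuous_measurable_fun; exact: continuous_cos.
by apply: (measurableT_comp _ mu); apply: continuous_measurable_fun; exact: continuous_sin.
Qed.

End complex_measurability.

Section weighted_integral.
Context {R : realType}.
Local Notation mu := (@lebesgue_measure R).
Local Notation Re := complex.Re.
Local Notation Im := complex.Im.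
Variables (v : R -> R) (iv : mu.-integrable arc (EFin \o v)).
Implicit Types k : R -> R[i].

Lemma measurable_arc : measurable (arc : set (measurableTypeR R)).
Proof. exact: measurable_itv. Qed.

Lemma arc_lty : (mu arc < +oo)%E.
Proof. exact: lebesgue_measure_cc_lty. Qed.

Definition wint k : R[i] := arc_cintegral (fun t => k t * (v t)%:C).

Definition cbounded k (B : R) : Prop :=
  cmeasurable (k : measurableTypeR R -> R[i]) /\ forall t, normc (k t) <= B.

Lemma integrable_bounded_mul (f : R -> R) (B : R) : measurable_fun setT f ->
  (forall t, `|f t| <= B) -> mu.-integrable arc (fun t => (f t * v t)%:E).
Proof.
move=> mf fB.
have B0 : 0 <= B := le_trans (normr_ge0 _) (fB 0).
apply: (@le_integrable _ _ _ _ _ measurable_arc _ (fun t => B%:E * (v t)%:E)%E).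
- apply/measurable_EFinP; apply: measurable_funM; first exact: measurable_funTS.
  by case/integrableP: iv => /measurable_EFinP.
- move=> t _ /=; rewrite lee_fin !normrM ler_wpM2r//.
  by rewrite (le_trans (fB t))// ler_norm.
- by apply: integrableZl => //; exact: measurable_arc.
Qed.

Lemma integrable_wint k B : cbounded k B ->
  mu.-integrable arc (fun t => (Re (k t * (v t)%:C))%:E) /\
  mu.-integrable arc (fun t => (Im (k t * (v t)%:C))%:E).
Proof.
move=> [[m1 m2] kB]; split.
  under eq_fun do rewrite Re_mulc mulr0 subr0.
  by apply: (integrable_bounded_mul m1) => t; exact: le_trans (Re_le_normc _) (kB t).
under eq_fun do rewrite Im_mulc mulr0 add0r.
by apply: (integrable_bounded_mul m2) => t; exact: le_trans (Im_le_normc _) (kB t).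
Qed.

Lemma wintD k1 k2 B1 B2 : cbounded k1 B1 -> cbounded k2 B2 ->
  wint (fun t => k1 t + k2 t) = wint k1 + wint k2.
Proof.
move=> /integrable_wint[a1 a2] /integrable_wint[b1 b2].
rewrite /wint /arc_cintegral; apply/eqP; rewrite eq_complex/=; apply/andP; split; apply/eqP.
  rewrite -RintegralD//; [|exact: measurable_arc].
  by apply: eq_Rintegral => t _; rewrite mulrDl Re_addc.
rewrite -RintegralD//; [|exact: measurable_arc].
by apply: eq_Rintegral => t _; rewrite mulrDl Im_addc.
Qed.

Lemma wintZ (c : R[i]) k B : cbounded k B -> wint (fun t => c * k t) = c * wint k.
Proof.
move=> /integrable_wint[a1 a2].
have iZ (x : R) (f : R -> R) : mu.-integrable arc (fun t => (f t)%:E) ->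
    mu.-integrable arc (fun t => (x * f t)%:E).
  by move=> h; apply: (integrableZl measurable_arc x h).
rewrite /wint /arc_cintegral; apply/eqP; rewrite eq_complex Re_mulc Im_mulc /=; apply/andP; split; apply/eqP.
  rewrite -!RintegralZl//; [|exact: measurable_arc..].
  rewrite -RintegralB//; [|exact: measurable_arc|exact: iZ|exact: iZ].
  by apply: eq_Rintegral => t _; rewrite -mulrA Re_mulc.
rewrite -!RintegralZl//; [|exact: measurable_arc..].
rewrite -RintegralD//; [|exact: measurable_arc|exact: iZ|exact: iZ].
by apply: eq_Rintegral => t _; rewrite -mulrA Im_mulc.
Qed.

Lemma wint_bound k B : cbounded k B ->
  normc (wint k) <= 2 * B * \int[mu]_(t in arc) `|v t|.
Proof.
move=> kb; have [a1 a2] := integrable_wint kb.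
have B0 : 0 <= B := le_trans (normc_ge0 _) (kb.2 0).
have iav : mu.-integrable arc (EFin \o (fun t => `|v t|)).
  exact: integrable_norm iv.
have main (f : R -> R) : mu.-integrable arc (fun t => (f t)%:E) ->
    (forall t, `|f t| <= B * `|v t|) ->
    `|\int[mu]_(t in arc) f t| <= B * \int[mu]_(t in arc) `|v t|.
  move=> fi fB; apply: le_trans (le_normr_Rintegral measurable_arc fi) _.
  rewrite -RintegralZl//; last exact: measurable_arc.
  apply: le_Rintegral => //.
  - exact: measurable_arc.
  - exact: integrable_norm fi.
  - by apply: (integrableZl measurable_arc B iav).
apply: le_trans (normc_le_ReIm _) _; rewrite -mulrA mulrDl mul1r /=.
have vE t : normc (k t * (v t)%:C) <= B * `|v t|.
  by rewrite normcM normc_real ler_wpM2r// kb.2.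
by apply: lerD; apply: main => // t; apply: le_trans (vE t);
  [exact: Re_le_normc|exact: Im_le_normc].
Qed.

Lemma eq_wint k1 k2 : k1 =1 k2 -> wint k1 = wint k2.
Proof. by move=> /funext ->. Qed.

Lemma cboundedM k1 k2 B1 B2 : cbounded k1 B1 -> cbounded k2 B2 ->
  cbounded (fun t => k1 t * k2 t) (B1 * B2).
Proof.
move=> [m1 h1] [m2 h2]; split; first exact: cmeasurableM.
by move=> t; rewrite normcM ler_pM ?normc_ge0.
Qed.

Lemma cboundedD k1 k2 B1 B2 : cbounded k1 B1 -> cbounded k2 B2 ->
  cbounded (fun t => k1 t + k2 t) (B1 + B2).
Proof.
move=> [m1 h1] [m2 h2]; split; first exact: cmeasurableD.
by move=> t; apply: le_trans (le_normcD _ _) _; rewrite lerD.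
Qed.

Lemma cbounded_cst c : cbounded (fun=> c) (normc c).
Proof. by split => //; exact: cmeasurable_cst. Qed.

Lemma cbounded_expiX n : cbounded (fun t => expi (- t) ^+ n) 1.
Proof.
split; last by move=> t; rewrite normcX normc_expi expr1n.
by apply: cmeasurableX; apply: cmeasurable_expi; exact: measurable_funN.
Qed.

Definition fcoef n : R[i] := ((2 * pi)^-1)%:C * wint (fun t => expi (- t) ^+ n).

Definition herglotz (z : R[i]) : R[i] :=
  ((2 * pi)^-1)%:C * wint (fun t => (expi t + z) / (expi t - z)).

Definition dherglotz (z : R[i]) : R[i] :=
  ((2 * pi)^-1)%:C * wint (fun t => 2 * expi t / (expi t - z) ^+ 2).

Lemma cbounded_sum (a : nat -> R[i]) m n : exists B,
  cbounded (fun t => \sum_(i < n) a i * expi (- t) ^+ (i + m)) B.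
Proof.
elim: n => [|n [B IH]].
  exists 0; rewrite (_ : (fun t => _) = fun=> 0).
    by split => [|t]; [exact: cmeasurable_cst|rewrite normc0].
  by apply/funext => t; rewrite big_ord0.
exists (B + normc (a n) * 1).
rewrite (_ : (fun t => _) = fun t => \sum_(i < n) a i * expi (- t) ^+ (i + m) + a n * expi (- t) ^+ (n + m)).
  by apply: cboundedD => //; apply: cboundedM; [exact: cbounded_cst|exact: cbounded_expiX].
by apply/funext => t; rewrite big_ord_recr.
Qed.

Lemma wint_sum (a : nat -> R[i]) m n :
  ((2 * pi)^-1)%:C * wint (fun t => \sum_(i < n) a i * expi (- t) ^+ (i + m)) =
  \sum_(i < n) a i * fcoef (i + m).
Proof.
elim: n => [|n IH].
  rewrite big_ord0 (eq_wint (k2 := fun t => 0 * 1)) => [|t]; last by rewrite big_ord0 mul0r.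
  by rewrite (wintZ _ (cbounded_cst 1)) mul0r mulr0.
rewrite big_ord_recr/= -IH.
have [B hB] := cbounded_sum a m n.
rewrite (eq_wint (k2 := fun t => \sum_(i < n) a i * expi (- t) ^+ (i + m) + a n * expi (- t) ^+ (n + m))) => [|t]; last by rewrite big_ord_recr.
rewrite (wintD hB (cboundedM (cbounded_cst (a n)) (cbounded_expiX (n + m)))).
by rewrite (wintZ _ (cbounded_expiX _)) /fcoef; ring.
Qed.

Lemma normc_expi_sub_ge (z : R[i]) t : 1 - normc z <= normc (expi t - z).
Proof.
rewrite lerBlDr -(normc_expi t) -{1}(subrK z (expi t)); exact: le_normcD.
Qed.

Lemma expi_sub_neq0 (z : R[i]) t : normc z < 1 -> expi t - z != 0.
Proof.
move=> z1; rewrite -normc_gt0; apply: lt_le_trans (normc_expi_sub_ge _ _).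
by rewrite subr_gt0.
Qed.

Lemma cbounded_inv (z : R[i]) : normc z < 1 ->
  cbounded (fun t => (expi t - z)^-1) (1 - normc z)^-1.
Proof.
move=> z1; split.
  apply: cmeasurableV; apply: cmeasurableD; last exact: cmeasurable_cst.
  exact: (@cmeasurable_expi _ (measurableTypeR R) R id).
move=> t; rewrite normcV lef_pV2 ?posrE ?subr_gt0 ?normc_expi_sub_ge//.
by rewrite normc_gt0 expi_sub_neq0.
Qed.

Lemma cbounded_expi : cbounded expi 1.
Proof.
split; last by move=> t; rewrite normc_expi.
exact: (@cmeasurable_expi _ (measurableTypeR R) R id).
Qed.

Lemma cboundedX k B n : cbounded k B -> cbounded (fun t => k t ^+ n) (B ^+ n).
Proof.
move=> [mk kB]; split; first exact: cmeasurableX.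
by move=> t; rewrite normcX lerXn2r// nnegrE ?normc_ge0// (le_trans (normc_ge0 _) (kB t)).
Qed.

Lemma cbounded_herglotz (z : R[i]) : normc z < 1 ->
  cbounded (fun t => (expi t + z) / (expi t - z)) ((1 + normc z) * (1 - normc z)^-1).
Proof.
move=> z1; apply: cboundedM (cbounded_inv z1).
exact: cboundedD cbounded_expi (cbounded_cst z).
Qed.

Lemma cbounded_dherglotz (z : R[i]) : normc z < 1 ->
  cbounded (fun t => 2 * expi t / (expi t - z) ^+ 2)
    (normc (2 : R[i]) * 1 * (1 - normc z)^-1 ^+ 2).
Proof.
move=> z1; under eq_fun do rewrite -exprVn.
apply: cboundedM; last exact: cboundedX (cbounded_inv z1).
exact: cboundedM (cbounded_cst 2) cbounded_expi.
Qed.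

Let V : R := \int[mu]_(t in arc) `|v t|.

Let V0 : 0 <= V.
Proof. by apply: Rintegral_ge0. Qed.

Let pi_inv_ge0 : 0 <= ((2 * pi)^-1 : R).
Proof. by rewrite invr_ge0 mulr_ge0// pi_ge0. Qed.

Lemma quad_derive_herglotz (z : R[i]) : normc z < 1 ->
  quad_derive herglotz z (dherglotz z).
Proof.
move=> z1; pose d := (1 - normc z) / 2.
have d0 : 0 < d by rewrite divr_gt0// subr_gt0.
exists ((2 * pi)^-1 * (2 * (normc (2 : R[i]) * 1 * (1 - normc z)^-1 ^+ 2 * d^-1) * V)), d; split => //.
  by rewrite !mulr_ge0// ?normc_ge0// ?exprn_ge0// ?invr_ge0 ?subr_ge0 ?(ltW d0) ?(ltW z1).
move=> h hd.
have zh1 : normc (z + h) < 1.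
  by apply: le_lt_trans (le_normcD _ _) _; rewrite /d in hd; have := normc_ge0 h; lra.
have dzh : d <= 1 - normc (z + h).
  have := le_normcD z h; rewrite /d in hd *; lra.
pose kz t := (expi t + z) / (expi t - z); pose kh t := (expi t + (z + h)) / (expi t - (z + h)).
pose dk t := 2 * expi t / (expi t - z) ^+ 2.
have rb : cbounded (fun t => dk t * (expi t - (z + h))^-1)
    (normc (2 : R[i]) * 1 * (1 - normc z)^-1 ^+ 2 * d^-1).
  have [m1 b1] := cboundedM (cbounded_dherglotz z1) (cbounded_inv zh1).
  split => // t; apply: le_trans (b1 t) _.
  rewrite ler_wpM2l//; last by rewrite lef_pV2 ?posrE// (lt_le_trans d0).
  by rewrite !mulr_ge0// ?normc_ge0// ?exprn_ge0// invr_ge0 subr_ge0 ltW.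
have e t : kh t = (kz t + h * dk t) + h ^+ 2 * (dk t * (expi t - (z + h))^-1).
  rewrite /kh /kz /dk; field.
  by rewrite expi_sub_neq0//= expi_sub_neq0.
rewrite /herglotz -/kz -/kh (eq_wint e).
rewrite (wintD (cboundedD (cbounded_herglotz z1) (cboundedM (cbounded_cst h) (cbounded_dherglotz z1))) (cboundedM (cbounded_cst (h ^+ 2)) rb)).
rewrite (wintD (cbounded_herglotz z1) (cboundedM (cbounded_cst h) (cbounded_dherglotz z1))).
rewrite (wintZ _ rb) (wintZ _ (cbounded_dherglotz z1)) /dherglotz.
rewrite (_ : _ - _ - _ = ((2 * pi)^-1)%:C * (h ^+ 2 * wint (fun t => dk t / (expi t - (z + h))))); last first.
  by rewrite -/kz -/dk; ring.
rewrite normcM normc_real (ger0_norm pi_inv_ge0) normcM normcX.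
rewrite -[leRHS]mulrA ler_wpM2l// mulrC ler_wpM2r ?exprn_ge0 ?normc_ge0//.
exact: wint_bound rb.
Qed.

Lemma herglotz_kernel_expansion (e z : R[i]) n : e != 0 -> e - z != 0 ->
  (e + z) / (e - z) = 1 + \sum_(i < n) (2 * z ^+ i.+1) * (e^-1) ^+ (i + 1) +
     2 * z ^+ n.+1 * ((e^-1) ^+ n * (e - z)^-1).
Proof.
move=> e0 ez0; elim: n => [|n IH].
  by rewrite big_ord0 addr0 expr0 expr1; field.
rewrite IH big_ord_recr/= addn1 !exprS -!addrA; congr (_ + (_ + _)).
by move: (z ^+ n) (e^-1 ^+ n) => a b; field; rewrite ?e0 ?ez0.
Qed.

Lemma dherglotz_kernel_expansion (e z : R[i]) n : e != 0 -> e - z != 0 ->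
  2 * e / (e - z) ^+ 2 = \sum_(i < n) (2 * i.+1%:R * z ^+ i) * (e^-1) ^+ (i + 1) +
     2 * z ^+ n * ((e^-1) ^+ n * ((n.+1%:R * e - n%:R * z) * (e - z)^-1 ^+ 2)).
Proof.
move=> e0 ez0; elim: n => [|n IH].
  by rewrite big_ord0 add0r !expr0; field.
rewrite IH big_ord_recr/= addn1 !exprS -!addrA; congr (_ + _).
by rewrite -!natr1; move: (z ^+ n) (e^-1 ^+ n) => a b; field; rewrite ?e0 ?ez0.
Qed.

Lemma herglotz_expansion (z : R[i]) n : normc z < 1 ->
  normc (herglotz z - fcoef 0 - \sum_(i < n) (2 * fcoef i.+1) * z ^+ i.+1) <=
  ((2 * pi)^-1 * (2 * (1 - normc z)^-1 * V)) * (normc (2 : R[i]) * normc z ^+ n.+1).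
Proof.
move=> z1.
have iE (t : R) : expi (- t) = (expi t)^-1 by exact: expiN.
pose a i := 2 * z ^+ i.+1.
have [B hB] := cbounded_sum a 1 n.
have b0 : cbounded (fun t => expi (- t) ^+ 0) 1 by exact: cbounded_expiX.
have br : cbounded (fun t => expi (- t) ^+ n * (expi t - z)^-1) (1 * (1 - normc z)^-1).
  by apply: cboundedM (cbounded_inv z1); exact: cbounded_expiX.
have e t : (expi t + z) / (expi t - z) = (expi (- t) ^+ 0 + \sum_(i < n) a i * expi (- t) ^+ (i + 1)) +
    (2 * z ^+ n.+1) * (expi (- t) ^+ n * (expi t - z)^-1).
  by rewrite expr0 iE; apply: herglotz_kernel_expansion; rewrite ?expi_neq0 ?expi_sub_neq0.
rewrite /herglotz (eq_wint e) (wintD (cboundedD b0 hB) (cboundedM (cbounded_cst _) br)).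
rewrite (wintD b0 hB) (wintZ _ br).
have -> : \sum_(i < n) (2 * fcoef i.+1) * z ^+ i.+1 =
    ((2 * pi)^-1)%:C * wint (fun t => \sum_(i < n) a i * expi (- t) ^+ (i + 1)).
  by rewrite wint_sum; apply: eq_bigr => i _; rewrite addn1 /a; ring.
rewrite /fcoef (_ : _ - _ - _ = ((2 * pi)^-1)%:C * (2 * z ^+ n.+1 * wint (fun t => expi (- t) ^+ n / (expi t - z)))); last first.
  by ring.
rewrite !normcM normc_real (ger0_norm pi_inv_ge0) normcX.
rewrite -[leRHS]mulrA ler_wpM2l// mulrC ler_wpM2r ?mulr_ge0 ?exprn_ge0 ?normc_ge0//.
by have := wint_bound br; rewrite mul1r.
Qed.

Lemma dherglotz_expansion (z : R[i]) n : normc z < 1 ->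
  normc (dherglotz z - \sum_(i < n) (2 * i.+1%:R * fcoef i.+1) * z ^+ i) <=
  ((2 * pi)^-1 * (2 * (normc (2 : R[i]) * (1 - normc z)^-1 ^+ 2) * V)) * (n.+1%:R * 2 * normc z ^+ n).
Proof.
move=> z1.
have iE (t : R) : expi (- t) = (expi t)^-1 by exact: expiN.
pose a i := 2 * i.+1%:R * z ^+ i.
have [B hB] := cbounded_sum a 1 n.
have br : cbounded (fun t => 2 * (expi (- t) ^+ n * ((n.+1%:R * expi t - n%:R * z) * (expi t - z)^-1 ^+ 2)))
   (normc (2 : R[i]) * (1 * ((n.+1%:R * 1 + n.+1%:R * 1) * (1 - normc z)^-1 ^+ 2))).
  apply: cboundedM (cbounded_cst _) _; apply: cboundedM (cbounded_expiX n) _.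
  apply: cboundedM (cboundedX 2 (cbounded_inv z1)).
  have nE (m : nat) : normc (m%:R : R[i]) = m%:R.
    by rewrite -(rmorph_nat (real_complex R)) normc_real ger0_norm.
  apply: cboundedD.
    by have := cboundedM (cbounded_cst n.+1%:R) cbounded_expi; rewrite nE.
  split; first exact: cmeasurable_cst.
  move=> t; rewrite normcN normcM nE ler_pM ?normc_ge0 ?ler_nat// ltW//.
have e t : 2 * expi t / (expi t - z) ^+ 2 = \sum_(i < n) a i * expi (- t) ^+ (i + 1) +
    (z ^+ n) * (2 * (expi (- t) ^+ n * ((n.+1%:R * expi t - n%:R * z) * (expi t - z)^-1 ^+ 2))).
  rewrite iE [_ ^+ n * (2 * _)]mulrA [_ ^+ n * 2]mulrC.
  by apply: dherglotz_kernel_expansion; rewrite ?expi_neq0 ?expi_sub_neq0.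
rewrite /dherglotz (eq_wint e) (wintD hB (cboundedM (cbounded_cst _) br)).
rewrite (wintZ _ br).
have -> : \sum_(i < n) (2 * i.+1%:R * fcoef i.+1) * z ^+ i =
    ((2 * pi)^-1)%:C * wint (fun t => \sum_(i < n) a i * expi (- t) ^+ (i + 1)).
  by rewrite wint_sum; apply: eq_bigr => i _; rewrite addn1 /a; ring.
rewrite [_ * (_ + _)]mulrDr addrAC subrr add0r 2!normcM normc_real (ger0_norm pi_inv_ge0) normcX.
apply: (@le_trans _ _ ((2 * pi)^-1 * (normc z ^+ n * (2 * (normc (2 : R[i]) * (1 * ((n.+1%:R * 1 + n.+1%:R * 1) * (1 - normc z)^-1 ^+ 2))) * V)))).
  by rewrite ler_wpM2l// ler_wpM2l ?exprn_ge0 ?normc_ge0//; exact: wint_bound br.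
by rewrite le_eqVlt; apply/orP; left; apply/eqP; ring.
Qed.

End weighted_integral.

(** * Fourier coefficients *)

Section parseval.
Context {R : realType}.
Local Notation mu := (@lebesgue_measure R).
Local Notation Re := complex.Re.
Local Notation Im := complex.Im.
Implicit Types (a : nat -> R[i]) (t : R).

Lemma integrable_arc_bounded (f : R -> R) (M : R) : measurable_fun setT f ->
  (forall t, `|f t| <= M) -> mu.-integrable arc (EFin \o f).
Proof.
move=> mf fM; apply: (@integrable_le_cst _ _ _ _ _ _ M) => //.
- exact: measurable_arc.
- exact: arc_lty.
- exact: measurable_funTS.
Qed.

Lemma integrable_arc1 : mu.-integrable arc (EFin \o (cst 1 : R -> R)).
Proof. by apply: (integrable_arc_bounded (M := 1)) => // t; rewrite normr1. Qed.

Lemma EFin_Rintegral (f : R -> R) : mu.-integrable arc (EFin \o f) ->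
  (\int[mu]_(t in arc) f t)%:E = (\int[mu]_(t in arc) (f t)%:E)%E.
Proof. by move=> fi; rewrite fineK// integrable_fin_num//; exact: measurable_arc. Qed.

Lemma Rintegral_arc_cst (c : R) : \int[mu]_(t in arc) c = 2 * pi * c.
Proof.
rewrite Rintegral_cst; last exact: measurable_arc.
suff e : mu arc = (2 * pi)%:E by rewrite [X in fine X]e mulrC.
have pp := @pi_gt0 R; have ppp : - pi < pi :> R by lra.
have := @lebesgue_measure_itv R `[- pi, pi]%R; rewrite /= lte_fin ppp => ->.
by rewrite -EFinD; congr EFin; ring.
Qed.

Lemma integral_trig (n : nat) :
  \int[mu]_(t in arc) cos (n.+1%:R * t) = 0 /\ \int[mu]_(t in arc) sin (n.+1%:R * t) = 0.
Proof.
have pp := @pi_gt0 R; have ppp : - pi < pi :> R by lra.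
have N0 : n.+1%:R != 0 :> R by rewrite pnatr_eq0.
have dl t : is_derive t (1 : R) (fun t => n.+1%:R * t) n.+1%:R.
  have := @is_derive_scaleX R n.+1%:R 0 t.
  by rewrite expr0 !mulr1; under eq_fun do rewrite expr1.
have ck : continuous (fun t : R => n.+1%:R * t) by exact: is_derive_continuous dl.
have sinpi : sin (n.+1%:R * pi) = 0 :> R.
  elim: {dl ck N0} n.+1 => [|m IH]; first by rewrite mul0r sin0.
  by rewrite -natr1 mulrDl mul1r sinDpi IH oppr0.
split; rewrite /Rintegral.
  have dF (t : R) : is_derive t 1 (fun t => n.+1%:R^-1 * sin (n.+1%:R * t)) (cos (n.+1%:R * t)).
    have d1 := is_derive1_comp (is_derive_sin (n.+1%:R * t)) (dl t).
    have := @is_deriveZ _ _ _ _ n.+1%:R^-1 _ _ _ d1.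
    by rewrite /GRing.scale/= mulrCA mulVf// mulr1.
  rewrite (integral_is_derive ppp dF).
    by rewrite /= mulrN sinN sinpi oppr0 subrr.
  by move=> t; apply: continuous_comp; [exact: ck|exact: continuous_cos].
have dF (t : R) : is_derive t 1 (fun t => - n.+1%:R^-1 * cos (n.+1%:R * t)) (sin (n.+1%:R * t)).
  have d1 := is_derive1_comp (is_derive_cos (n.+1%:R * t)) (dl t).
  have := @is_deriveZ _ _ _ _ (- n.+1%:R^-1) _ _ _ d1.
  rewrite /GRing.scale/= (_ : - n.+1%:R^-1 * (- _ * _) = sin (n.+1%:R * t))//.
  by move: N0; move: (n.+1%:R : R) => N N0; field.
rewrite (integral_is_derive ppp dF).
  by rewrite /= mulrN cosN subrr.
by move=> t; apply: continuous_comp; [exact: ck|exact: continuous_sin].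
Qed.

Lemma fcoef1 (n : nat) : fcoef (cst 1 : R -> R) n = (n == 0%N)%:R.
Proof.
rewrite /fcoef /wint /arc_cintegral.
have pp : 2 * pi != 0 :> R by rewrite mulf_neq0// gt_eqF// pi_gt0.
case: n => [|n].
  rewrite (_ : Rintegral _ _ _ +i* _ = (2 * pi)%:C).
    by rewrite -rmorphM/= mulVf.
  congr (_ +i* _).
    rewrite (_ : 2 * pi = 2 * pi * 1); last by rewrite mulr1.
    by rewrite -Rintegral_arc_cst; apply: eq_Rintegral => t _; rewrite expr0 mulr1.
  rewrite (_ : 0 = 2 * pi * 0); last by rewrite mulr0.
  by rewrite -Rintegral_arc_cst; apply: eq_Rintegral => t _; rewrite expr0 mulr1.
have [h1 h2] := integral_trig n.
have e t : expi (- t) ^+ n.+1 * 1%:C = cos (n.+1%:R * t) +i* (- sin (n.+1%:R * t)) :> R[i].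
  by rewrite mulr1 -expi_nat mulrN /expi cosN sinN.
have h3 : \int[mu]_(t in arc) ((-1) * sin (n.+1%:R * t)) = 0.
  rewrite RintegralZl ?h2 ?mulr0//; first exact: measurable_arc.
  apply: (integrable_arc_bounded (M := 1)) => [|t]; last exact: sin_max.
  apply: continuous_measurable_fun => t; apply: continuous_comp; last exact: continuous_sin.
  by apply: cvgM; [exact: cvg_cst|exact: cvg_id].
transitivity (((2 * pi)^-1)%:C * (0 +i* 0) : R[i]); last by rewrite mulr0.
congr (_ * (_ +i* _)).
  by rewrite -[RHS]h1; apply: eq_Rintegral => t _; rewrite e.
by rewrite -[RHS]h3; apply: eq_Rintegral => t _; rewrite e mulN1r.
Qed.

Definition trig_poly a n t : R[i] := \sum_(i < n) a i * expi t ^+ i.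

Lemma cmeasurable_trig_poly a n : cmeasurable (trig_poly a n : measurableTypeR R -> R[i]).
Proof.
apply: (cmeasurable_sum (F := fun i t => a i * expi t ^+ i)) => i.
apply: cmeasurableM; first exact: cmeasurable_cst.
by apply: cmeasurableX; exact: (@cmeasurable_expi _ (measurableTypeR R) R id).
Qed.

Lemma trig_poly_bound a n : exists2 B, 0 <= B & forall t, normc (trig_poly a n t) <= B.
Proof.
rewrite /trig_poly; elim: n => [|n [B B0 IH]].
  by exists 0 => // t; rewrite big_ord0 normc0.
exists (B + normc (a n)); first by rewrite addr_ge0 ?normc_ge0.
move=> t; rewrite big_ord_recr/=; apply: le_trans (le_normcD _ _) _.
by rewrite lerD// normcM normcX normc_expi expr1n mulr1.
Qed.

Lemma integrable_normc2 (k : R -> R[i]) (B : R) : cmeasurable (k : measurableTypeR R -> R[i]) ->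
  (forall t, normc (k t) <= B) -> mu.-integrable arc (EFin \o (fun t => normc (k t) ^+ 2)).
Proof.
move=> mk kB; apply: (integrable_arc_bounded (M := B ^+ 2)); first exact: measurable_normc2 mk.
move=> t; rewrite ger0_norm ?exprn_ge0 ?normc_ge0// ler_sqr ?nnegrE ?normc_ge0//.
exact: le_trans (normc_ge0 _) (kB t).
Qed.

Lemma normcD_sqr (z w : R[i]) :
  normc (z + w) ^+ 2 = normc z ^+ 2 + normc w ^+ 2 + 2 * Re (z * conjc w).
Proof. by rewrite !normc_sqr; case: z => a b; case: w => c d /=; ring. Qed.

Lemma conjc_expi t : conjc (expi t) = expi (- t).
Proof. by rewrite /expi cosN sinN. Qed.

Lemma conjcM (z w : R[i]) : conjc (z * w) = conjc z * conjc w.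
Proof. exact: rmorphM. Qed.

Lemma conjcXn (z : R[i]) n : conjc (z ^+ n) = conjc z ^+ n.
Proof. exact: rmorphXn. Qed.

Lemma conjc_sum n (F : nat -> R[i]) : conjc (\sum_(i < n) F i) = \sum_(i < n) conjc (F i).
Proof. exact: rmorph_sum. Qed.

Lemma real_complex_sum n (F : nat -> R) :
  (\sum_(i < n) F i)%:C = \sum_(i < n) (F i)%:C :> R[i].
Proof. exact: (rmorph_sum (real_complex R)). Qed.

Lemma parseval_trig_poly a n :
  \int[mu]_(t in arc) normc (trig_poly a n t) ^+ 2 = 2 * pi * \sum_(i < n) normc (a i) ^+ 2.
Proof.
elim: n => [|n IH].
  rewrite big_ord0 -Rintegral_arc_cst.
  by apply: eq_Rintegral => t _; rewrite /trig_poly big_ord0 normc0 expr0n.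
pose b i : R[i] := a (n - i.+1)%N * conjc (a n).
have e t : normc (trig_poly a n.+1 t) ^+ 2 = (normc (trig_poly a n t) ^+ 2 + normc (a n) ^+ 2) +
    2 * Re ((\sum_(i < n) b i * expi (- t) ^+ (i + 1)) * ((1 : R))%:C).
  rewrite /trig_poly big_ord_recr/= normcD_sqr normcM normcX normc_expi expr1n mulr1.
  congr (_ + 2 * Re _); rewrite mulr1 mulr_suml (reindex_inj rev_ord_inj)/=.
  apply: eq_bigr => i _; rewrite /b conjcM conjcXn conjc_expi.
  rewrite mulrACA -!mulrA; congr (_ * _); congr (_ * _).
  rewrite expiN exprVn addn1.
  rewrite -[in X in _ / X](subnK (ltn_ord i)) exprD invfM mulrA mulfV ?mul1r ?exprVn//.
  by rewrite expf_neq0// expi_neq0.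
transitivity (\int[mu]_(t in arc) ((normc (trig_poly a n t) ^+ 2 + normc (a n) ^+ 2) +
    2 * Re ((\sum_(i < n) b i * expi (- t) ^+ (i + 1)) * ((1 : R))%:C))).
  by apply: eq_Rintegral => t _; rewrite e.
have [B1 _ hB1] := trig_poly_bound a n.
have [B hB] := cbounded_sum b 1 n.
have [i1 _] := integrable_wint integrable_arc1 hB.
have i2 := integrable_normc2 (cmeasurable_trig_poly a n) hB1.
have i3 : mu.-integrable arc (EFin \o (cst (normc (a n) ^+ 2) : R -> R)).
  by apply: (integrable_arc_bounded (M := `|normc (a n) ^+ 2|)).
rewrite RintegralD//; last 3 first.
- exact: measurable_arc.
- by have := integrableD measurable_arc i2 i3; under eq_fun do rewrite -EFinD.
- exact: (integrableZl measurable_arc 2 i1).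
rewrite RintegralD//; last exact: measurable_arc.
rewrite [X in _ + X]RintegralZl//; last exact: measurable_arc.
rewrite IH Rintegral_arc_cst big_ord_recr/= -mulrDr.
have := wint_sum integrable_arc1 b 1 n.
rewrite big1 => [|i _]; last by rewrite fcoef1 addn1 mulr0.
move=> /eqP; rewrite mulf_eq0 => /orP[|/eqP].
  rewrite -normr_eq0 normc_norm normc_real => /eqP[/eqP].
  by rewrite normr_eq0 invr_eq0 mulf_eq0 (gt_eqF (pi_gt0 R)) pnatr_eq0.
move=> /(congr1 (@complex.Re R))/= h.
by rewrite [X in _ + 2 * X](_ : _ = 0) ?mulr0 ?addr0.
Qed.

Lemma parseval a (G : R -> R[i]) (eps : nat -> R) :
  cmeasurable (G : measurableTypeR R -> R[i]) -> eps @ \oo --> (0 : R) ->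
  (forall n t, normc (G t - trig_poly a n t) <= eps n) ->
  (\int[mu]_(t in arc) (normc (G t) ^+ 2)%:E =
   \sum_(n <oo) (2 * pi * normc (a n) ^+ 2)%:E)%E.
Proof.
move=> mG eps0 Ge.
have [E hE] : exists E, forall n, eps n <= E.
  have /cvg_seq_bounded/pinfty_ex_gt0[E E0 hE] : cvgn eps by apply/cvg_ex; exists 0.
  by exists E => n; apply: le_trans (ler_norm _) _; exact: hE.
have Gb t : normc (G t) <= E.
  by have := Ge 0%N t; rewrite /trig_poly big_ord0 subr0 => /le_trans; exact.
have Sb n t : normc (trig_poly a n t) <= E + E.
  rewrite (_ : trig_poly a n t = - (G t - trig_poly a n t) + G t); last by ring.
  by apply: le_trans (le_normcD _ _) _; rewrite normcN lerD// (le_trans (Ge n t)).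
have Sn t : (fun n => normc (trig_poly a n t) ^+ 2) @ \oo --> normc (G t) ^+ 2.
  have h : (fun n => normc (trig_poly a n t)) @ \oo --> normc (G t).
    apply/cvgrPdist_le => e e0; move/cvgrPdist_le : eps0 => /(_ e e0).
    apply: filterS => n; rewrite sub0r normrN => epse.
    apply: (@le_trans _ _ (eps n)); last exact: le_trans (ler_norm _) epse.
    apply: le_trans (Ge n t); rewrite ler_norml; apply/andP; split.
      rewrite lerNl opprB lerBlDr -(normcN (G t - _)) opprB.
      by apply: le_trans (le_normcD _ _); rewrite subrK.
    by rewrite lerBlDr; apply: le_trans (le_normcD _ _); rewrite subrK.
  by under eq_fun do rewrite expr2; rewrite expr2; exact: cvgM.
have := @dominated_convergence _ _ _ mu arc measurable_arc
  (fun n t => (normc (trig_poly a n t) ^+ 2)%:E) (fun t => (normc (G t) ^+ 2)%:E)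
  (fun t => ((E + E) ^+ 2)%:E).
move=> /(_ _ _ _ _ _)[].
- move=> n; apply/measurable_EFinP; apply: measurable_funTS.
  exact: measurable_normc2 (cmeasurable_trig_poly a n).
- by apply/measurable_EFinP; apply: measurable_funTS; exact: measurable_normc2 mG.
- by apply: aeW => t _; apply/fine_cvgP; split; [exact: nearW|exact: Sn].
- by apply: (integrable_arc_bounded (M := `|(E + E) ^+ 2|)).
- apply: aeW => t n _; rewrite gee0_abs ?lee_fin ?exprn_ge0 ?normc_ge0//.
  by rewrite ler_sqr ?nnegrE ?normc_ge0// (le_trans (normc_ge0 _) (Sb n t)).
move=> _ _ h; apply/esym; apply: cvg_lim => //.
apply: cvg_trans h; apply: near_eq_cvg; apply: nearW => n /=.
rewrite big_mkord sumEFin -EFin_Rintegral; last exact: integrable_normc2 (cmeasurable_trig_poly a n) (Sb n).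
by rewrite parseval_trig_poly mulr_sumr.
Qed.

Lemma bessel (v : R -> R) (M : R) n : measurable_fun setT v -> (forall t, `|v t| <= M) ->
  2 * pi * \sum_(i < n) normc (fcoef v i.+1) ^+ 2 <= \int[mu]_(t in arc) v t ^+ 2.
Proof.
move=> mv vM; have iv := integrable_arc_bounded mv vM.
pose c i := fcoef v i.+1.
pose S t : R[i] := \sum_(i < n) conjc (c i) * expi (- t) ^+ (i + 1).
have [B hB] := cbounded_sum (fun i => conjc (c i)) 1 n.
have [i1 _] := integrable_wint iv hB.
have Snorm t : normc (S t) = normc (trig_poly c n t).
  have e : conjc (S t) = trig_poly c n t * expi t.
    rewrite /S (conjc_sum n (fun i => conjc (c i) * expi (- t) ^+ (i + 1))) /trig_poly mulr_suml; apply: eq_bigr => i _.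
    by rewrite conjcM conjcK conjcXn conjc_expi opprK addn1 exprSr mulrA.
  have nJ z : normc (conjc z : R[i]) = normc z.
    by case: z => p q /=; rewrite sqrrN.
  by rewrite -[LHS]nJ e normcM normc_expi mulr1.
have [B1 _ hB1] := trig_poly_bound c n.
have iS := integrable_normc2 (cmeasurable_trig_poly c n) hB1.
have IS : \int[mu]_(t in arc) normc (S t) ^+ 2 = 2 * pi * \sum_(i < n) normc (c i) ^+ 2.
  by rewrite -parseval_trig_poly; apply: eq_Rintegral => t _; rewrite Snorm.
have IvS : \int[mu]_(t in arc) Re (S t * (v t)%:C) = 2 * pi * \sum_(i < n) normc (c i) ^+ 2.
  have := wint_sum iv (fun i => conjc (c i)) 1 n.
  rewrite (_ : \sum_(i < n) _ = (\sum_(i < n) normc (c i) ^+ 2)%:C); last first.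
    rewrite (real_complex_sum n (fun i => normc (c i) ^+ 2)); apply: eq_bigr => i _; rewrite addn1 -/(c i) normc_sqr.
    by case: (c i) => p q; apply/eqP; rewrite eq_complex/=; apply/andP; split; apply/eqP; ring.
  move=> /(congr1 (@complex.Re R)); rewrite Re_mulc/= mul0r subr0 => <-.
  by rewrite mulrA divff ?mul1r// gt_eqF// mulr_gt0// pi_gt0.
have iv2 : mu.-integrable arc (EFin \o (fun t => v t ^+ 2)).
  apply: (integrable_arc_bounded (M := M ^+ 2)); first exact: measurable_funX.
  move=> t; rewrite normrX ler_sqr ?nnegrE//; exact: le_trans (normr_ge0 _) (vM t).
have iS' : mu.-integrable arc (EFin \o (fun t => normc (S t) ^+ 2)).
  by under eq_fun do rewrite Snorm.
have i2 : mu.-integrable arc (EFin \o (fun t => 2 * Re (S t * (v t)%:C))).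
  exact: (integrableZl measurable_arc 2 i1).
apply: (@le_trans _ _ (\int[mu]_(t in arc) (2 * Re (S t * (v t)%:C) - normc (S t) ^+ 2))).
  rewrite RintegralB//; last exact: measurable_arc.
  rewrite [X in X - _]RintegralZl//; last exact: measurable_arc.
  by rewrite IS IvS le_eqVlt; apply/orP; left; apply/eqP; ring.
apply: le_Rintegral => //.
- exact: measurable_arc.
- by have := integrableB measurable_arc i2 iS'; under eq_fun do rewrite -EFinB.
- move=> t _; rewrite Re_mulc mulr0 subr0 normc_sqr -[Re (v t)%:C]/(v t).
  have := sqr_ge0 (Re (S t) - v t); have := sqr_ge0 (Im (S t)).
  by move: (Re (S t)) (Im (S t)) (v t) => p q r; nra.
Qed.

End parseval.

Section shifted_coefficients.
Context {R : realType}.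
Local Notation mu := (@lebesgue_measure R).
Local Notation Re := complex.Re.
Local Notation Im := complex.Im.

Lemma Rintegral_periodic (g : R -> R) (M s : R) : measurable_fun setT g ->
  (forall t, `|g t| <= M) -> (forall t, g (t + pi *+ 2) = g t) -> `|s| <= pi *+ 2 ->
  \int[mu]_(t in arc) g (t + s) = \int[mu]_(t in arc) g t.
Proof.
move=> mg gM pg s2.
have ms : measurable_fun setT (fun t : R => g (t + s)).
  by apply: (measurableT_comp mg); exact: measurable_funD.
have iM : mu.-integrable arc (EFin \o (cst M : R -> R)).
  by apply: (integrable_arc_bounded (M := `|M|)).
have i1 := integrable_arc_bounded mg gM.
have i2 := integrable_arc_bounded ms (fun t => gM (t + s)).
have e : \int[mu]_(t in arc) (g (t + s) + M) = \int[mu]_(t in arc) (g t + M).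
  rewrite /Rintegral; congr fine.
  apply: (@ge0_integral_periodic _ (fun t => (g t + M)%:E)) => //.
  - by apply/measurable_EFinP; exact: measurable_funD.
  - by move=> t; rewrite lee_fin; have := gM t; rewrite ler_norml => /andP[]; lra.
  - by move=> t; rewrite pg.
move: e; rewrite !RintegralD//; [|exact: measurable_arc..].
by move/addIr.
Qed.

Variables (u : R -> R) (M : R).
Hypotheses (mu_ : measurable_fun setT u) (uM : forall t, `|u t| <= M).
Hypothesis pu : forall t, u (t + pi *+ 2) = u t.

Definition increment s t : R := u (t + s) - u t.

Lemma measurable_increment s : measurable_fun setT (increment s).
Proof.
apply: measurable_funB => //; apply: (measurableT_comp mu_); exact: measurable_funD.
Qed.

Lemma increment_bound s t : `|increment s t| <= M + M.
Proof. by apply: le_trans (ler_normB _ _) _; rewrite lerD. Qed.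

Lemma fcoef_increment s n : `|s| <= pi *+ 2 ->
  fcoef (increment s) n = (expi s ^+ n - 1) * fcoef u n.
Proof.
move=> s2; have iu := integrable_arc_bounded mu_ uM.
pose us t := u (t + s).
have mus : measurable_fun setT us.
  by apply: (measurableT_comp mu_); exact: measurable_funD.
have ius := integrable_arc_bounded mus (fun t => uM (t + s)).
pose k t : R[i] := expi (- t) ^+ n.
have kb : cbounded k 1 by exact: cbounded_expiX.
have e1 : wint us k = expi s ^+ n * wint u k.
  rewrite -(wintZ iu _ kb) /wint /arc_cintegral.
  have ek t : k t * (us t)%:C = expi s ^+ n * k (t + s) * (u (t + s))%:C.
    rewrite /k -exprMn -expiD; congr (_ ^+ n * _); congr expi; ring.
  have kp t : k (t + pi *+ 2) = k t.
    by rewrite /k -(expi_periodic (- (t + pi *+ 2))) opprD subrK.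
  have [[m1 m2] b1] := cboundedM (cbounded_cst (expi s ^+ n)) kb.
  have n1 t : normc (expi s ^+ n * k t * (u t)%:C) <= normc (expi s ^+ n) * 1 * M.
    rewrite normcM normc_real ler_pM ?normc_ge0//; exact: b1.
  have per (P : R[i] -> R) : (forall z, `|P z| <= normc z) ->
      measurable_fun setT (fun t => P (expi s ^+ n * k t * (u t)%:C)) ->
      \int[mu]_(t in arc) P (k t * (us t)%:C) = \int[mu]_(t in arc) P (expi s ^+ n * k t * (u t)%:C).
    move=> Pn mP; pose g t := P (expi s ^+ n * k t * (u t)%:C).
    rewrite -[RHS](@Rintegral_periodic g (normc (expi s ^+ n) * 1 * M) s)//.
    - by apply: eq_Rintegral => t _; rewrite ek.
    - by move=> t; exact: le_trans (Pn _) (n1 t).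
    - by move=> t; rewrite /g kp pu.
  by congr (_ +i* _); apply: per; [exact: Re_le_normc| |exact: Im_le_normc|];
    case: (cmeasurableM (f := fun t : measurableTypeR R => expi s ^+ n * k t) (conj m1 m2) (cmeasurable_real mu_)).
have e2 : wint (increment s) k = wint us k - wint u k.
  have [a1 a2] := integrable_wint ius kb; have [b1 b2] := integrable_wint iu kb.
  rewrite /wint /arc_cintegral; apply/eqP; rewrite eq_complex/=; apply/andP; split; apply/eqP.
    rewrite -RintegralB//; last exact: measurable_arc.
    by apply: eq_Rintegral => t _; rewrite /increment rmorphB mulrBr Re_addc Re_oppc.
  rewrite -RintegralB//; last exact: measurable_arc.
  by apply: eq_Rintegral => t _; rewrite /increment rmorphB mulrBr Im_addc Im_oppc.
by rewrite /fcoef -/k e2 e1; ring.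
Qed.

Lemma normc_fcoef_increment s n : `|s| <= pi *+ 2 ->
  normc (fcoef (increment s) n) ^+ 2 = chord2 (n%:R * s) * normc (fcoef u n) ^+ 2.
Proof.
by move=> s2; rewrite fcoef_increment// normcM exprMn -expi_nat normc_expi_sub1.
Qed.

End shifted_coefficients.

(** * Radial limits *)

Section poisson.
Context {R : realType}.
Local Notation mu := (@lebesgue_measure R).
Local Notation Re := complex.Re.
Local Notation Im := complex.Im.
Implicit Types (r s t : R).

Definition poisson r s : R := (1 - r ^+ 2) / ((1 - r) ^+ 2 + r * chord2 s).

Lemma Re_scalec (x : R) (z : R[i]) : Re (x%:C * z) = x * Re z.
Proof. by rewrite Re_mulc /= mul0r subr0. Qed.

Lemma Re_herglotz_kernel r (p t : R) :
  Re ((expi p + r%:C * expi t) / (expi p - r%:C * expi t)) = poisson r (p - t).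
Proof.
have e : normc (expi p - r%:C * expi t) ^+ 2 = (1 - r) ^+ 2 + r * chord2 (p - t).
  rewrite normc_sqr /chord2 cosB /= !mul0r subr0 addr0.
  have := cos2Dsin2 p; have := cos2Dsin2 t.
  move: (cos p) (sin p) (cos t) (sin t) => a b c d h1 h2.
  have -> : (a - r * c) ^+ 2 + (b - (r * d)) ^+ 2 =
     (a ^+ 2 + b ^+ 2) + r ^+ 2 * (c ^+ 2 + d ^+ 2) - 2 * r * (a * c + b * d) by ring.
  by rewrite h1 h2; ring.
rewrite Re_mulc Re_invc Im_invc e mulrN opprK /poisson !mulrA -mulrDl; congr (_ / _).
rewrite /= !mul0r subr0 addr0.
have := cos2Dsin2 p; have := cos2Dsin2 t.
move: (cos p) (sin p) (cos t) (sin t) => a b c d h1 h2.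
transitivity ((a ^+ 2 + b ^+ 2) - r ^+ 2 * (c ^+ 2 + d ^+ 2)); first by ring.
by rewrite h1 h2 mulr1.
Qed.

Lemma normc_rexpi r t : 0 <= r -> normc (r%:C * expi t) = r.
Proof. by move=> r0; rewrite normcM normc_expi mulr1 normc_real ger0_norm. Qed.

Lemma poisson_ge0 r s : 0 <= r < 1 -> 0 <= poisson r s.
Proof.
move=> /andP[r0 r1]; rewrite divr_ge0//; first by nra.
by rewrite addr_ge0 ?sqr_ge0// mulr_ge0 ?chord2_ge0.
Qed.

Lemma poisson_le r s : 0 <= r < 1 -> poisson r s <= 2 / (1 - r).
Proof.
move=> /andP[r0 r1]; have e0 : 0 < 1 - r by lra.
have c0 := chord2_ge0 s.
rewrite /poisson ler_pdivrMr; last by rewrite ltr_pwDl ?exprn_gt0// mulr_ge0.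
rewrite mulrAC ler_pdivlMr//.
have : 0 <= r * chord2 s by rewrite mulr_ge0.
have : 0 <= (1 - r) ^+ 2 * (1 - r) by rewrite mulr_ge0 ?sqr_ge0 ?ltW.
by move: (chord2 s) => x; nra.
Qed.

Lemma poisson_le_chord r s k : 2^-1 <= r < 1 -> 0 < k -> k <= chord2 s ->
  poisson r s <= 4 * (1 - r) / k.
Proof.
move=> /andP[r0 r1] k0 kc; have e0 : 0 < 1 - r by lra.
rewrite /poisson ler_pdivrMr; last by rewrite ltr_pwDl ?exprn_gt0// mulr_ge0 ?chord2_ge0//; lra.
rewrite mulrAC ler_pdivlMr//.
have : 0 <= (1 - r) ^+ 2 by rewrite sqr_ge0.
have : k / 2 <= r * chord2 s by nra.
have : (1 - r ^+ 2) * k <= 2 * (1 - r) * k by rewrite ler_wpM2r ?(ltW k0)//; nra.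
move: (r * chord2 s) ((1 - r) ^+ 2) (1 - r ^+ 2) => x y w h1 h2 h3; nra.
Qed.

Lemma measurable_poisson r t : measurable_fun setT (fun p : R => poisson r (p - t)).
Proof.
apply: measurable_funM => //; apply: (measurableT_comp measurable_invr).
apply: measurable_funD => //; apply: measurable_funM => //.
apply: (measurableT_comp (continuous_measurable_fun continuous_chord2)).
exact: measurable_funB.
Qed.

Lemma herglotz1 (z : R[i]) : normc z < 1 -> herglotz (cst 1) z = 1.
Proof.
move=> z1; apply/eqP; rewrite -subr_eq0; apply/eqP/eq0_normc.
set x := normc _.
have x0 : 0 <= x := normc_ge0 _.
pose C : R := ((2 * pi)^-1 * (2 * (1 - normc z)^-1 * \int[mu]_(t in arc) `|(cst 1 t : R)|)) * normc (2 : R[i]).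
have h n : x <= C * normc z ^+ n.+1.
  have := herglotz_expansion integrable_arc1 n z1; rewrite fcoef1 big1 ?subr0 => [|i _].
    by rewrite mulrA.
  by rewrite fcoef1 mulr0 mul0r.
have c0 : (fun n => C * normc z ^+ n.+1) @ \oo --> (0 : R).
  rewrite -[X in _ --> X](mulr0 C); apply: cvgM; first exact: cvg_cst.
  rewrite (cvg_shiftS (fun n => normc z ^+ n)); apply: cvg_expr.
  by rewrite ger0_norm ?normc_ge0.
apply: le_anti; rewrite x0 andbT.
have := @ler_cvg_to _ _ _ _ _ _ _ _ (cvg_cst x) c0 => /(_ _); apply.
by apply: nearW.
Qed.

Lemma herglotz_sub_le (w : R -> R) r t : mu.-integrable arc (EFin \o w) -> 0 <= r < 1 ->
  (`|Re (herglotz w (r%:C * expi t)) - w t|%:E <=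
   ((2 * pi)^-1)%:E * \int[mu]_(p in arc) (poisson r (p - t) * `|w p - w t|)%:E)%E.
Proof.
move=> iw r01; have /andP[r0 r1] := r01.
have z1 : normc (r%:C * expi t) < 1 by rewrite normc_rexpi.
have ReH (v : R -> R) : Re (herglotz v (r%:C * expi t)) =
    (2 * pi)^-1 * \int[mu]_(p in arc) (poisson r (p - t) * v p).
  rewrite /herglotz Re_scalec; congr (_ * _).
  rewrite -[LHS]/(\int[mu]_(p in arc) Re _).
  by apply: eq_Rintegral => p _; rewrite Re_mulc mulr0 subr0 Re_herglotz_kernel.
have P0 s := poisson_ge0 s r01.
have bP p : `|poisson r (p - t)| <= 2 / (1 - r).
  by rewrite ger0_norm// poisson_le.
have i1 := integrable_bounded_mul iw (measurable_poisson r t) bP.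
have i2 := integrable_bounded_mul integrable_arc1 (measurable_poisson r t) bP.
have i3 : mu.-integrable arc (fun p => (w t * (poisson r (p - t) * 1))%:E).
  exact: (integrableZl measurable_arc (w t) i2).
have i4 : mu.-integrable arc (EFin \o (fun p => poisson r (p - t) * w p - w t * (poisson r (p - t) * 1))).
  by have := integrableB measurable_arc i1 i3; under eq_fun do rewrite -EFinB.
have e : Re (herglotz w (r%:C * expi t)) - w t =
    (2 * pi)^-1 * \int[mu]_(p in arc) (poisson r (p - t) * w p - w t * (poisson r (p - t) * 1)).
  rewrite RintegralB//; last exact: measurable_arc.
  rewrite mulrBr -ReH; congr (_ - _).
  rewrite RintegralZl//; last exact: measurable_arc.
  by rewrite mulrCA -ReH herglotz1// mulr1.
rewrite e normrM ger0_norm; last by rewrite invr_ge0 mulr_ge0// pi_ge0.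
rewrite EFinM lee_wpmul2l ?lee_fin//; first by rewrite invr_ge0 mulr_ge0// pi_ge0.
have h := le_normr_Rintegral measurable_arc i4.
have i5 := integrable_norm i4.
apply: (@le_trans _ _ (\int[mu]_(p in arc) `|poisson r (p - t) * w p - w t * (poisson r (p - t) * 1)|)%:E).
  by rewrite lee_fin.
rewrite EFin_Rintegral// le_eqVlt; apply/orP; left; apply/eqP.
apply: eq_integral => p _ /=; congr EFin.
rewrite (_ : _ - _ = poisson r (p - t) * (w p - w t)); last by ring.
by rewrite normrM ger0_norm.
Qed.

(* A kernel below 2 / a and 36 a / (p - t)^2, as the Poisson kernel with
   a = 1 - r, is summed over dyadic annuli around t. *)
Lemma dyadic_kernel_bound (P g : R -> R) (t a rho eps : R) (k : nat) :
  measurable_fun setT P -> measurable_fun setT g ->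
  (forall p, 0 <= P p) -> (forall p, 0 <= g p) -> 0 < a -> 0 <= eps ->
  (forall p, P p <= 2 / a) -> (forall p, `|p - t| < rho -> P p * (p - t) ^+ 2 <= 36 * a) ->
  (forall r, 0 < r <= rho -> (\int[mu]_(p in ball t r) (g p)%:E <= (eps * r)%:E)%E) ->
  a * 2 ^+ k <= rho ->
  (\int[mu]_(p in ball t (a * 2 ^+ k)) (P p * g p)%:E <= (eps * (2 + 144 * (1 - 2^-1 ^+ k)))%:E)%E.
Proof.
move=> mP mg P0 g0 a0 eps0 P1 P2 gb.
have mPg : measurable_fun setT (fun p => (P p * g p)%:E).
  by apply/measurable_EFinP; exact: measurable_funM.
have mgE : measurable_fun setT (fun p => (g p)%:E) by apply/measurable_EFinP.
have bnd (A : set R) (c b : R) : measurable A -> 0 <= c -> A `<=` ball t b -> 0 < b <= rho ->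
    (forall p, A p -> P p <= c) ->
    (\int[mu]_(p in A) (P p * g p)%:E <= (c * (eps * b))%:E)%E.
  move=> mA c0 Ab b0 Pc; apply: (@le_trans _ _ (\int[mu]_(p in A) (c%:E * (g p)%:E))%E).
    apply: ge0_le_integral => //.
    - by move=> p _; rewrite lee_fin mulr_ge0.
    - exact: measurable_funTS.
    - by apply: measurable_funTS; apply/measurable_EFinP; exact: measurable_funM.
    - by move=> p Ap; rewrite lee_fin ler_wpM2r// Pc.
  rewrite ge0_integralZl//; last 2 first.
  - exact: measurable_funTS.
  - by move=> p _; rewrite lee_fin.
  rewrite EFinM lee_wpmul2l ?lee_fin//; apply: le_trans (gb _ b0).
  apply: ge0_subset_integral => //; first exact: measurable_ball.
  - exact: measurable_funTS.
  - by move=> p _; rewrite lee_fin.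
elim: k => [|k IH] arho.
  rewrite expr0 mulr1 in arho *.
  apply: le_trans (@bnd (ball t a) (2 / a) a _ _ _ _ _) _ => //.
  - exact: measurable_ball.
  - by rewrite divr_ge0// ltW.
  - by rewrite a0.
  - rewrite lee_fin le_eqVlt; apply/orP; left; apply/eqP; rewrite expr0; field.
    by rewrite gt_eqF.
have k2 : 0 < 2 ^+ k :> R by rewrite exprn_gt0.
have arho' : a * 2 ^+ k <= rho.
  by apply: le_trans arho; rewrite exprS; nra.
pose A := ball t (a * 2 ^+ k.+1) `\` ball t (a * 2 ^+ k).
have mA : measurable A by apply: measurableD; exact: measurable_ball.
have -> : ball t (a * 2 ^+ k.+1) = ball t (a * 2 ^+ k) `|` A.
  rewrite /A setDUK//; apply: le_ball; rewrite exprS; nra.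
rewrite ge0_integral_setU//.
- apply: (@le_trans _ _ ((eps * (2 + 144 * (1 - 2^-1 ^+ k)))%:E +
      (36 * a / (a * 2 ^+ k) ^+ 2 * (eps * (a * 2 ^+ k.+1)))%:E)%E).
    apply: leeD; first exact: IH.
    apply: bnd => //.
    + by rewrite divr_ge0 ?sqr_ge0// mulr_ge0// ltW.
    + by move=> p [].
    + by rewrite arho andbT mulr_gt0// exprn_gt0.
    + move=> p [pA /negP pB]; rewrite ler_pdivlMr; last by rewrite exprn_gt0// mulr_gt0.
      move: pA pB; rewrite /ball/= distrC => pA; rewrite -leNgt => pB.
      apply: le_trans (P2 p (lt_le_trans pA arho)).
      rewrite ler_wpM2l// -[leRHS]real_normK ?num_real//.
      by rewrite ler_sqr ?nnegrE// mulr_ge0// ltW.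
  rewrite -EFinD lee_fin le_eqVlt; apply/orP; left; apply/eqP.
  rewrite !exprVn !exprS; move: k2; move: (2 ^+ k : R) => X X0; field.
  by rewrite !gt_eqF.
- exact: measurable_ball.
- exact: measurable_funTS.
- by move=> p _; rewrite lee_fin mulr_ge0.
- by apply/disj_setPS => p [pB []].
Qed.

Lemma chord2_ge_far (t p del : R) : 0 < del -> del <= pi - `|t| -> arc p ->
  del <= `|p - t| -> del ^+ 2 / 9 <= chord2 (p - t).
Proof.
move=> del0 dt; rewrite /arc/= in_itv/= => /andP[p1 p2] pB.
have main s : del <= `|s| -> `|s| <= pi -> del ^+ 2 / 9 <= chord2 s.
  move=> h1 h2; apply: le_trans (chord2_ge h2).
  rewrite ler_pM2r// -[leRHS]real_normK ?num_real//.
  by rewrite ler_sqr ?nnegrE// ltW.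
have [sp|sp] := leP `|p - t| pi; first exact: main.
have c2 (s : R) : chord2 (s + pi *+ 2) = chord2 s by rewrite /chord2 cosD2pi.
have := ler_norm t; have := ler_norm (- t); rewrite normrN => h3 h4.
have pp := @pi_gt0 R.
have [s0|s0] := leP 0 (p - t).
  rewrite (ger0_norm s0) in sp.
  by rewrite -(subrK (pi *+ 2) (p - t)) c2; apply: main; rewrite mulr2n ler0_norm; lra.
rewrite (ltr0_norm s0) in sp.
by rewrite -c2; apply: main; rewrite mulr2n ger0_norm; lra.
Qed.

Definition radius (j : nat) : R := 1 - 2^-1 ^+ j.

Lemma fatou_lebesgue_pt (w : R -> R) t : measurable_fun setT w ->
  mu.-integrable arc (EFin \o w) -> `|t| < pi -> lebesgue_pt w t ->
  (fun j => Re (herglotz w ((radius j)%:C * expi t))) @ \oo --> w t.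
Proof.
move=> mw iw tpi wt.
pose g (p : R) : R := `|w p - w t|.
have mg : measurable_fun setT g.
  by apply: measurableT_comp => //; exact: measurable_funB.
have g0 p : 0 <= g p := normr_ge0 _.
have ig : mu.-integrable arc (EFin \o g).
  apply: integrable_norm; have ic : mu.-integrable arc (EFin \o (cst (w t) : R -> R)).
    by apply: (integrable_arc_bounded (M := `|w t|)).
  by have := integrableB measurable_arc iw ic; under eq_fun do rewrite -EFinB.
pose Cg : R := \int[mu]_(p in arc) g p.
have Cg0 : 0 <= Cg by apply: Rintegral_ge0.
apply/cvgrPdist_le => e e0.
pose eps := e / 146; have eps0 : 0 < eps by rewrite divr_gt0.
have [rho rho0 hrho] : exists2 rho : R, 0 < rho & forall r, 0 < r <= rho ->
    (\int[mu]_(p in ball t r) (g p)%:E <= (eps * r)%:E)%E.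
  have : \forall r \near 0^'+, (davg w t r <= (eps / 2)%:E)%E.
    move/fine_cvgP : wt => [wfin /cvgrPdist_le/(_ (eps / 2))].
    rewrite divr_gt0// => /(_ isT) wl.
    near=> r.
    have f1 : davg w t r \is a fin_num by near: r.
    have f2 : `|0 - fine (davg w t r)| <= eps / 2 by near: r.
    rewrite -(fineK f1) lee_fin; apply: le_trans (ler_norm _) _.
    by rewrite -normrN -sub0r.
  move=> [rho /= rho0 h]; exists (rho / 2); first by rewrite divr_gt0.
  move=> r /andP[r0 rr].
  have := h r; rewrite /ball/= sub0r normrN gtr0_norm// => /(_ _ r0) h'.
  have : (davg w t r <= (eps / 2)%:E)%E by apply: h'; lra.
  rewrite /davg /iavg (lebesgue_measure_ball _ (ltW r0)) inver gt_eqF ?mulrn_wgt0//.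
  rewrite lee_pdivrMl ?mulrn_wgt0// -EFinM.
  rewrite (_ : r *+ 2 * (eps / 2) = eps * r); last by rewrite -mulr_natl; field.
  by apply: le_trans; rewrite le_eqVlt; apply/orP; left; apply/eqP; apply: eq_integral.
have [m hm] : exists m : nat, 2^-1 ^+ m <= Num.min rho (Num.min (pi - `|t|) 1).
  have : (fun m => 2^-1 ^+ m : R) @ \oo --> (0 : R).
    by apply: cvg_expr; rewrite ger0_norm//; lra.
  move/cvgrPdist_le => /(_ (Num.min rho (Num.min (pi - `|t|) 1))).
  rewrite !lt_min rho0 subr_gt0 tpi ltr01 => /(_ isT)[m _ hm]; exists m.
  by have := hm m (leqnn m); rewrite /= sub0r normrN ger0_norm// exprn_ge0.
move: hm; rewrite !le_min => /and3P[m1 m2 m3].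
pose del : R := 2^-1 ^+ m; rewrite -/del in m1 m2 m3.
have del0 : 0 < del by rewrite exprn_gt0// invr_gt0.
pose kap := del ^+ 2 / 9; have kap0 : 0 < kap by rewrite divr_gt0// exprn_gt0.
have c0 : (fun j => 4 * 2^-1 ^+ j / kap * Cg) @ \oo --> (0 : R).
  rewrite (_ : (fun j => _) = (fun j => (4 / kap * Cg) * 2^-1 ^+ j)); last first.
    by apply/funext => j; ring.
  rewrite -[X in _ --> X](mulr0 (4 / kap * Cg)); apply: cvgM; first exact: cvg_cst.
  by apply: cvg_expr; rewrite ger0_norm//; lra.
move/cvgrPdist_le : c0 => /(_ e e0)[N _ hN].
exists (maxn N (maxn m 1)) => // j /=; rewrite !geq_max => /and3P[Nj mj j1].
pose a : R := 2^-1 ^+ j; have a0 : 0 < a by rewrite exprn_gt0// invr_gt0.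
have a2 : a <= 2^-1.
  by rewrite /a -(prednK j1) exprS ler_piMr// exprn_ile1//; lra.
have r01 : 2^-1 <= radius j < 1 by rewrite /radius -/a; apply/andP; split; lra.
have r02 : 0 <= radius j < 1 by case/andP: r01 => ? ->; rewrite andbT; lra.
have ra : 1 - radius j = a by rewrite /radius -/a; ring.
have ak : a * 2 ^+ (j - m) = del.
  rewrite /a /del -{1}(subnK mj) exprD mulrAC -exprMn mulVf// expr1n mul1r//.
rewrite distrC -lee_fin; apply: le_trans (herglotz_sub_le t iw r02) _.
have mPg : measurable_fun setT (fun p : R => (poisson (radius j) (p - t) * g p)%:E).
  by apply/measurable_EFinP; apply: measurable_funM => //; exact: measurable_poisson.
have P0 p := poisson_ge0 (p - t) r02.
have inarc p : `|p - t| < del -> arc p.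
  rewrite /arc/= in_itv/= ltr_norml => /andP[h1 h2].
  have := ler_norm t; have := ler_norm (- t); rewrite normrN => h3 h4.
  by apply/andP; split; lra.
have near_le : (\int[mu]_(p in ball t del) (poisson (radius j) (p - t) * g p)%:E <= e%:E)%E.
  rewrite -ak; apply: (@le_trans _ _ (eps * (2 + 144 * (1 - 2^-1 ^+ (j - m))))%:E).
    apply: (@dyadic_kernel_bound _ g t a del eps) => //.
    - exact: measurable_poisson.
    - exact: ltW.
    - by move=> p; rewrite -ra poisson_le.
    - move=> p pdel; have [->|s0] := eqVneq p t.
        by rewrite subrr expr0n mulr0 mulr_ge0// ltW.
      have s2 : 0 < (p - t) ^+ 2 by rewrite exprn_even_gt0//= subr_eq0.
      have s9 : 0 < (p - t) ^+ 2 / 9 by rewrite divr_gt0.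
      have spi : `|p - t| <= pi by have := @pi_ge2 R; lra.
      have := poisson_le_chord r01 s9 (chord2_ge spi).
      rewrite ra => h; rewrite (_ : 36 * a = 4 * a / ((p - t) ^+ 2 / 9) * (p - t) ^+ 2).
        by rewrite ler_wpM2r// ltW.
      by field; rewrite subr_eq0.
    - by move=> r /andP[r0 rdel]; apply: hrho; rewrite r0 (le_trans rdel).
    - by rewrite ak.
  rewrite lee_fin; have : 0 <= 2^-1 ^+ (j - m) :> R by rewrite exprn_ge0.
  rewrite /eps; move: (_ ^+ _) => x x0.
  by have : e / 146 * 146 = e; [field|nra].
have far_le : (\int[mu]_(p in arc `\` ball t del) (poisson (radius j) (p - t) * g p)%:E <= e%:E)%E.
  have mA : measurable (arc `\` ball t del : set (measurableTypeR R)).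
    by apply: measurableD; [exact: measurable_arc|exact: measurable_ball].
  apply: (@le_trans _ _ (\int[mu]_(p in arc) ((4 * a / kap)%:E * (g p)%:E))%E).
    apply: (@le_trans _ _ (\int[mu]_(p in arc `\` ball t del) ((4 * a / kap)%:E * (g p)%:E))%E).
      apply: ge0_le_integral => //.
      - by move=> p _; rewrite lee_fin mulr_ge0.
      - exact: measurable_funTS.
      - by apply: measurable_funTS; apply/measurable_EFinP; exact: measurable_funM.
      - move=> p [parc pB]; rewrite lee_fin ler_wpM2r//.
        rewrite -ra; apply: poisson_le_chord => //.
        by apply: chord2_ge_far parc _ => //; rewrite leNgt distrC; apply/negP => h; exact: pB.
    apply: ge0_subset_integral => //.
    - exact: measurable_arc.
    - by apply: measurable_funTS; apply/measurable_EFinP; exact: measurable_funM.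
    - by move=> p _; rewrite lee_fin mulr_ge0// divr_ge0 ?(ltW kap0)// mulr_ge0// ltW.
  rewrite ge0_integralZl//.
  - rewrite -(EFin_Rintegral ig) -EFinM lee_fin.
    by have := hN j Nj; rewrite /= sub0r normrN ger0_norm// !mulr_ge0 ?invr_ge0 ?(ltW kap0) ?(ltW a0).
  - exact: measurable_arc.
  - by apply: measurable_funTS; apply/measurable_EFinP.
  - by move=> p _; rewrite lee_fin.
  - by rewrite lee_fin divr_ge0 ?(ltW kap0)// mulr_ge0// ltW.
have arcU : (arc : set R) = ball t del `|` (arc `\` ball t del).
  rewrite setDUK// => p; rewrite /ball/= distrC; exact: inarc.
rewrite arcU ge0_integral_setU; first last.
- by apply/disj_setPS => p [pB []].
- by move=> p _; rewrite lee_fin mulr_ge0.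
- exact: measurable_funTS.
- by apply: measurableD; [exact: measurable_arc|exact: measurable_ball].
- exact: measurable_ball.
apply: (@le_trans _ _ (((2 * pi)^-1)%:E * (e%:E + e%:E))%E).
  rewrite lee_wpmul2l ?lee_fin ?invr_ge0 ?mulr_ge0 ?pi_ge0//; exact: leeD.
rewrite -EFinD -EFinM lee_fin.
have : (2 * pi)^-1 <= 2^-1 :> R by rewrite lef_pV2 ?posrE//; have := @pi_ge2 R; lra.
move: (_^-1) => x xle; nra.
Unshelve. all: by end_near.
Qed.

End poisson.

(** * Weighted Dirichlet integral of a Herglotz integral *)

Section limits.
Context {R : realType}.
Local Notation Re := complex.Re.
Local Notation Im := complex.Im.

Lemma cvg_dist_le (a e : nat -> R) (l : R) : e @ \oo --> (0 : R) ->
  (forall n, `|l - a n| <= e n) -> a @ \oo --> l.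
Proof.
move=> e0 ae; apply/cvgrPdist_le => eps eps0.
move/cvgrPdist_le : e0 => /(_ eps eps0); apply: filterS => n.
rewrite sub0r normrN => h; apply: le_trans (ae n) _; exact: le_trans (ler_norm _) h.
Qed.

Lemma cmeasurable_cvg d (X : measurableType d) (F : nat -> X -> R[i]) (f : X -> R[i])
    (e : X -> nat -> R) : (forall n, cmeasurable (F n)) ->
  (forall x, e x @ \oo --> (0 : R)) ->
  (forall x n, normc (f x - F n x) <= e x n) -> cmeasurable f.
Proof.
move=> mF e0 fF; split.
  apply: (@measurable_fun_cvg _ _ _ _ (fun n x => Re (F n x))) => [n|x _]; first exact: (mF n).1.
  apply: cvg_dist_le (e0 x) _ => n; apply: le_trans (fF x n).
  by rewrite -Re_oppc -Re_addc Re_le_normc.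
apply: (@measurable_fun_cvg _ _ _ _ (fun n x => Im (F n x))) => [n|x _]; first exact: (mF n).2.
apply: cvg_dist_le (e0 x) _ => n; apply: le_trans (fF x n).
by rewrite -Im_oppc -Im_addc Im_le_normc.
Qed.

Lemma cvg_expr_lt1 (C x : R) : 0 <= x < 1 -> (fun n => C * x ^+ n) @ \oo --> (0 : R).
Proof.
move=> /andP[x0 x1]; rewrite -[X in _ --> X](mulr0 C).
by apply: cvgM; [exact: cvg_cst|apply: cvg_expr; rewrite ger0_norm].
Qed.

Lemma nat_expr_le (y : R) n : 0 <= y < 1 -> n%:R * y ^+ n * (1 - y) <= 1.
Proof.
move=> /andP[y0 y1].
have h : n%:R * y ^+ n * (1 - y) <= 1 - y ^+ n.
  elim: n => [|n IH]; first by rewrite expr0 !mul0r subrr.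
  rewrite -natr1 exprS; have p0 : 0 <= y ^+ n by rewrite exprn_ge0.
  have p1 : y ^+ n <= 1 by rewrite exprn_ile1 // ltW.
  have n0 : 0 <= n%:R :> R by [].
  move: (n%:R : R) (y ^+ n) n0 p0 p1 IH => N p N0 p0 p1 IH.
  have h1 : y * (N * p * (1 - y)) <= y * (1 - p) by rewrite ler_wpM2l.
  have h2 : 0 <= (1 - y) * (1 - y * p) by rewrite mulr_ge0//; nra.
  nra.
by apply: le_trans h _; rewrite lerBlDr lerDl exprn_ge0.
Qed.

Lemma cvg_nat_expr (C x : R) : 0 <= C -> 0 <= x < 1 ->
  (fun n => C * (n.+1%:R * 2 * x ^+ n)) @ \oo --> (0 : R).
Proof.
move=> C0 /andP[x0 x1]; pose y := Num.sqrt x.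
have y0 : 0 <= y by rewrite sqrtr_ge0.
have yx : y ^+ 2 = x by rewrite sqr_sqrtr.
have y1 : y < 1 by nra.
have y1' : 0 < 1 - y by lra.
apply: (@cvg_dist_le _ (fun n => (C * 2 * (1 + (1 - y)^-1)) * y ^+ n)).
  by apply: cvg_expr_lt1; rewrite y0.
move=> n; rewrite sub0r normrN ger0_norm ?mulr_ge0 ?exprn_ge0//.
rewrite -yx exprAC expr2 -natr1 -!mulrA ler_wpM2l//.
rewrite [leLHS]mulrCA ler_wpM2l// mulrA ler_wpM2r ?exprn_ge0//.
rewrite mulrDl mul1r addrC lerD//; first by rewrite exprn_ile1// ltW.
by rewrite -[leRHS]mul1r ler_pdivlMr// nat_expr_le// y0.
Qed.

End limits.

(* A copy of [product_measure1], which MathComp-Analysis does not make a canonical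
   sigma-finite measure; Tonelli's theorem with a plane factor needs it. *)
Section product_sigma_finite.
Context d1 d2 (T1 : measurableType d1) (T2 : measurableType d2) (R : realType).
Variables (m1 : {sigma_finite_measure set T1 -> \bar R})
          (m2 : {sigma_finite_measure set T2 -> \bar R}).

Definition sf_product : set (T1 * T2) -> \bar R := (m1 \x m2)%E.

HB.instance Definition _ := Measure.on sf_product.

Lemma sigma_finite_sf_product : sigma_finite setT sf_product.
Proof.
have /sigma_finiteP[F [TF ndF Foo]] := sigma_finiteT m1.
have /sigma_finiteP[G [TG ndG Goo]] := sigma_finiteT m2.
exists (fun n => F n `*` G n).
  rewrite -setXTT TF TG predeqE => -[x y]; split.
    move=> [/= [n _ Fnx] [k _ Gky]]; exists (maxn n k) => //; split.
      by move: x Fnx; exact/subsetPset/ndF/leq_maxl.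
    by move: y Gky; exact/subsetPset/ndG/leq_maxr.
  by move=> [n _ []/= ? ?]; split; exists n.
move=> k; have [? ?] := Foo k; have [? ?] := Goo k.
split; first exact: measurableX.
by rewrite /sf_product product_measure1E// lte_mul_pinfty// ge0_fin_numE.
Qed.

HB.instance Definition _ := Measure_isSigmaFinite.Build _ _ _ sf_product
  sigma_finite_sf_product.
End product_sigma_finite.

Section tonelli_sets.
Context d1 d2 (T1 : measurableType d1) (T2 : measurableType d2) (R : realType).
Variables (m1 : {sigma_finite_measure set T1 -> \bar R})
          (m2 : {sigma_finite_measure set T2 -> \bar R}).

Lemma measurable_integral_snd (B : set T2) (f : T1 * T2 -> \bar R) :
  measurable B -> measurable_fun setT f -> (forall p, 0 <= f p)%E ->
  measurable_fun setT (fun x => \int[m2]_(y in B) f (x, y))%E.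
Proof.
move=> mB mf f0; pose F := f \_ (setT `*` B).
have F0 p : (0 <= F p)%E by rewrite /F patchE; case: ifP.
have mF : measurable_fun setT F.
  apply/(measurable_restrictT _ _).1; first exact: measurableX.
  exact: measurable_funTS.
rewrite (_ : (fun _ => _) = fubini_F m2 F).
  exact: measurable_fun_fubini_tonelli_F.
apply/funext => x; rewrite /fubini_F [LHS]integral_mkcond; apply: eq_integral => y _.
rewrite /F !patchE; congr (if _ then _ else _).
by apply/idP/idP => /set_mem => [yB|[_ yB]]; exact/mem_set.
Qed.

Lemma tonelli_sets (A : set T1) (B : set T2) (f : T1 * T2 -> \bar R) :
  measurable A -> measurable B -> measurable_fun setT f -> (forall p, 0 <= f p)%E ->
  (\int[m1]_(x in A) \int[m2]_(y in B) f (x, y) =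
   \int[m2]_(y in B) \int[m1]_(x in A) f (x, y))%E.
Proof.
move=> mA mB mf f0; pose F := f \_ (A `*` B).
have F0 p : (0 <= F p)%E by rewrite /F patchE; case: ifP.
have mF : measurable_fun setT F.
  apply/(measurable_restrictT _ _).1; first exact: measurableX.
  exact: measurable_funTS.
have FE x y : F (x, y) = if x \in A then if y \in B then f (x, y) else 0%E else 0%E.
  rewrite /F patchE; case: ifPn => [/set_mem[/= xA yB]|h].
    by rewrite !mem_set.
  case: ifPn => // xA; case: ifPn => // yB; move: h.
  by rewrite mem_set//; split; exact/set_mem.
have := @fubini_tonelli _ _ _ _ R m1 m2 F mF F0.
move=> h; rewrite [LHS]integral_mkcond [RHS]integral_mkcond.
transitivity (\int[m1]_x \int[m2]_y F (x, y))%E.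
  apply: eq_integral => x _; rewrite patchE; case: ifPn => xA.
    rewrite [LHS]integral_mkcond; apply: eq_integral => y _.
    by rewrite patchE FE xA.
  by rewrite integral0_eq// => y _; rewrite FE (negbTE xA).
rewrite h; apply: eq_integral => y _; rewrite patchE; case: ifPn => yB.
  rewrite [RHS]integral_mkcond; apply: eq_integral => x _.
  by rewrite patchE FE yB.
by rewrite integral0_eq// => x _; rewrite FE (negbTE yB); case: ifP.
Qed.

End tonelli_sets.

Section disk_energy.
Context {R : realType}.
Local Notation mu := (@lebesgue_measure R).
Local Notation mu2 := (mu \x mu)%E.
Local Notation Re := complex.Re.
Local Notation Im := complex.Im.
Variables (alpha : R) (v : R -> R).
Hypothesis iv : mu.-integrable arc (EFin \o v).
Let T : measurableType _ := (measurableTypeR R * measurableTypeR R)%type.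

Definition toC (p : R * R) : R[i] := p.1 +i* p.2.

Lemma normc_toC p : normc (toC p) = Num.sqrt (sqnorm p).
Proof. by []. Qed.

Lemma normc_toC2 p : normc (toC p) ^+ 2 = sqnorm p.
Proof. by rewrite normc_toC sqr_sqrtr// sqnorm_ge0. Qed.

Lemma unit_disk_toC p : unit_disk (toC p) = (sqnorm p < 1) :> Prop.
Proof.
rewrite /unit_disk/= -normc_toC; congr is_true.
by rewrite -normc_toC2 expr_lt1// normc_ge0.
Qed.

Lemma measurable_disk : measurable ([set p | sqnorm p < 1] : set T).
Proof.
rewrite (_ : [set p | _] = sqnorm @^-1` `]-oo, 1[); first exact: measurable_sqnorm_preimage.
by apply/seteqP; split => p /=; rewrite in_itv.
Qed.

Lemma cmeasurable_toC : cmeasurable (toC : T -> R[i]).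
Proof. by split; [exact: measurable_fst|exact: measurable_snd]. Qed.

Definition dcoef n : R[i] := 2 * n.+1%:R * fcoef v n.+1.

Lemma dherglotz_cvg (z : R[i]) : normc z < 1 -> exists2 e : nat -> R,
  e @ \oo --> (0 : R) & forall w n, normc w = normc z ->
    normc (dherglotz v w - \sum_(i < n) dcoef i * w ^+ i) <= e n.
Proof.
move=> z1; exists (fun n => ((2 * pi)^-1 * (2 * (normc (2 : R[i]) * (1 - normc z)^-1 ^+ 2) * \int[mu]_(t in arc) `|v t|)) * (n.+1%:R * 2 * normc z ^+ n)).
  apply: cvg_nat_expr; last by rewrite normc_ge0.
  by rewrite !mulr_ge0// ?invr_ge0 ?mulr_ge0 ?pi_ge0 ?exprn_ge0 ?normc_ge0 ?invr_ge0 ?subr_ge0 ?(ltW z1)//; apply: Rintegral_ge0.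
move=> w n wz; rewrite -wz; apply: dherglotz_expansion => //; first by rewrite wz.
Qed.

Definition disk_dherglotz (p : R * R) : R[i] :=
  dherglotz v (toC p) * (\1_([set p : R * R | sqnorm p < 1]) p)%:C.

Lemma cmeasurable_on_disk (f : R[i] -> R[i]) (F : nat -> R[i] -> R[i]) :
  (forall n, cmeasurable (F n \o toC : T -> R[i])) ->
  (forall z, normc z < 1 -> exists2 e : nat -> R, e @ \oo --> (0 : R) &
    forall n, normc (f z - F n z) <= e n) ->
  cmeasurable (fun p : T => f (toC p) * (\1_([set p : R * R | sqnorm p < 1]) p)%:C).
Proof.
move=> mF fF; pose I (p : R * R) : R[i] := (\1_([set p : R * R | sqnorm p < 1]) p)%:C.
have h (p : R * R) : exists e : nat -> R, e @ \oo --> (0 : R) /\ forall n,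
    normc (f (toC p) * I p - F n (toC p) * I p) <= e n.
  have [p1|p1] := ltP (sqnorm p) 1.
    have : normc (toC p) < 1 by move: p1; rewrite -unit_disk_toC.
    move=> /fF[e e0 he]; exists e; split => // n.
    by rewrite /I -mulrBl normcM normc_real indicE mem_set//= normr1 mulr1.
  exists (fun=> 0); split; first exact: cvg_cst.
  move=> n; rewrite /I -mulrBl normcM normc_real indicE memNset/= ?normr0 ?mulr0//.
  by apply/negP; rewrite -leNgt.
have /choice[e he] := h.
apply: (cmeasurable_cvg (F := fun n p => F n (toC p) * I p) (e := e)) => [n|p|p n].
- apply: cmeasurableM; first exact: mF.
  by apply: cmeasurable_real; apply: measurable_indic; exact: measurable_disk.
- by case: (he p).
- by case: (he p).
Qed.

Lemma cmeasurable_disk_dherglotz : cmeasurable (disk_dherglotz : T -> R[i]).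
Proof.
apply: (cmeasurable_on_disk (F := fun n z => \sum_(i < n) dcoef i * z ^+ i)) => [n|z z1].
  apply: (cmeasurable_sum (F := fun i (p : T) => dcoef i * toC p ^+ i)) => i.
  by apply: cmeasurableM; [exact: cmeasurable_cst|apply: cmeasurableX; exact: cmeasurable_toC].
by have [e e0 he] := dherglotz_cvg z1; exists e => // n; exact: he.
Qed.

Definition disk_density (p : R * R) : \bar R :=
  (normc (disk_dherglotz p) ^+ 2 * radial_weight alpha (sqnorm p))%:E.

Lemma measurable_disk_density : measurable_fun (setT : set T) disk_density.
Proof.
apply/measurable_EFinP; apply: measurable_funM.
  exact: measurable_normc2 cmeasurable_disk_dherglotz.
exact: (measurableT_comp (measurable_radial_weight alpha) measurable_sqnorm).
Qed.

Lemma disk_density_ge0 p : (0 <= disk_density p)%E.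
Proof. by rewrite lee_fin mulr_ge0 ?exprn_ge0 ?normc_ge0 ?powR_ge0. Qed.

Definition rotate (t : R) (p : R * R) : R * R :=
  (cos t * p.1 - sin t * p.2, sin t * p.1 + cos t * p.2).

Lemma toC_rotate t p : toC (rotate t p) = expi t * toC p.
Proof. by case: p => x y; apply/eqP; rewrite eq_complex/= !eqxx/= addrC. Qed.

Lemma sqnorm_rotate t p : sqnorm (rotate t p) = sqnorm p.
Proof. by rewrite -!normc_toC2 toC_rotate normcM normc_expi mul1r. Qed.

Lemma measurable_rotate_density :
  measurable_fun setT (fun x : measurableTypeR R * T => disk_density (rotate x.1 x.2)).
Proof.
apply: (measurableT_comp measurable_disk_density).
have mc : measurable_fun setT (fun x : measurableTypeR R * T => cos x.1).
  by apply: (measurableT_comp (continuous_measurable_fun (@continuous_cos R))).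
have ms : measurable_fun setT (fun x : measurableTypeR R * T => sin x.1).
  by apply: (measurableT_comp (continuous_measurable_fun (@continuous_sin R))).
have m1 : measurable_fun setT (fun x : measurableTypeR R * T => x.2.1).
  by apply: (measurableT_comp measurable_fst); exact: measurable_snd.
have m2 : measurable_fun setT (fun x : measurableTypeR R * T => x.2.2).
  by apply: (measurableT_comp measurable_snd); exact: measurable_snd.
apply: measurable_fun_pair.
  by apply: measurable_funB; exact: measurable_funM.
by apply: measurable_funD; exact: measurable_funM.
Qed.

Lemma integral_rotate_density p :
  (\int[mu]_(t in arc) disk_density (rotate t p) =
   \sum_(n <oo) ((2 * pi * normc (dcoef n) ^+ 2)%:E *
     (sqnorm p ^+ n * radial_weight alpha (sqnorm p))%:E * (\1_([set p : R * R | sqnorm p < 1]) p)%:E))%E.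
Proof.
have [p1|p1] := ltP (sqnorm p) 1; last first.
  have i0 : (\1_([set p : R * R | sqnorm p < 1]) p : R) = 0.
    by rewrite indicE memNset//=; apply/negP; rewrite -leNgt.
  rewrite eseries0 => [|n _ _]; last by rewrite i0 mule0.
  apply: integral0_eq => t _; rewrite /disk_density /disk_dherglotz sqnorm_rotate.
  rewrite [X in X%:C](_ : _ = 0) ?mulr0 ?normc0 ?expr0n ?mul0r//.
  by rewrite indicE memNset//= sqnorm_rotate; apply/negP; rewrite -leNgt.
have i1 : (\1_([set p : R * R | sqnorm p < 1]) p : R) = 1 by rewrite indicE mem_set.
have z1 : normc (toC p) < 1 by move: p1; rewrite -unit_disk_toC.
have W0 : 0 <= radial_weight alpha (sqnorm p) by exact: powR_ge0.
have [e e0 he] := dherglotz_cvg z1.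
pose G t := dherglotz v (expi t * toC p).
pose a n := dcoef n * toC p ^+ n.
have Ge n t : normc (G t - trig_poly a n t) <= e n.
  rewrite /trig_poly (_ : \sum_(i < n) _ = \sum_(i < n) dcoef i * (expi t * toC p) ^+ i).
    by apply: he; rewrite normcM normc_expi mul1r.
  by apply: eq_bigr => i _; rewrite exprMn /a; ring.
have mG : cmeasurable (G : measurableTypeR R -> R[i]).
  apply: (cmeasurable_cvg (F := trig_poly a) (e := fun=> e)) => // n.
  exact: cmeasurable_trig_poly.
have H := parseval mG e0 Ge.
transitivity ((radial_weight alpha (sqnorm p))%:E * \int[mu]_(t in arc) (normc (G t) ^+ 2)%:E)%E.
  rewrite -ge0_integralZl//.
  - apply: eq_integral => t _; rewrite /disk_density -EFinM mulrC sqnorm_rotate.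
    have -> // : disk_dherglotz (rotate t p) = G t.
    rewrite /disk_dherglotz toC_rotate indicE mem_set; first by rewrite mulr1.
    by rewrite /= sqnorm_rotate.
  - exact: measurable_arc.
  - by apply/measurable_EFinP; apply: measurable_funTS; exact: measurable_normc2 mG.
  - by move=> t _; rewrite lee_fin exprn_ge0 ?normc_ge0.
rewrite H -nneseriesZl//; last first.
  by move=> n _; rewrite lee_fin !mulr_ge0 ?exprn_ge0 ?normc_ge0 ?pi_ge0.
apply: eq_eseriesr => n _; rewrite i1 mule1 -!EFinM; congr EFin.
rewrite /a normcM normcX exprMn exprAC normc_toC2; ring.
Qed.

Lemma disk_energy : (\int[mu2]_p disk_density p =
  \sum_(n <oo) ((normc (dcoef n) ^+ 2)%:E * disk_moment alpha n))%E.
Proof.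
have pp := @pi_gt0 R.
have pi2 : 0 < 2 * pi :> R by rewrite mulr_gt0.
have D0 := integral_ge0 mu2 (fun p _ => disk_density_ge0 p).
suff : ((2 * pi)%:E * \int[mu2]_p disk_density p =
   (2 * pi)%:E * \sum_(n <oo) ((normc (dcoef n) ^+ 2)%:E * disk_moment alpha n))%E.
  move=> h; have h' x y : ((2 * pi)%:E * x = (2 * pi)%:E * y -> x = y :> \bar R)%E.
    move=> /(congr1 (fun z => ((2 * pi)^-1)%:E * z)%E).
    by rewrite !muleA -!EFinM mulVf ?gt_eqF// !mul1e.
  exact: h' h.
transitivity (\int[mu]_(t in arc) \int[mu2]_p disk_density (rotate t p))%E.
  have -> : (\int[mu]_(t in arc) \int[mu2]_p disk_density (rotate t p) =
      \int[mu]_(t in `](- pi)%R, pi[) \int[mu2]_p disk_density (rotate t p))%E.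
    apply: (@integral_itv_bndoo R _ _ _ true false).
    apply: measurable_funTS.
    apply: (measurable_integral_snd (sf_product mu mu) measurableT measurable_rotate_density) => p.
    exact: disk_density_ge0.
  transitivity (\int[mu]_(t in `](- pi)%R, pi[) (cst (\int[mu2]_p disk_density p) t))%E.
    rewrite integral_cst//= lebesgue_measure_itv/= lte_fin (_ : (- pi < pi) = true); last by lra.
    by rewrite muleC -EFinD; congr (_ * _%:E)%E; ring.
  apply: eq_integral => t /set_mem/=; rewrite in_itv/= => tpi.
  by rewrite -(integral_rotation measurable_disk_density disk_density_ge0 tpi).
transitivity (\int[mu2]_p \int[mu]_(t in arc) disk_density (rotate t p))%E.
  apply: (tonelli_sets mu (sf_product mu mu) measurable_arc measurableT measurable_rotate_density) => p.
  exact: disk_density_ge0.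
under eq_integral do rewrite integral_rotate_density.
have mI : measurable_fun (setT : set T) (fun p => \1_([set p : R * R | sqnorm p < 1]) p : R).
  by apply: measurable_indic; exact: measurable_disk.
have mm n : measurable_fun (setT : set T) (fun p => sqnorm p ^+ n * radial_weight alpha (sqnorm p)).
  apply: measurable_funM; first by apply: measurable_funX; exact: measurable_sqnorm.
  exact: (measurableT_comp (measurable_radial_weight alpha) measurable_sqnorm).
have mmI n : measurable_fun (setT : set T) (fun p => ((sqnorm p ^+ n * radial_weight alpha (sqnorm p))%:E * (\1_([set p : R * R | sqnorm p < 1]) p : R)%:E)%E).
  by apply: emeasurable_funM; apply/measurable_EFinP.
have ge n p : (0 <= (sqnorm p ^+ n * radial_weight alpha (sqnorm p))%:E * (\1_([set p : R * R | sqnorm p < 1]) p : R)%:E)%E.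
  by rewrite mule_ge0 ?lee_fin// mulr_ge0 ?powR_ge0 ?exprn_ge0 ?sqnorm_ge0.
rewrite integral_nneseries//; last 2 first.
- move=> n; under eq_fun do rewrite -muleA.
  by apply: measurable_funeM.
- move=> n p _; rewrite -muleA mule_ge0//.
  by rewrite lee_fin !mulr_ge0 ?exprn_ge0 ?normc_ge0// ltW.
rewrite -nneseriesZl//; last first.
  move=> n _; rewrite mule_ge0 ?lee_fin ?exprn_ge0 ?normc_ge0//.
  by apply: integral_ge0 => p _; rewrite lee_fin mulr_ge0 ?powR_ge0 ?exprn_ge0 ?sqnorm_ge0.
apply: eq_eseriesr => n _.
under eq_integral do rewrite -muleA.
rewrite ge0_integralZl//; last by rewrite lee_fin !mulr_ge0 ?exprn_ge0 ?normc_ge0// ltW.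
rewrite muleA -EFinM; congr (_ * _)%E.
rewrite /disk_moment [RHS]integral_mkcond; apply: eq_integral => p _.
rewrite patchE indicE; case: ifPn => _; first by rewrite mule1.
by rewrite mule0.
Qed.

End disk_energy.

(** * Double integrals over the circle *)

Section chord_energy.
Context {R : realType}.
Local Notation mu := (@lebesgue_measure R).
Local Notation Re := complex.Re.
Local Notation Im := complex.Im.
Local Notation mR := (measurableTypeR R).
Variable alpha : R.

Definition chord_density (w : R -> R) (t s : R) : \bar R :=
  ((w t - w s) ^+ 2 * chord_kernel alpha (t - s))%:E.

Definition chord_energy (A : set R) (w : R -> R) : \bar R :=
  (\int[mu]_(t in A) \int[mu]_(s in arc) chord_density w t s)%E.

Lemma chord_density_ge0 w t s : (0 <= chord_density w t s)%E.
Proof. by rewrite lee_fin mulr_ge0 ?sqr_ge0 ?chord_kernel_ge0. Qed.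

Lemma chord_kernelN s : chord_kernel alpha (- s) = chord_kernel alpha s.
Proof. by rewrite /chord_kernel /chord chord2N. Qed.

Lemma measurable_chord_density w : measurable_fun setT w ->
  measurable_fun setT (fun p : mR * mR => chord_density w p.1 p.2).
Proof.
move=> mw; apply/measurable_EFinP; apply: measurable_funM.
  apply: measurable_funX; apply: measurable_funB.
    exact: (measurableT_comp mw measurable_fst).
  exact: (measurableT_comp mw measurable_snd).
apply: (measurableT_comp (measurable_chord_kernel alpha)).
by apply: measurable_funB; [exact: measurable_fst|exact: measurable_snd].
Qed.

Lemma measurable_chord_density1 w t : measurable_fun setT w ->
  measurable_fun setT (chord_density w t).
Proof.
move=> mw; apply/measurable_EFinP; apply: measurable_funM.
  by apply: measurable_funX; exact: measurable_funB.
apply: (measurableT_comp (measurable_chord_kernel alpha)).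
exact: measurable_funB.
Qed.

Lemma measurable_chord_density_integral w : measurable_fun setT w ->
  measurable_fun setT (fun t : R => \int[mu]_(s in arc) chord_density w t s)%E.
Proof.
move=> mw; apply: (measurable_integral_snd mu measurable_arc (measurable_chord_density mw)).
by move=> p; exact: chord_density_ge0.
Qed.

Lemma chord_density_periodic w t s : (forall x, w (x + pi *+ 2) = w x) ->
  chord_density w t (s + pi *+ 2) = chord_density w t s.
Proof.
move=> pw; rewrite /chord_density pw; congr (_ * _)%:E.
by rewrite /chord_kernel -!normc_expiB expi_periodic.
Qed.

Lemma chord_energyE w : measurable_fun setT w -> (forall x, w (x + pi *+ 2) = w x) ->
  chord_energy arc w = (\int[mu]_(x in arc)
    ((chord_kernel alpha x)%:E * \int[mu]_(t in arc) ((increment w x t) ^+ 2)%:E))%E.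
Proof.
move=> mw pw; have pp := @pi_gt0 R.
pose f (p : mR * mR) : \bar R := ((increment w p.2 p.1) ^+ 2 * chord_kernel alpha p.2)%:E.
have f0 p : (0 <= f p)%E by rewrite lee_fin mulr_ge0 ?sqr_ge0 ?chord_kernel_ge0.
have mf : measurable_fun setT f.
  apply/measurable_EFinP; apply: measurable_funM.
    apply: measurable_funX; apply: measurable_funB.
      apply: (measurableT_comp mw); apply: measurable_funD; [exact: measurable_fst|exact: measurable_snd].
    exact: (measurableT_comp mw measurable_fst).
  exact: (measurableT_comp (measurable_chord_kernel alpha) measurable_snd).
transitivity (\int[mu]_(t in arc) \int[mu]_(x in arc) f (t, x))%E.
  apply: eq_integral => t /set_mem; rewrite /arc/= in_itv/= => /andP[t1 t2].
  have t3 : `|t| <= pi *+ 2 by rewrite ler_norml; apply/andP; split; lra.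
  rewrite -(ge0_integral_periodic (measurable_chord_density1 t mw) (chord_density_ge0 w t) (fun s => chord_density_periodic t s pw) t3).
  apply: eq_integral => x _; rewrite /chord_density /f /increment/=.
  have -> : chord_kernel alpha (t - (x + t)) = chord_kernel alpha x.
    by rewrite -[RHS]chord_kernelN; congr chord_kernel; ring.
  by rewrite (addrC x t) -sqrrN opprB.
rewrite (tonelli_sets mu mu measurable_arc measurable_arc mf f0).
apply: eq_integral => x _; rewrite -ge0_integralZl//.
- by apply: eq_integral => t _; rewrite -EFinM mulrC.
- exact: measurable_arc.
- apply: measurable_funTS; apply/measurable_EFinP; apply: measurable_funX.
  exact: measurable_increment.
- by move=> t _; rewrite lee_fin sqr_ge0.
- by rewrite lee_fin chord_kernel_ge0.
Qed.

Lemma measurable_increment_integral w : measurable_fun setT w ->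
  measurable_fun setT (fun x : R => \int[mu]_(t in arc) ((increment w x t) ^+ 2)%:E)%E.
Proof.
move=> mw; apply: (measurable_integral_snd mu measurable_arc (f := fun p => ((increment w p.1 p.2) ^+ 2)%:E)).
  apply/measurable_EFinP; apply: measurable_funX; apply: measurable_funB.
    apply: (measurableT_comp mw); apply: measurable_funD; [exact: measurable_snd|exact: measurable_fst].
  exact: (measurableT_comp mw measurable_snd).
by move=> p; rewrite lee_fin sqr_ge0.
Qed.

Variables (v : R -> R) (M : R).
Hypothesis mv : measurable_fun setT v.
Hypothesis vM : forall t, `|v t| <= M.
Hypothesis pv : forall t, v (t + pi *+ 2) = v t.

Let c n := normc (fcoef v n.+1) ^+ 2.

Let c_ge0 n : 0 <= c n.
Proof. by rewrite exprn_ge0 ?normc_ge0. Qed.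

Lemma chord_moment_ge0 n : (0 <= chord_moment alpha n)%E.
Proof. by apply: integral_ge0 => s _; rewrite lee_fin mulr_ge0 ?chord2_ge0 ?chord_kernel_ge0. Qed.

Lemma measurable_chord_moment_integrand n :
  measurable_fun setT (fun s : R => chord2 (n%:R * s) * chord_kernel alpha s).
Proof.
apply: measurable_funM; last exact: measurable_chord_kernel.
apply: (measurableT_comp (continuous_measurable_fun (@continuous_chord2 R))).
exact: measurable_funM.
Qed.

Lemma chord_energy_ge :
  (\sum_(n <oo) ((2 * pi * c n)%:E * chord_moment alpha n.+1) <= chord_energy arc v)%E.
Proof.
have pp := @pi_gt0 R.
have C0 n : 0 <= 2 * pi * c n by apply: mulr_ge0; [lra|exact: c_ge0].
have g0 n : (0 <= (2 * pi * c n)%:E * chord_moment alpha n.+1)%E.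
  by rewrite mule_ge0 ?chord_moment_ge0// lee_fin.
apply: lime_le; first by apply: is_cvg_nneseries => n _ _; exact: g0.
near=> N; rewrite big_mkord chord_energyE//.
pose g n s : \bar R := ((2 * pi * c n)%:E * (chord2 (n.+1%:R * s) * chord_kernel alpha s)%:E)%E.
have mg n : measurable_fun setT (g n : mR -> _).
  by apply: measurable_funeM; apply/measurable_EFinP; exact: measurable_chord_moment_integrand.
have gg n s : (0 <= g n s)%E.
  by rewrite mule_ge0// lee_fin// mulr_ge0 ?chord2_ge0 ?chord_kernel_ge0.
rewrite [leLHS](_ : _ = \int[mu]_(s in arc) \sum_(n < N) g n s)%E; last first.
  rewrite ge0_integral_sum//.
  - apply: eq_bigr => n _; rewrite -ge0_integralZl//.
    + exact: measurable_arc.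
    + by apply: measurable_funTS; apply/measurable_EFinP; exact: measurable_chord_moment_integrand.
    + by move=> s _; rewrite lee_fin mulr_ge0 ?chord2_ge0 ?chord_kernel_ge0.
    + by rewrite lee_fin.
  - exact: measurable_arc.
  - by move=> n; exact: measurable_funTS.
apply: ge0_le_integral.
- exact: measurable_arc.
- by move=> s _; exact: sume_ge0.
- by apply: measurable_funTS; apply: emeasurable_sum.
- apply: measurable_funTS; apply: emeasurable_funM; last exact: measurable_increment_integral.
  by apply/measurable_EFinP; exact: measurable_chord_kernel.
move=> x; rewrite /arc/= in_itv/= => /andP[x1 x2].
have x3 : `|x| <= pi *+ 2 by rewrite ler_norml; apply/andP; split; lra.
have mi := measurable_increment mv x.
have bi := increment_bound vM x.
have K0 := chord_kernel_ge0 alpha x.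
have ii : mu.-integrable arc (EFin \o (fun t => increment v x t ^+ 2)).
  apply: (@integrable_arc_bounded _ _ ((M + M) ^+ 2)).
    exact: measurable_funX.
  move=> t; rewrite normrX lerXn2r ?nnegrE ?normr_ge0//.
  exact: le_trans (normr_ge0 _) (bi t).
rewrite -EFin_Rintegral// /g -EFinM.
rewrite (_ : \sum_(n < N) _ = (chord_kernel alpha x * (2 * pi * \sum_(n < N) normc (fcoef (increment v x) n.+1) ^+ 2))%:E)%E.
  rewrite lee_fin ler_wpM2l//; exact: bessel bi.
rewrite !mulr_sumr -sumEFin; apply: eq_bigr => n _; rewrite -EFinM; congr EFin.
rewrite (normc_fcoef_increment mv vM)// /c; ring.
Unshelve. all: by end_near. Qed.

Let iv := integrable_arc_bounded mv vM.

(* The Poisson extension of v on the circle of radius r. *)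
Definition dilate r t : R := Re (herglotz v (r%:C * expi t)).

Let err r n : R := ((2 * pi)^-1 * (2 * (1 - r)^-1 * \int[mu]_(t in arc) `|v t|)) *
  (normc (2 : R[i]) * r ^+ n.+1).

Let err_cvg r : 0 <= r < 1 -> err r @ \oo --> (0 : R).
Proof.
move=> r01; rewrite (_ : err r = fun n => ((2 * pi)^-1 * (2 * (1 - r)^-1 * \int[mu]_(t in arc) `|v t|)) *
  (normc (2 : R[i]) * r) * r ^+ n); first exact: cvg_expr_lt1.
by apply/funext => n; rewrite /err exprS; ring.
Qed.

Let dilate_expansion r t n : 0 <= r < 1 ->
  normc (herglotz v (r%:C * expi t) - fcoef v 0 -
    \sum_(i < n) (2 * fcoef v i.+1) * (r%:C * expi t) ^+ i.+1) <= err r n.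
Proof.
move=> /andP[r0 r1]; have rn := normc_rexpi t r0.
have z1 : normc (r%:C * expi t) < 1 by rewrite rn.
have := herglotz_expansion iv n z1; rewrite rn; exact.
Qed.

Lemma cmeasurable_dilate r : 0 <= r < 1 ->
  cmeasurable (fun t : mR => herglotz v (r%:C * expi t)).
Proof.
move=> r01; apply: (cmeasurable_cvg (F := fun n t => fcoef v 0 +
    \sum_(i < n) (2 * fcoef v i.+1) * (r%:C * expi t) ^+ i.+1) (e := fun=> err r)).
- move=> n; apply: cmeasurableD; first exact: cmeasurable_cst.
  apply: (cmeasurable_sum (F := fun i (t : mR) => 2 * fcoef v i.+1 * (r%:C * expi t) ^+ i.+1)) => i.
  apply: cmeasurableM; first exact: cmeasurable_cst.
  apply: cmeasurableX; apply: cmeasurableM; first exact: cmeasurable_cst.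
  by apply: cmeasurable_expi; exact: measurable_id.
- by move=> _; exact: err_cvg.
- by move=> t n; rewrite opprD addrA; exact: dilate_expansion.
Qed.

Lemma dilate_periodic r t : dilate r (t + pi *+ 2) = dilate r t.
Proof. by rewrite /dilate expi_periodic. Qed.

Lemma integral_increment_dilate r x : 0 <= r < 1 ->
  (\int[mu]_(t in arc) ((increment (dilate r) x t) ^+ 2)%:E <=
   \sum_(n <oo) (8 * pi * c n * chord2 (n.+1%:R * x))%:E)%E.
Proof.
move=> r01; have /andP[r0 r1] := r01; have pp := @pi_gt0 R.
pose H t := herglotz v (r%:C * expi t).
(* The factor expi (- t) makes the frequencies start at 0. *)
pose G t := expi (- t) * (H (t + x) - H t).
pose a n := 2 * fcoef v n.+1 * r%:C ^+ n.+1 * (expi x ^+ n.+1 - 1).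
have mH := cmeasurable_dilate r01.
have mG : cmeasurable (G : mR -> R[i]).
  apply: cmeasurableM.
    by apply: cmeasurable_expi; exact: measurable_funN.
  apply: cmeasurableD; last exact: cmeasurableN.
  have mx : measurable_fun setT (fun t : mR => t + x) by exact: measurable_funD.
  by split; [exact: (measurableT_comp mH.1 mx)|exact: (measurableT_comp mH.2 mx)].
have Ge n t : normc (G t - trig_poly a n t) <= err r n + err r n.
  pose S t := fcoef v 0 + \sum_(i < n) (2 * fcoef v i.+1) * (r%:C * expi t) ^+ i.+1.
  have SH s : normc (H s - S s) <= err r n by rewrite opprD addrA; exact: dilate_expansion.
  rewrite (_ : G t - _ = expi (- t) * ((H (t + x) - S (t + x)) - (H t - S t))).
    rewrite normcM normc_expi mul1r; apply: le_trans (le_normcD _ _) _.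
    by rewrite normcN lerD.
  have -> : trig_poly a n t = expi (- t) * (S (t + x) - S t).
    rewrite /S opprD addrACA subrr add0r -sumrB mulr_sumr.
    apply: eq_bigr => i _; rewrite /a expiD !exprMn expiN.
    have := expi_neq0 t; move: (expi t) => e e0.
    by rewrite [e ^+ i.+1]exprS; field.
  by rewrite /G; move: (H _) (H _) (S _) (S _) (expi _) => h1 h2 s1 s2 e; ring.
have e0 : (fun n => err r n + err r n) @ \oo --> (0 : R).
  by rewrite -[0]addr0; apply: cvgD; exact: err_cvg.
have P := parseval mG e0 Ge.
apply: (@le_trans _ _ (\int[mu]_(t in arc) (normc (G t) ^+ 2)%:E)%E).
  apply: ge0_le_integral.
  - exact: measurable_arc.
  - by move=> t _; rewrite lee_fin sqr_ge0.
  - apply: measurable_funTS; apply/measurable_EFinP; apply: measurable_funX.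
    by apply: measurable_increment; exact: mH.1.
  - by apply: measurable_funTS; apply/measurable_EFinP; exact: measurable_normc2 mG.
  move=> t _; rewrite lee_fin /G normcM normc_expi mul1r.
  have -> : increment (dilate r) x t = Re (H (t + x) - H t) by rewrite Re_addc Re_oppc.
  rewrite -[leLHS]ger0_norm ?sqr_ge0// normrX lerXn2r ?nnegrE ?normr_ge0 ?normc_ge0//.
  exact: Re_le_normc.
rewrite P; apply: lee_nneseries => n _.
  by move=> _; rewrite lee_fin !mulr_ge0 ?exprn_ge0 ?normc_ge0// ltW.
have -> : normc (a n) ^+ 2 = 4 * c n * r ^+ n.+1 ^+ 2 * chord2 (n.+1%:R * x).
  rewrite /a /c; move: (fcoef v n.+1) => f.
  rewrite 3!normcM normcX normc_real (ger0_norm r0) -expi_nat.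
  rewrite -(normc_expi_sub1 (n.+1%:R * x)).
  rewrite (_ : 2 = (2 : R)%:C); last by rewrite rmorph_nat.
  by rewrite normc_real ger0_norm//; ring.
rewrite lee_fin.
have q1 : r ^+ n.+1 ^+ 2 <= 1 by rewrite -exprM exprn_ile1// ltW.
move: (chord2 _) (chord2_ge0 (n.+1%:R * x)) => C C0.
have c0 := c_ge0 n.
move: (_ ^+ n.+1 ^+ 2) q1 => q q1.
rewrite (_ : 2 * pi * _ = 8 * pi * c n * C * q); last by ring.
have CC : 0 <= c n * C by exact: mulr_ge0.
rewrite ler_piMr// -mulrA mulr_ge0//; lra.
Qed.

Lemma chord_energy_dilate_le r : 0 <= r < 1 ->
  (chord_energy arc (dilate r) <=
   \sum_(n <oo) ((8 * pi * c n)%:E * chord_moment alpha n.+1))%E.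
Proof.
move=> r01; have pp := @pi_gt0 R.
have C0 n : 0 <= 8 * pi * c n by apply: mulr_ge0; [lra|exact: c_ge0].
have mw : measurable_fun setT (dilate r) by exact: (cmeasurable_dilate r01).1.
rewrite chord_energyE//; last exact: dilate_periodic.
pose g n s : \bar R := ((8 * pi * c n)%:E * (chord2 (n.+1%:R * s) * chord_kernel alpha s)%:E)%E.
have mg n : measurable_fun setT (g n : mR -> _).
  by apply: measurable_funeM; apply/measurable_EFinP; exact: measurable_chord_moment_integrand.
have gg n s : (0 <= g n s)%E.
  by rewrite mule_ge0// lee_fin// mulr_ge0 ?chord2_ge0 ?chord_kernel_ge0.
rewrite [leRHS](_ : _ = \int[mu]_(s in arc) \sum_(n <oo) g n s)%E; last first.
  rewrite integral_nneseries//.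
  - apply: eq_eseriesr => n _; rewrite -ge0_integralZl//.
    + exact: measurable_arc.
    + by apply: measurable_funTS; apply/measurable_EFinP; exact: measurable_chord_moment_integrand.
    + by move=> s _; rewrite lee_fin mulr_ge0 ?chord2_ge0 ?chord_kernel_ge0.
    + by rewrite lee_fin.
  - exact: measurable_arc.
  - by move=> n; exact: measurable_funTS.
apply: ge0_le_integral.
- exact: measurable_arc.
- move=> x _; rewrite mule_ge0 ?lee_fin ?chord_kernel_ge0//.
  by apply: integral_ge0 => t _; rewrite lee_fin sqr_ge0.
- apply: measurable_funTS; apply: emeasurable_funM; last exact: measurable_increment_integral.
  by apply/measurable_EFinP; exact: measurable_chord_kernel.
- apply: measurable_funTS; apply: ge0_emeasurable_sum => // n s _ _; exact: gg.
move=> x _; rewrite (_ : \sum_(n <oo) g n x = (chord_kernel alpha x)%:E *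
    \sum_(n <oo) (8 * pi * c n * chord2 (n.+1%:R * x))%:E)%E.
  by rewrite lee_wpmul2l ?lee_fin ?chord_kernel_ge0// integral_increment_dilate.
rewrite -nneseriesZl; last by move=> n _; rewrite lee_fin mulr_ge0 ?chord2_ge0.
by apply: eq_eseriesr => n _; rewrite /g -!EFinM; congr EFin; ring.
Qed.

Lemma full_measure_integral (A : set R) (g : R -> \bar R) : measurable (A : set mR) ->
  A `<=` arc -> mu (arc `\` A) = 0 -> measurable_fun setT g -> (forall t, 0 <= g t)%E ->
  (\int[mu]_(t in arc) g t = \int[mu]_(t in A) g t)%E.
Proof.
move=> mA Aarc A0 mg g0.
rewrite (@ge0_negligible_integral _ _ _ mu arc (arc `\` A))//; last 2 first.
- exact: measurable_arc.
- exact: measurable_funTS.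
- congr integral; rewrite setDD; apply/seteqP; split => t; first by case.
  by move=> At; split; [exact: Aarc|].
- exact: measurableD measurable_arc mA.
Qed.

Lemma chord_energy_restrict (A : set R) u : measurable (A : set mR) -> A `<=` arc ->
  mu (arc `\` A) = 0 -> measurable_fun setT u ->
  chord_energy arc u = (\int[mu]_(t in A) \int[mu]_(s in A) chord_density u t s)%E.
Proof.
move=> mA Aarc A0 mu_; rewrite /chord_energy.
rewrite (full_measure_integral mA Aarc A0 (measurable_chord_density_integral mu_)).
  apply: eq_integral => t _; apply: (full_measure_integral mA Aarc A0).
    exact: measurable_chord_density1.
  by move=> s; exact: chord_density_ge0.
by move=> t; apply: integral_ge0 => s _; exact: chord_density_ge0.
Qed.

Lemma limn_einf_le (u : nat -> \bar R) (C : \bar R) : (forall n, u n <= C)%E ->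
  (limn_einf u <= C)%E.
Proof.
move=> uC; rewrite limn_einf_lim; apply: lime_le; first exact: is_cvg_einfs.
apply: nearW => n; apply: le_trans (uC n).
by apply: ereal_inf_lbound; exists n => /=.
Qed.

Lemma radius_lt1 j : 0 <= (radius j : R) < 1.
Proof.
have h : 0 < (2^-1 : R) ^+ j by rewrite exprn_gt0// invr_gt0.
have h1 : (2^-1 : R) ^+ j <= 1 by rewrite exprn_ile1// ?invr_ge0// invf_le1// ler1n.
by rewrite /radius; apply/andP; split; lra.
Qed.

Lemma chord_energy_fatou (A : set R) : measurable (A : set mR) -> A `<=` arc ->
  mu (arc `\` A) = 0 ->
  (forall t, A t -> (fun j => dilate (radius j) t) @ \oo --> v t) ->
  (chord_energy arc v <= \sum_(n <oo) ((8 * pi * c n)%:E * chord_moment alpha n.+1))%E.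
Proof.
move=> mA Aarc A0 vA; set C := (X in (_ <= X)%E).
pose w j := dilate (radius j).
have mw j : measurable_fun setT (w j) by exact: (cmeasurable_dilate (radius_lt1 j)).1.
have EA u := @chord_energy_restrict A u mA Aarc A0.
have mI u : measurable_fun setT u -> measurable_fun A (fun t : R => \int[mu]_(s in A) chord_density u t s)%E.
  move=> mu_; apply: measurable_funTS.
  apply: (measurable_integral_snd mu mA (measurable_chord_density mu_)).
  by move=> p; exact: chord_density_ge0.
have lim t s : A t -> A s -> limn_einf (fun j => chord_density (w j) t s) = chord_density v t s.
  move=> At As.
  have h : (fun j => chord_density (w j) t s) @ \oo --> chord_density v t s.
    apply: cvg_EFin; first by apply: nearW.
    apply: cvgM; last exact: cvg_cst.
    apply: (@cvg_comp _ _ _ _ (fun x : R => x ^+ 2) _ (nbhs (v t - v s))); last exact: exprn_continuous.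
    by apply: cvgB; exact: vA.
  rewrite is_cvg_limn_einfE; first exact: cvg_lim h.
  by apply/cvg_ex; eexists; exact: h.
rewrite EA//.
apply: (@le_trans _ _ (\int[mu]_(t in A) limn_einf (fun j => \int[mu]_(s in A) chord_density (w j) t s))%E).
  apply: ge0_le_integral.
  - exact: mA.
  - by move=> t _; apply: integral_ge0 => s _; exact: chord_density_ge0.
  - exact: mI.
  - rewrite (_ : (fun t => _) = (fun t => - limn_esup (fun j => - \int[mu]_(s in A) chord_density (w j) t s))%E).
      apply: measurableT_comp => //; apply: measurable_fun_limn_esup => j.
      by apply: measurableT_comp => //; exact: mI.
    by apply/funext => t; rewrite (limn_esupN (fun j => \int[mu]_(s in A) chord_density (w j) t s)%E) oppeK.
  move=> t At; apply: (@le_trans _ _ (\int[mu]_(s in A) limn_einf (fun j => chord_density (w j) t s))%E).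
    by rewrite le_eqVlt; apply/orP; left; apply/eqP; apply: eq_integral => s /set_mem As; rewrite lim.
  apply: (@fatou _ _ _ mu A mA (fun j => chord_density (w j) t)).
  - by move=> j; apply: measurable_funTS; exact: measurable_chord_density1.
  - by move=> j s _; exact: chord_density_ge0.
apply: le_trans.
  apply: (@fatou _ _ _ mu A mA (fun j t => \int[mu]_(s in A) chord_density (w j) t s)%E).
  - by move=> j; exact: mI.
  - by move=> j t _; apply: integral_ge0 => s _; exact: chord_density_ge0.
apply: limn_einf_le => j; rewrite -EA//.
exact: chord_energy_dilate_le (radius_lt1 j).
Qed.

End chord_energy.

Section radial_limits.
Context {R : realType}.
Local Notation mu := (@lebesgue_measure R).
Local Notation mR := (measurableTypeR R).

Lemma radial_limits (v : R -> R) : measurable_fun setT v -> mu.-integrable arc (EFin \o v) ->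
  exists A : set R, [/\ measurable (A : set mR), A `<=` arc, mu (arc `\` A) = 0 &
    forall t, A t -> (fun j => dilate v (radius j) t) @ \oo --> v t].
Proof.
move=> mv iv; have pp := @pi_gt0 R.
pose w := v \_ arc.
have mw : measurable_fun setT w.
  exact: (measurable_restrictT v measurable_arc).1 (measurable_funTS mv).
have wE t : arc t -> w t = v t by move=> ta; rewrite /w patchE mem_set.
have iw : mu.-integrable arc (EFin \o w).
  apply: eq_integrable iv; first exact: measurable_arc.
  by move=> t /set_mem ta /=; rewrite wE.
have hw z : herglotz w z = herglotz v z.
  rewrite /herglotz /wint /arc_cintegral; congr (_ * (_ +i* _));
    by apply: eq_Rintegral => t /set_mem ta; rewrite wE.
have [N [mN N0 hN]] := lebesgue_differentiation (integrable_locally measurable_arc iv).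
have mA : measurable ((`](- pi), pi[ `\` N : set R) : set mR) by exact: measurableD.
exists (`](- pi), pi[ `\` N); split => //.
- by move=> t [+ _]; rewrite /arc/= !in_itv/= => /andP[? ?]; rewrite !ltW.
- apply: subset_measure0 (_ : mu (N `|` ([set - pi] `|` [set pi])) = 0).
  + exact: measurableD measurable_arc mA.
  + by apply: measurableU => //; exact: measurableU.
  + move=> t [ta tA]; have [tN|tN] := pselect (N t); first by left.
    have : ~ (`](- pi), pi[%classic t) by move=> h; apply: tA.
    move: ta; rewrite /arc/= !in_itv/= => /andP[t1 t2] h; right.
    move: t1 t2; rewrite !le_eqVlt => /orP[/eqP->|t1]; first by left.
    by move=> /orP[/eqP->|t2]; [right|case: h; rewrite t1].
  + have m1 x : measurable ([set x] : set mR) by exact: measurable_set1.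
    rewrite setUA !measureU0//; try exact: lebesgue_measure_set1.
    exact: measurableU.
move=> t [tpi tN].
have wt : lebesgue_pt w t by apply: contrapT => h; apply: tN; apply: hN.
have tpi' : `|t| < pi by move: tpi; rewrite /= in_itv/= ltr_norml.
rewrite -wE; last by move: tpi; rewrite /arc/= !in_itv/= => /andP[? ?]; rewrite !ltW.
rewrite /dilate; under eq_fun do rewrite -hw.
exact: fatou_lebesgue_pt.
Qed.

End radial_limits.

(** * Comparison *)

Section energy_comparison.
Context {R : realType}.
Local Notation mu := (@lebesgue_measure R).
Local Notation mu2 := (mu \x mu)%E.
Local Notation mR := (measurableTypeR R).

Lemma nneseries_le_lty (a b : nat -> \bar R) (K : R) : 0 <= K ->
  (forall n, 0 <= a n)%E -> (forall n, 0 <= b n)%E -> (forall n, a n <= K%:E * b n)%E ->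
  (\sum_(n <oo) b n < +oo -> \sum_(n <oo) a n < +oo)%E.
Proof.
move=> K0 a0 b0 ab boo; apply: (@le_lt_trans _ _ (K%:E * \sum_(n <oo) b n)%E).
  rewrite -nneseriesZl//; apply: lee_nneseries => n _; last exact: ab.
  by move=> _; exact: a0.
by apply: lte_mul_pinfty => //; rewrite lee_fin.
Qed.

Variables (alpha : R) (v : R -> R) (M : R).
Hypothesis a01 : 0 <= alpha < 1.
Hypothesis mv : measurable_fun setT v.
Hypothesis vM : forall t, `|v t| <= M.
Hypothesis pv : forall t, v (t + pi *+ 2) = v t.

Lemma disk_energy_lty :
  (\int[mu2]_p disk_density alpha v p < +oo)%E <-> (chord_energy alpha arc v < +oo)%E.
Proof.
have iv := integrable_arc_bounded mv vM; have pp := @pi_gt0 R.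
have /andP[a0 a1] := a01; have a1' : 0 < 1 - alpha by lra.
have a01' : 0 <= alpha <= 1 by rewrite a0 ltW.
pose c n := normc (fcoef v n.+1) ^+ 2.
have c0 n : 0 <= c n by rewrite exprn_ge0 ?normc_ge0.
pose N n : R := n.+1%:R.
have N0 n : 0 < N n by rewrite ltr0n.
pose P n := N n `^ (1 - alpha).
have P0 n : 0 <= P n by exact: powR_ge0.
have NP n : N n ^+ 2 * N n `^ (- 1 - alpha) = P n.
  rewrite -powR_mulrn ?ltW// -powRD; last by apply/implyP => _; rewrite gt_eqF.
  by congr powR; ring.
pose A := fine (@disk_area R).
have A0 : 0 < A by rewrite fine_gt0// disk_area_gt0 ltey_eq disk_area_fin_num.
have AE : disk_area = A%:E by rewrite fineK// disk_area_fin_num.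
pose d n : \bar R := ((normc (dcoef v n) ^+ 2)%:E * disk_moment alpha n)%E.
have dc n : normc (dcoef v n) ^+ 2 = 4 * N n ^+ 2 * c n.
  rewrite /dcoef /c; move: (fcoef v n.+1) => f; rewrite 2!normcM.
  rewrite (_ : 2 = (2 : R)%:C); last by rewrite rmorph_nat.
  rewrite (_ : n.+1%:R = (N n)%:C); last by rewrite rmorph_nat.
  by rewrite !normc_real ger0_norm// (ger0_norm (ltW (N0 n))); ring.
have dle n : (d n <= (8 * A)%:E * (c n * P n)%:E)%E.
  apply: (le_trans (lee_wpmul2l _ (disk_moment_le n a01'))).
    by rewrite lee_fin exprn_ge0 ?normc_ge0.
  rewrite AE -!EFinM lee_fin dc -NP le_eqVlt; apply/orP; left; apply/eqP.
  by rewrite -/(N n); ring.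
have dge n : ((2^-1 * A)%:E * (c n * P n)%:E <= d n)%E.
  apply: le_trans (lee_wpmul2l _ (disk_moment_ge n a01')); last first.
    by rewrite lee_fin exprn_ge0 ?normc_ge0.
  rewrite AE -!EFinM lee_fin dc -NP le_eqVlt; apply/orP; left; apply/eqP.
  by rewrite -/(N n); field.
have d0 n : (0 <= d n)%E.
  apply: le_trans (dge n); rewrite -EFinM lee_fin mulr_ge0//; first lra.
  exact: mulr_ge0.
have k8 n : 0 <= 8 * pi * c n by apply: mulr_ge0 => //; lra.
have k2 n : 0 <= 2 * pi * c n by apply: mulr_ge0 => //; lra.
have cP0 n : (0 <= (c n * P n)%:E)%E by rewrite lee_fin mulr_ge0.
have cm0 n : (0 <= chord_moment alpha n.+1)%E by exact: chord_moment_ge0.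
rewrite (disk_energy alpha iv); split => h.
  have {}h : (\sum_(n <oo) (c n * P n)%:E < +oo)%E.
    apply: (nneseries_le_lty (K := 2 / A) _ cP0 d0 _ h) => [|n].
      by rewrite divr_ge0// ltW.
    apply: le_trans (lee_wpmul2l _ (dge n)); last by rewrite lee_fin divr_ge0// ltW.
    rewrite -!EFinM lee_fin le_eqVlt; apply/orP; left; apply/eqP.
    by field; rewrite gt_eqF.
  have [B [mB Barc B0 vB]] := radial_limits mv iv.
  apply: le_lt_trans (chord_energy_fatou alpha mv vM mB Barc B0 vB) _.
  apply: (nneseries_le_lty (K := 8 * pi * (90 / (1 - alpha))) _ _ cP0 _ h) => [|n|n].
  - by apply: mulr_ge0; [lra|rewrite divr_ge0// ltW].
  - by rewrite mule_ge0// lee_fin; exact: k8.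
  - apply: (le_trans (lee_wpmul2l _ (chord_moment_le n a01))).
      by rewrite lee_fin; exact: k8.
    rewrite -!EFinM lee_fin le_eqVlt; apply/orP; left; apply/eqP.
    rewrite -/(N n) -/(P n) -/(c n); ring.
have {}h := le_lt_trans (chord_energy_ge alpha mv vM pv) h.
have {}h : (\sum_(n <oo) (c n * P n)%:E < +oo)%E.
  apply: (nneseries_le_lty (K := 36 / (2 * pi)) _ cP0 _ _ h) => [|n|n].
  - by rewrite divr_ge0//; lra.
  - by rewrite mule_ge0// lee_fin; exact: k2.
  - rewrite muleA -EFinM; apply: le_trans (lee_wpmul2l _ (chord_moment_ge n a01)); last first.
      by rewrite lee_fin; apply: mulr_ge0 (k2 n); rewrite divr_ge0//; lra.
    rewrite -!EFinM lee_fin le_eqVlt; apply/orP; left; apply/eqP.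
    rewrite -/(N n) -/(P n) -/(c n); move: (P n) (c n) (pi : R) pp => p x q q0.
    by field; rewrite gt_eqF.
apply: (nneseries_le_lty (K := 8 * A) _ d0 cP0 dle h).
by rewrite mulr_ge0// ltW.
Qed.

End energy_comparison.

Section lipschitz.
Context {R : realType}.
Local Notation mu := (@lebesgue_measure R).
Local Notation mR := (measurableTypeR R).
Variable alpha : R.

Lemma chord_energy_eq (A : set R) (w1 w2 : R -> R) : measurable (A : set mR) -> A `<=` arc ->
  mu (arc `\` A) = 0 -> measurable_fun setT w1 -> measurable_fun setT w2 ->
  (forall t, A t -> w1 t = w2 t) -> chord_energy alpha arc w1 = chord_energy alpha arc w2.
Proof.
move=> mA Aarc A0 m1 m2 w12; rewrite (chord_energy_restrict alpha mA Aarc A0 m1) (chord_energy_restrict alpha mA Aarc A0 m2).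
apply: eq_integral => t /set_mem At; apply: eq_integral => s /set_mem As.
by rewrite /chord_density !w12.
Qed.

Lemma chord_energy_lipschitz (w1 w2 : R -> R) (K : R) :
  measurable_fun setT w1 -> measurable_fun setT w2 ->
  (forall t s, `|w1 t - w1 s| <= K * `|w2 t - w2 s|) ->
  (chord_energy alpha arc w2 < +oo -> chord_energy alpha arc w1 < +oo)%E.
Proof.
move=> m1 m2 wK h; apply: (@le_lt_trans _ _ ((K ^+ 2)%:E * chord_energy alpha arc w2)%E); last first.
  by apply: lte_mul_pinfty => //; rewrite lee_fin sqr_ge0.
have i0 w t : (0 <= \int[mu]_(s in arc) chord_density alpha w t s)%E.
  by apply: integral_ge0 => s _; exact: chord_density_ge0.
rewrite /chord_energy -ge0_integralZl//; last 3 first.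
- exact: measurable_arc.
- by apply: measurable_funTS; exact: measurable_chord_density_integral.
- by rewrite lee_fin sqr_ge0.
apply: ge0_le_integral.
- exact: measurable_arc.
- by move=> t _; exact: i0.
- by apply: measurable_funTS; exact: measurable_chord_density_integral.
- by apply: measurable_funTS; apply: measurable_funeM; exact: measurable_chord_density_integral.
move=> t _; rewrite -ge0_integralZl//; last 4 first.
- exact: measurable_arc.
- by apply: measurable_funTS; exact: measurable_chord_density1.
- by move=> s _; exact: chord_density_ge0.
- by rewrite lee_fin sqr_ge0.
apply: ge0_le_integral.
- exact: measurable_arc.
- by move=> s _; exact: chord_density_ge0.
- by apply: measurable_funTS; exact: measurable_chord_density1.
- by apply: measurable_funTS; apply: measurable_funeM; exact: measurable_chord_density1.
move=> s _; rewrite /chord_density -EFinM lee_fin mulrA ler_wpM2r ?chord_kernel_ge0//.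
rewrite -exprMn -[leLHS]ger0_norm ?sqr_ge0// -[leRHS]ger0_norm ?sqr_ge0// !normrX.
rewrite lerXn2r ?nnegrE ?normr_ge0// normrM; apply: le_trans (wK t s) _.
by rewrite ler_wpM2r// ler_norm.
Qed.

Lemma expR_lipschitz (m M a b : R) : m <= expR a <= M -> m <= expR b <= M ->
  m * `|a - b| <= `|expR a - expR b| <= M * `|a - b|.
Proof.
wlog ab : a b / a <= b => [H ha hb|].
  by have [/H|/ltW/H] := leP a b; [exact|rewrite distrC [`|expR a - _|]distrC; apply].
move=> /andP[ma aM] /andP[mb bM].
have e : expR a <= expR b by rewrite ler_expR.
have h1 := expR_ge1Dx (a - b); have h2 := expR_ge1Dx (b - a).
have pa := expR_gt0 a; have pb := expR_gt0 b.
have e1 : expR b * expR (a - b) = expR a by rewrite -expRD; congr expR; ring.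
have e2 : expR a * expR (b - a) = expR b by rewrite -expRD; congr expR; ring.
rewrite distrC [`|expR a - _|]distrC !ger0_norm ?subr_ge0//.
apply/andP; split.
  have := ler_wpM2l (ltW pa) h2; rewrite e2 => h.
  have : m * (b - a) <= expR a * (b - a) by rewrite ler_wpM2r// subr_ge0.
  lra.
have := ler_wpM2l (ltW pb) h1; rewrite e1 => h.
have : expR b * (b - a) <= M * (b - a) by rewrite ler_wpM2r// subr_ge0.
lra.
Qed.

End lipschitz.

Section periodic_measurability.
Context {R : realType}.
Local Notation mR := (measurableTypeR R).

Definition principal_arg (t : R) : R :=
  t - (Num.floor ((t + pi) / (pi *+ 2)))%:~R * (pi *+ 2).

Lemma principal_arg_arc t : arc (principal_arg t).
Proof.
have pp := @pi_gt0 R; have p2 : 0 < (pi : R) *+ 2 by rewrite mulrn_wgt0.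
have := floor_itv ((t + pi) / (pi *+ 2)).
rewrite intrD ler_pdivlMr// ltr_pdivrMr// => /andP[h1 h2].
rewrite /arc /principal_arg/= in_itv/=; move: h1 h2; move: (_%:~R) => k h1.
by rewrite [1%:~R]mulr1z mulrDl mul1r => h2; apply/andP; split; lra.
Qed.

Lemma expi_principal_arg t : expi (principal_arg t) = expi t.
Proof.
have h (n : nat) (s : R) : expi (s + n%:R * (pi *+ 2)) = expi s.
  by rewrite mulr_natl; apply: (periodicn (T := pi *+ 2)) => u; exact: expi_periodic.
rewrite /principal_arg; case: (Num.floor _) => n.
  by rewrite -[LHS](h n) subrK.
by rewrite NegzE mulrNz mulNr opprK h.
Qed.

Lemma measurable_principal_arg : measurable_fun setT principal_arg.
Proof.
apply: measurable_funB => //; apply: measurable_funM => //.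
apply: nondecreasing_measurable => // s t st; rewrite ler_int le_floor//.
by rewrite ler_wpM2r ?lerD2r// invr_ge0 mulrn_wge0 ?pi_ge0.
Qed.

Lemma measurable_circle (h : R[i] -> R) : measurable_fun arc (h \o expi) ->
  measurable_fun setT (h \o expi : mR -> R).
Proof.
move=> mh.
rewrite (_ : h \o expi = ((h \o expi) \_ arc) \o principal_arg).
  apply: (measurableT_comp _ measurable_principal_arg).
  exact: (measurable_restrictT _ measurable_arc).1.
apply/funext => t; rewrite /= patchE mem_set/= ?expi_principal_arg//.
exact: principal_arg_arc.
Qed.

End periodic_measurability.

Section null_modifications.
Context {R : realType}.
Local Notation mu := (@lebesgue_measure R).
Local Notation mR := (measurableTypeR R).

Lemma wint_ae (A : set R) (u v : R -> R) (k : R -> R[i]) (B : R) :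
  measurable (A : set mR) -> mu (arc `\` A) = 0 ->
  mu.-integrable arc (EFin \o u) -> mu.-integrable arc (EFin \o v) ->
  (forall t, A t -> u t = v t) -> cbounded k B -> wint u k = wint v k.
Proof.
move=> mA A0 iu iv uv hk.
have [u1 u2] := integrable_wint iu hk; have [v1 v2] := integrable_wint iv hk.
have E (f g : R -> R) : mu.-integrable arc (EFin \o f) -> mu.-integrable arc (EFin \o g) ->
    (forall t, A t -> f t = g t) -> \int[mu]_(t in arc) f t = \int[mu]_(t in arc) g t.
  move=> fi gi fg; rewrite /Rintegral; congr fine; apply: ae_eq_integral.
  - exact: measurable_arc.
  - exact: measurable_int fi.
  - exact: measurable_int gi.
  - exists (arc `\` A); split => //; first exact: measurableD measurable_arc mA.
    move=> t /= h; have [ta tA] : arc t /\ ~ A t.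
      split; first by apply: contrapT => ta; apply: h.
      by move=> tA; apply: h => _; rewrite fg.
    by split.
by rewrite /wint /arc_cintegral; congr (_ +i* _); apply: E => // t /uv ->.
Qed.

End null_modifications.

(** * Outer functions *)

Section log_integrability.
Context {R : realType}.
Local Notation mu := (@lebesgue_measure R).
Local Notation mR := (measurableTypeR R).
Variable w : R -> R.
Hypothesis mw : measurable_fun setT w.

Lemma ln_le_sqr (x : R) : 0 < x -> ln x <= x ^+ 2.
Proof.
move=> x0; have := @le_ln1Dx R (x - 1); rewrite (addrC 1) subrK => h.
have h2 : ln x <= x - 1 by apply: h; lra.
by have := sqr_ge0 (x - 2^-1); nra.
Qed.

Lemma measurable_lne : measurable_fun setT (fun t : mR => lne (w t)%:E).
Proof.
rewrite (_ : (fun _ => _) = fun t : mR => if w t <= 0 then -oo%E else (ln (w t))%:E)//.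
apply: measurable_fun_ifT => //; first exact: measurable_fun_ler.
by apply/measurable_EFinP; exact: (measurableT_comp (@measurable_ln R)).
Qed.

Lemma integrable_lne :
  (\int[mu]_(t in arc) (`|w t| ^+ 2)%:E < +oo)%E ->
  (-oo < \int[mu]_(t in arc) lne (w t)%:E)%E ->
  mu.-integrable arc (fun t => lne (w t)%:E).
Proof.
move=> w2 wl; pose g (t : mR) := lne (w t)%:E.
have mg : measurable_fun arc g by apply: measurable_funTS; exact: measurable_lne.
have pos : (\int[mu]_(t in arc) g^\+ t < +oo)%E.
  apply: le_lt_trans w2; apply: ge0_le_integral.
  - exact: measurable_arc.
  - by move=> t _; exact: funepos_ge0.
  - exact: measurable_funepos.
  - apply/measurable_EFinP; apply: measurable_funTS; apply: measurable_funX.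
    exact: measurableT_comp.
  move=> t _; rewrite funeposE /g/= ge_max lee_fin exprn_ge0 ?normr_ge0// andbT.
  case: ifPn => [_|]; first exact: leNye.
  by rewrite -ltNge => w0; rewrite lee_fin (ger0_norm (ltW w0)) ln_le_sqr.
have neg : (\int[mu]_(t in arc) g^\- t < +oo)%E.
  move: wl; rewrite integralE -/g; case: (\int[mu]_(t in arc) g^\- t)%E => [r||]//.
    by rewrite ltry.
  by rewrite /= addeNy.
apply/integrableP; split => //.
rewrite (_ : (\int[mu]_(t in arc) _ = \int[mu]_(t in arc) (g^\+ t + g^\- t))%E); last first.
  by apply: eq_integral => t _; rewrite -[RHS]/((g^\+ \+ g^\-)%E t) -fune_abse.
rewrite ge0_integralD//; first by rewrite lte_add_pinfty.
- exact: measurable_arc.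
- exact: measurable_funepos.
- exact: measurable_funeneg.
Qed.

Hypothesis il : mu.-integrable arc (fun t => lne (w t)%:E).

(* Where w = 0, ln gives 0 and lne gives -oo. *)
Lemma integrable_ln : mu.-integrable arc (EFin \o (fun t => ln (w t))).
Proof.
apply: le_integrable il; first exact: measurable_arc.
  apply: measurable_funTS; apply/measurable_EFinP.
  exact: (measurableT_comp (@measurable_ln R)).
move=> t _ /=; case: ifPn => // w0; rewrite leey//.
Qed.

Lemma ae_gt0 : {ae mu, forall t, arc t -> 0 < w t}.
Proof.
have := integrable_ae measurable_arc il; apply: filterS => t h /h /=.
by case: ifPn => //; rewrite -ltNge.
Qed.

End log_integrability.

Section dirichlet.
Context {R : realType}.
Local Notation mu := (@lebesgue_measure R).
Local Notation mu2 := (mu \x mu)%E.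
Local Notation mR := (measurableTypeR R).
Local Notation Re := complex.Re.
Let T : measurableType _ := (measurableTypeR R * measurableTypeR R)%type.

Lemma integral_scale_lty d (X : measurableType d) (m : {measure set X -> \bar R})
    (f g : X -> R) (K : R) : 0 <= K ->
  measurable_fun setT f -> measurable_fun setT g -> (forall x, 0 <= f x <= K * g x) ->
  (forall x, 0 <= g x) ->
  (\int[m]_x (g x)%:E < +oo -> \int[m]_x (f x)%:E < +oo)%E.
Proof.
move=> K0 mf mg fg g0 h.
apply: (@le_lt_trans _ _ (K%:E * \int[m]_x (g x)%:E)%E); last first.
  by apply: lte_mul_pinfty => //; rewrite lee_fin.
rewrite -ge0_integralZl//; last 2 first.
- exact/measurable_EFinP.
- by move=> x _; rewrite lee_fin.
apply: ge0_le_integral => //.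
- by move=> x _; rewrite lee_fin; case/andP: (fg x).
- exact/measurable_EFinP.
- by apply: measurable_funeM; exact/measurable_EFinP.
- by move=> x _; rewrite -EFinM lee_fin; case/andP: (fg x).
Qed.

Variables (alpha : R) (v : R -> R) (f : R[i] -> R[i]) (m M : R).
Hypothesis iv : mu.-integrable arc (EFin \o v).
Hypothesis fE : forall z, unit_disk z -> cderiv f z = dherglotz v z * cexp (herglotz v z).
Hypothesis m0 : 0 < m.
Hypothesis vm : forall z, unit_disk z -> m <= normc (cexp (herglotz v z)).
Hypothesis vM : forall z, unit_disk z -> normc (cexp (herglotz v z)) <= M.

Let disk_herglotz (p : R * R) : R[i] :=
  herglotz v (toC p) * (\1_([set p : R * R | sqnorm p < 1]) p)%:C.

Let cmeasurable_disk_herglotz : cmeasurable (disk_herglotz : T -> R[i]).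
Proof.
apply: (cmeasurable_on_disk (F := fun n z => fcoef v 0 + \sum_(i < n) (2 * fcoef v i.+1) * z ^+ i.+1)) => [n|z z1].
  apply: cmeasurableD; first exact: cmeasurable_cst.
  apply: (cmeasurable_sum (F := fun i (p : T) => 2 * fcoef v i.+1 * toC p ^+ i.+1)) => i.
  by apply: cmeasurableM; [exact: cmeasurable_cst|apply: cmeasurableX; exact: cmeasurable_toC].
exists (fun n => ((2 * pi)^-1 * (2 * (1 - normc z)^-1 * \int[mu]_(t in arc) `|v t|) *
    (normc (2 : R[i]) * normc z)) * normc z ^+ n).
  by apply: cvg_expr_lt1; rewrite normc_ge0.
move=> n; rewrite opprD addrA; apply: le_trans (herglotz_expansion iv n z1) _.
by rewrite exprS !mulrA.
Qed.

Let density1 p : R := normc (disk_dherglotz v p) ^+ 2 * radial_weight alpha (sqnorm p).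

Let density2 p : R := density1 p * expR (Re (disk_herglotz p)) ^+ 2.

Let dirichlet_integralE : dirichlet_integral alpha f = ((pi^-1)%:E * \int[mu2]_p (density2 p)%:E)%E.
Proof.
rewrite /dirichlet_integral; congr (_ * _)%E; rewrite [LHS]integral_mkcond.
apply: eq_integral => p _; rewrite patchE /density2 /density1 /disk_dherglotz /disk_herglotz.
have [p1|p1] := pselect (unit_disk (toC p)).
  rewrite mem_set// fE// normcM exprMn normc_cexp indicE mem_set; last by rewrite /= -unit_disk_toC.
  rewrite !mulr1 /radial_weight -normc_toC; congr EFin.
  by rewrite -mulrA [X in _ * X]mulrC mulrA.
rewrite memNset// indicE memNset; last by rewrite /= -unit_disk_toC.
by rewrite mulr0 normc0 expr0n !mul0r.
Qed.

Lemma dirichlet_integral_lty :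
  (dirichlet_integral alpha f < +oo)%E <-> (\int[mu2]_p disk_density alpha v p < +oo)%E.
Proof.
have pp := @pi_gt0 R.
have md1 : measurable_fun (setT : set T) density1.
  by have /measurable_EFinP := measurable_disk_density alpha iv.
have md2 : measurable_fun (setT : set T) density2.
  apply: measurable_funM => //; apply: measurable_funX.
  exact: (measurableT_comp (@measurable_expR R) cmeasurable_disk_herglotz.1).
have d10 p : 0 <= density1 p by rewrite mulr_ge0 ?exprn_ge0 ?normc_ge0 ?powR_ge0.
have d12 p : m ^+ 2 * density1 p <= density2 p <= M ^+ 2 * density1 p.
  have [p1|p1] := pselect (unit_disk (toC p)); last first.
    rewrite /density2 /density1 /disk_dherglotz indicE memNset; last by rewrite /= -unit_disk_toC.
    by rewrite mulr0 normc0 expr0n !mul0r !mulr0 lexx.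
  have := vm p1; have := vM p1; rewrite normc_cexp /density2 /disk_herglotz.
  rewrite indicE mem_set; last by rewrite /= -unit_disk_toC.
  rewrite mulr1 => h2 h1; rewrite [_ * expR _ ^+ 2]mulrC.
  have e0 := expR_ge0 (Re (herglotz v (toC p))).
  by rewrite !ler_wpM2r// lerXn2r// nnegrE ?(ltW m0)// (le_trans e0).
have d20 p : 0 <= density2 p by rewrite mulr_ge0// sqr_ge0.
rewrite dirichlet_integralE; split => h.
  apply: (@integral_scale_lty _ _ mu2 density1 density2 (m ^- 2)) => //.
  - by rewrite invr_ge0 sqr_ge0.
  - move=> p; rewrite d10/= -ler_pdivrMl ?invr_gt0 ?exprn_gt0// invrK.
    by case/andP: (d12 p).
  - rewrite (_ : (\int[mu2]_p (density2 p)%:E = pi%:E * (pi^-1%:E * \int[mu2]_p (density2 p)%:E))%E).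
      by apply: lte_mul_pinfty => //; rewrite lee_fin ltW.
    by rewrite muleA -EFinM divff ?mul1e// gt_eqF.
apply: lte_mul_pinfty => //; first by rewrite lee_fin invr_ge0 ltW.
apply: (@integral_scale_lty _ _ mu2 density2 density1 (M ^+ 2)) => //.
- by rewrite sqr_ge0.
- by move=> p; rewrite d20/=; case/andP: (d12 p).
Qed.

End dirichlet.

Section outer_function.
Context {R : realType}.
Local Notation mu := (@lebesgue_measure R).
Local Notation mR := (measurableTypeR R).
Local Notation Re := complex.Re.

Lemma outer_is_derive (h : R[i] -> R) (z : R[i]) :
  mu.-integrable arc (EFin \o (fun t => ln (h (expi t)))) -> unit_disk z ->
  is_derive (z : R[i]^o) 1 (outer h : R[i]^o -> R[i]^o)
    (dherglotz (fun t => ln (h (expi t))) z * cexp (herglotz (fun t => ln (h (expi t))) z)).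
Proof.
move=> iu z1; apply: quad_derive_is_derive.
exact: quad_derive_cexp (quad_derive_herglotz iu z1).
Qed.

Lemma radial_limit_bounds (u : R -> R) (m M t : R) : 0 < m ->
  (forall z, unit_disk z -> m <= normc (cexp (herglotz u z)) <= M) ->
  (fun j => dilate u (radius j) t) @ \oo --> u t -> ln m <= u t <= ln M.
Proof.
move=> m0 bd lim.
have b j : ln m <= dilate u (radius j) t <= ln M.
  have /andP[r0 r1] := radius_lt1 (R := R) j.
  have : unit_disk ((radius j : R)%:C * expi t).
    by rewrite -[unit_disk _]/(is_true (normc _ < 1)) normc_rexpi.
  move=> /bd; rewrite normc_cexp -/(dilate u (radius j) t) => /andP[h1 h2].
  have M0 : 0 < M by exact: lt_le_trans (expR_gt0 _) h2.
  by rewrite -ler_expR -[X in _ && X]ler_expR !lnK// h1 h2.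
have c : cvg ((fun j => dilate u (radius j) t) @ \oo) by apply/cvg_ex; eexists; exact: lim.
rewrite -(cvg_lim _ lim)//; apply/andP; split.
  by apply: limr_ge => //; apply: nearW => j; case/andP: (b j).
by apply: limr_le => //; apply: nearW => j; case/andP: (b j).
Qed.

Lemma NseminormE (alpha : R) (h : R[i] -> R) :
  Nseminorm alpha h = chord_energy alpha arc (h \o expi).
Proof.
apply: eq_integral => t _; apply: eq_integral => s _.
by rewrite /chord_density /chord_kernel -normc_expiB -normrX ger0_norm ?sqr_ge0.
Qed.

End outer_function.

Theorem corollary1p2 (R : realType) (alpha : R) (h : R[i] -> R)
  (alpha_ge0 : 0 <= alpha) (alpha_lt1 : alpha < 1)
  (h_L2 : L2circle h) (h_ge0 : ae_nonneg h)
  (h_log : (-oo < log_integral h)%E)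
  (O_bounded : bounded_on_disk (outer h))
  (O_away0 : bounded_away_from_zero_on_disk (outer h)) :
  dirichlet_space alpha (outer h) <-> (Nseminorm alpha h < +oo)%E.
Proof.
pose mu := @lebesgue_measure R.
have a01 : 0 <= alpha < 1 by rewrite alpha_ge0.
case: O_bounded => M OM; case: O_away0 => m m0 Om.
pose w t := h (expi t); pose u t := ln (w t).
case: h_L2 => /measurable_circle mw w2.
have il := integrable_lne mw w2 h_log.
have iu : mu.-integrable arc (EFin \o u) := integrable_ln mw il.
have mu_ : measurable_fun setT u by exact: (measurableT_comp (@measurable_ln R) mw).
have outerE z : outer h z = cexp (herglotz u z) by [].
have OmM z : unit_disk z -> m <= normc (cexp (herglotz u z)) <= M.
  by move=> z1; rewrite -outerE Om// OM.
have mM : m <= M.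
  have /OmM/andP[] : unit_disk (0 : R[i]).
    by rewrite -[unit_disk _]/(is_true (normc _ < 1)) normc0.
  exact: le_trans.
have M0 : 0 < M by exact: lt_le_trans m0 mM.
have [A1 [mA1 A1arc A10 limA1]] := radial_limits mu_ iu.
have [N [mN N0 hN]] := ae_gt0 il.
pose A := A1 `\` N.
have mA : measurable (A : set (measurableTypeR R)) by exact: measurableD.
have Aarc : A `<=` arc by move=> t [/A1arc].
have A0 : mu (arc `\` A) = 0.
  have m1 : measurable ((arc `\` A1 : set R) : set (measurableTypeR R)).
    exact: measurableD measurable_arc mA1.
  apply: (@subset_measure0 _ _ _ mu _ ((arc `\` A1) `|` N)).
  - exact: measurableD measurable_arc mA.
  - exact: measurableU.
  - move=> t [ta tA]; have [tN|tN] := pselect (N t); first by right.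
    by left; split => // tA1; apply: tA.
  - exact: etrans (measureU0 m1 mN N0) A10.
have wA t : A t -> 0 < w t.
  move=> At; have tN : ~ N t by case: At.
  apply: contrapT => w0; apply: tN; apply: hN => /= h1; apply: w0; apply: h1.
  exact: Aarc.
have uA t : A t -> ln m <= u t <= ln M.
  by case=> /limA1 tA _; exact: radial_limit_bounds m0 OmM tA.
(* u may be unbounded on a null set. *)
pose v t := Num.min (ln M) (Num.max (ln m) (u t)).
have mv : measurable_fun setT v.
  by apply: measurable_minr => //; exact: measurable_maxr.
have lnmM : ln m <= ln M by rewrite ler_ln.
have v_bd t : ln m <= v t <= ln M.
  by rewrite /v le_min lnmM le_max lexx/= ge_min lexx.
have vA t : A t -> u t = v t.
  move=> /uA/andP[h1 h2]; rewrite /v (max_idPr h1); exact/esym/min_idPr.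
have vM t : `|v t| <= `|ln m| + `|ln M|.
  case/andP: (v_bd t) => h1 h2; rewrite ler_norml; apply/andP; split.
    apply: le_trans h1; rewrite lerNl; apply: le_trans (ler_norm _) _.
    by rewrite normrN lerDl.
  by apply: le_trans h2 _; apply: le_trans (ler_norm _) _; rewrite lerDr.
have pv t : v (t + pi *+ 2) = v t by rewrite /v /u /w expi_periodic.
have iv : mu.-integrable arc (EFin \o v) := integrable_arc_bounded mv vM.
have hE z : normc z < 1 -> herglotz u z = herglotz v z.
  by move=> z1; congr (_ * _); exact: wint_ae mA A0 iu iv vA (cbounded_herglotz z1).
have dE z : normc z < 1 -> dherglotz u z = dherglotz v z.
  by move=> z1; congr (_ * _); exact: wint_ae mA A0 iu iv vA (cbounded_dherglotz z1).
have anal : analytic_on_disk (outer h).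
  by move=> z z1; have [] := outer_is_derive iu z1.
have dO z : unit_disk z -> cderiv (outer h) z = dherglotz v z * cexp (herglotz v z).
  by move=> z1; rewrite -hE// -dE//; have [_ <-] := outer_is_derive iu z1.
have e_bd t : m <= expR (v t) <= M.
  by case/andP: (v_bd t) => h1 h2; rewrite -(lnK m0) -(lnK M0) !ler_expR h1 h2.
have mev : measurable_fun setT (expR \o v) by exact: measurableT_comp.
have D : (dirichlet_integral alpha (outer h) < +oo)%E <-> (chord_energy alpha arc v < +oo)%E.
  rewrite -(disk_energy_lty a01 mv vM pv).
  apply: (dirichlet_integral_lty alpha iv dO m0 (M := M)) => z z1.
    by rewrite -hE//; case/andP: (OmM z z1).
  by rewrite -hE//; case/andP: (OmM z z1).
have N' : Nseminorm alpha h = chord_energy alpha arc (expR \o v).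
  rewrite NseminormE; apply: chord_energy_eq mA Aarc A0 mw mev _ => t At /=.
  by rewrite -vA// /u lnK// posrE wA.
rewrite N'; split=> [[_ /D]|].
  apply: (chord_energy_lipschitz (K := M) mev mv) => t s.
  by case/andP: (expR_lipschitz (e_bd t) (e_bd s)) => _ h2; exact: h2.
move=> Nfin; split; first exact: anal.
apply: (proj2 D); move: Nfin.
apply: (chord_energy_lipschitz (K := m^-1) mv mev) => t s.
case/andP: (expR_lipschitz (e_bd t) (e_bd s)) => h1 _.
by rewrite (ler_pdivlMl _ _ m0); exact: h1.
Qed.
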